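(* Let $P_1(x,y)=\sum_{i+j=0}^{4}a_{ij1}x^iy^j$ and $Q_1(x,y)=\sum_{i+j=0}^{4}b_{ij1}x^iy^j$ be real polynomials of degree at most $4$ with free coefficients, and let $$M_1(h)=\oint_{\Gamma_h}Q_1(x,y)\,\mathrm{d}x-P_1(x,y)\,\mathrm{d}y,\qquad h\in\Big(-\frac1{20},0\Big),$$ where $\Gamma_h$ are the periodic orbits of $\dot x=y,\ \dot y=x^3(1-x)$ described in the context. If $M_1(h)\not\equiv0$, there exists $0<\varepsilon_0\ll1$ such that $M_1(h)$ has at most $5$ zeros (counting multiplicity) on the interval $h\in(-\varepsilon_0,0)$. This upper bound can be reached by simple zeros for suitable values of the parameters. Furthermore, $M_1(h)\equiv0$ if and only if $$a_{121}=-3b_{031},\quad b_{111}=-2a_{201},\quad a_{101}=-b_{011},\quad 3b_{131}=-2a_{221},\quad b_{211}=-3a_{301},\quad b_{311}=-4a_{401}.$$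
   Context: The system $\dot x=y,\ \dot y=x^3(1-x)$ is Hamiltonian with $H(x,y)=\frac12y^2-\frac14x^4+\frac15x^5$. It has an elementary center $(1,0)$ and a nilpotent saddle $(0,0)$. Surrounding $(1,0)$ there is a continuous family of periodic orbits $\Gamma_h\subset H^{-1}(h)$, $h\in(-\frac1{20},0)$, bounded by the homoclinic loop $\Gamma_0$ passing through the origin; $\Gamma_h$ is oriented by the flow. $M_1$ is the first-order Melnikov function, i.e. the coefficient of $\varepsilon$ in the expansion $d(h,\varepsilon)=\varepsilon M_1(h)+\varepsilon^2M_2(h)+\cdots$ of the bifurcation function of the perturbed system $\dot x=y+\sum_{k\ge1}\varepsilon^kP_k(x,y)$, $\dot y=x^3(1-x)+\sum_{k\ge1}\varepsilon^kQ_k(x,y)$, $|\varepsilon|\ll 1$, with $P_k=\sum_{i+j=0}^4a_{ijk}x^iy^j$ and $Q_k=\sum_{i+j=0}^4b_{ijk}x^iy^j$. The notation $0<\varepsilon_0\ll1$ means $\varepsilon_0>0$ sufficiently small. *)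

(* Defs.v *)
From Stdlib Require Export Reals List.
From Coquelicot Require Export Coquelicot.

Open Scope R_scope.

Definition H (x y : R) : R := y ^ 2 / 2 - x ^ 4 / 4 + x ^ 5 / 5.

Definition is_solution (x y : R -> R) : Prop :=
  forall t : R,
    is_derive x t (y t) /\ is_derive y t (x t ^ 3 * (1 - x t)).

(* T is the least period: for an autonomous system the orbit is then traversed
   exactly once, in the direction of the flow, when t runs over [0, T]. *)
Definition periodic_orbit (x y : R -> R) (T : R) : Prop :=
  is_solution x y /\
  0 < T /\
  (forall t : R, x (t + T) = x t /\ y (t + T) = y t) /\
  (forall s : R, 0 < s < T -> ~ (x s = x 0 /\ y s = y 0)).

(* For -1/20 < h < 0 the level set {H = h} does not meet the line x = 0; its
   part in x > 0 is the oval surrounding the center (1,0), and its part in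
   x < 0 is unbounded and contains no periodic orbit. *)
Definition is_Gamma (h : R) (x y : R -> R) (T : R) : Prop :=
  periodic_orbit x y T /\
  (forall t : R, H (x t) (y t) = h) /\
  (forall t : R, 0 < x t).

(* sum of c i j * x^i * y^j over i + j <= 4; other entries of c are ignored *)
Definition quartic (c : nat -> nat -> R) (x y : R) : R :=
  sum_n (fun i : nat =>
    sum_n (fun j : nat => c i j * x ^ i * y ^ j) (4 - i)) 4.

(* v is the integral of Q dx - P dy along the curve (x, y) on [0, T]. *)
Definition is_line_integral (P Q : R -> R -> R) (x y : R -> R) (T v : R)
    : Prop :=
  is_RInt (fun t : R => Q (x t) (y t) * Derive x t - P (x t) (y t) * Derive y t)
    0 T v.

(* Any two parametrizations of Gamma_h by the flow differ by a time shift, so v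
   does not depend on the one chosen; iota selects this unique value. *)
Definition M1 (a b : nat -> nat -> R) (h : R) : R :=
  iota (fun v : R =>
    exists (x y : R -> R) (T : R),
      is_Gamma h x y T /\ is_line_integral (quartic a) (quartic b) x y T v).

Definition M1_vanishes (a b : nat -> nat -> R) : Prop :=
  forall h : R, - (1 / 20) < h < 0 -> M1 a b h = 0.

(* z is a zero of f of multiplicity at least m (no condition if m = 0) *)
Definition zero_of_order (f : R -> R) (m : nat) (z : R) : Prop :=
  forall k : nat, (k < m)%nat -> Derive_n f k z = 0.

(* An entry (z, m) of l stands for a zero z of multiplicity at least m, so a
   zero of infinite order would violate the bound. *)
Definition at_most_zeros_mult (f : R -> R) (lo hi : R) (N : nat) : Prop :=
  forall l : list (R * nat),
    NoDup (map fst l) ->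
    (forall z m, In (z, m) l -> lo < z < hi /\ zero_of_order f m z) ->
    (list_sum (map snd l) <= N)%nat.

Definition simple_zero (f : R -> R) (z : R) : Prop :=
  f z = 0 /\ exists d : R, is_derive f z d /\ d <> 0.

Definition has_simple_zeros (f : R -> R) (lo hi : R) (N : nat) : Prop :=
  exists l : list R,
    NoDup l /\ length l = N /\
    (forall z, In z l -> lo < z < hi /\ simple_zero f z).

(* Main.v *)
(** The function [phi x = (x - 1) sqrt ((4 x^3 + 3 x^2 + 2 x + 1) / 10)] turns the ovals
    of [H] into circles [phi x^2 + y^2 = 2 h + 1/10], on which the flow is a rotation with
    positive angular speed. This gives existence of [Gamma_h], independence of the
    parametrization, and smooth formulas for the integrals [I_n = oint x^n y dx] and
    [K_n = I_n' = oint x^n dx / y].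

    By Green's formula and the symmetry in [y], [M1] is a combination of [I_0], [I_1],
    [I_2], [I_3], [h I_0], [h I_1] with coefficients given by the six linear forms of the
    theorem. With [theta = h d/dh], the Picard-Fuchs system becomes, in suitable
    combinations [Y0], [Y1], [Y2] and [I_3], the triangular system
    [(theta - p) Y = k h K_3] with [p = 3/4, 1, 5/4, 0]. Integrating it twice gives, with
    [s = - h], expansions in [1, s^(3/4), s ln s, s, s^(5/4), s^(7/4)] up to
    [O(s^(15/8))], where the remainders keep their order under [theta]. The coefficients of
    [s^(3/4)] and [s^(5/4)] do not vanish because [s^(1/4) oint y dx / x^4] and
    [s^(3/4) oint y dx / x^6] decrease in [s], the others because [I_1] and [I_3] have
    positive limits. Hence the map from the six parameters to the six leading
    coefficients is injective.

    If a combination has six zeros in [(- e, 0)], then applying [theta], [theta - 3/4],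
    [theta - 1], [theta - 1], [theta - 5/4] and Rolle's theorem bounds every coefficient by
    a constant times [e^(1/8)] times the largest one, so for small [e] all vanish. This is
    uniform in the parameters; five simple zeros are then obtained by interpolation. *)

Require Import Defs.
From Stdlib Require Import Reals List.
From Coquelicot Require Import Coquelicot.
From Stdlib Require Import Lra Lia Ranalysis5.

(** The saddle at the origin is nilpotent, so at the loop the integrals carry fractional powers of
    [s] and a logarithm. Plain differentiation in [h] would cost a power of [s] at each step; this
    is why everything is phrased with [theta]. A factor [theta - p] removes exactly the term [s^p],
    and the exponent 1 takes two factors because of [s ln s]. The logarithm is paid for with a small
    power, fixed once by [|ln s| <= 8 s^(-1/8)]. This is the origin of the order 7/8 given to
    [s ln s], of [15/8 = 1 + 7/8], which still exceeds the last retained exponent 7/4, and of the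
    gain 1/8 in the final estimate. Of the leading coefficients only the nonvanishing matters, so
    lower bounds by monotonicity stand in for their values. Negative powers of [x] are useful there
    because the corresponding integrals blow up at the loop at a rate that the energy and exactness
    relations bound from below. One interval must serve all parameters, hence the remainder is
    measured against the largest of them. Multiplicities are carried through Rolle's theorem; they
    also give simplicity of the interpolated zeros, since a double one would count as a sixth
    zero. *)

(** * Monotone functions and derivatives of inverses *)

Lemma deriv_pos_increasing (f df : R -> R) (a b : R) :
  a < b ->
  (forall x, a <= x <= b -> is_derive f x (df x)) ->
  (forall x, a <= x <= b -> 0 < df x) ->
  f a < f b.
Proof.
  intros Hab Hd Hpos.
  destruct (MVT_gen f a b df) as [c [Hc E]].
  - intros x; rewrite Rmin_left, Rmax_right by lra; intros; apply Hd; lra.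
  - intros x; rewrite Rmin_left, Rmax_right by lra; intros Hx.
    apply continuity_pt_filterlim. apply (ex_derive_continuous f x).
    exists (df x); apply Hd; lra.
  - rewrite Rmin_left, Rmax_right in Hc by lra.
    specialize (Hpos c Hc). nra.
Qed.

Lemma deriv_nonneg_le (f df : R -> R) (a b : R) :
  a <= b ->
  (forall x, a <= x <= b -> is_derive f x (df x)) ->
  (forall x, a <= x <= b -> 0 <= df x) ->
  f a <= f b.
Proof.
  intros Hab Hd Hpos.
  destruct (MVT_gen f a b df) as [c [Hc E]].
  - intros x; rewrite Rmin_left, Rmax_right by lra; intros; apply Hd; lra.
  - intros x; rewrite Rmin_left, Rmax_right by lra; intros Hx.
    apply continuity_pt_filterlim. apply (ex_derive_continuous f x).
    exists (df x); apply Hd; lra.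
  - rewrite Rmin_left, Rmax_right in Hc by lra.
    specialize (Hpos c Hc). nra.
Qed.

(** The difference quotient of [g] is the reciprocal of one of [f]: the intermediate value theorem
    on [[x0 - d, x0 + d]] writes [f x0 + k] as some [f x], so continuity of [g] is obtained rather
    than assumed. The domain [D] is an open interval in disguise; it is used with [(0, 5/4)] and
    with the whole line. *)
Lemma inverse_derive (D : R -> Prop) (f df g : R -> R) :
  (forall x y z, D x -> D z -> x <= y <= z -> D y) ->
  (forall x, D x -> exists e, 0 < e /\ D (x - e) /\ D (x + e)) ->
  (forall x, D x -> is_derive f x (df x)) ->
  (forall x, D x -> 0 < df x) ->
  (forall x, D x -> g (f x) = x) ->
  forall x, D x -> is_derive g (f x) (/ df x).
Proof.
  intros Hconv Hopen Hd Hpos Hg x0 Hx0.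
  assert (Hdf := Hpos x0 Hx0).
  apply is_derive_Reals. intros eps Heps.
  (* The first bound keeps the slope [m] above [df x0 / 2]; with it the second one makes
     [|df x0 - m| / (m * df x0)] smaller than [eps]. *)
  pose (eta := Rmin (df x0 / 2) (eps * (df x0 * df x0) / 4)).
  assert (Heta : 0 < eta).
  { apply Rmin_glb_lt; [lra|].
    assert (0 < eps * (df x0 * df x0)) by (apply Rmult_lt_0_compat; nra). lra. }
  assert (He1 : eta <= df x0 / 2) by apply Rmin_l.
  assert (He2 : eta <= eps * (df x0 * df x0) / 4) by apply Rmin_r.
  pose proof (proj1 (is_derive_Reals _ _ _) (Hd x0 Hx0) eta Heta) as [d1 Hd1].
  destruct (Hopen x0 Hx0) as [e [He [Dm Dp]]].
  pose (d := Rmin e (d1 / 2)).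
  assert (Hd0 : 0 < d) by (apply Rmin_glb_lt; [lra|destruct d1; simpl; lra]).
  assert (Hde : d <= e) by apply Rmin_l.
  assert (Hdd : d < d1) by (assert (d <= d1 / 2) by apply Rmin_r; destruct d1; simpl in *; lra).
  assert (D1 : D (x0 - d)) by (apply (Hconv (x0 - e) _ x0); auto; lra).
  assert (D2 : D (x0 + d)) by (apply (Hconv x0 _ (x0 + e)); auto; lra).
  assert (I1 : f (x0 - d) < f x0).
  { apply (deriv_pos_increasing f df); [lra| |]; intros x Hx;
      [apply Hd|apply Hpos]; apply (Hconv (x0 - d) _ x0); auto; lra. }
  assert (I2 : f x0 < f (x0 + d)).
  { apply (deriv_pos_increasing f df); [lra| |]; intros x Hx;
      [apply Hd|apply Hpos]; apply (Hconv x0 _ (x0 + d)); auto; lra. }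
  pose (dl := Rmin (f x0 - f (x0 - d)) (f (x0 + d) - f x0)).
  assert (Hdl : 0 < dl) by (apply Rmin_glb_lt; lra).
  exists (mkposreal dl Hdl). intros k Hk0 Hk. simpl in Hk.
  assert (K1 : dl <= f x0 - f (x0 - d)) by apply Rmin_l.
  assert (K2 : dl <= f (x0 + d) - f x0) by apply Rmin_r.
  apply Rabs_def2 in Hk.
  destruct (f_interv_is_interv f (x0 - d) (x0 + d) (f x0 + k)) as [x [Hx Ex]];
    [lra|lra| |].
  { intros a Ha. apply continuity_pt_filterlim. apply (ex_derive_continuous f a).
    exists (df a); apply Hd; apply (Hconv (x0 - d) _ (x0 + d)); auto; lra. }
  assert (Dx : D x) by (apply (Hconv (x0 - d) _ (x0 + d)); auto; lra).
  rewrite <- Ex, (Hg x Dx), (Hg x0 Hx0).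
  assert (Hne : x - x0 <> 0) by (intro Z; replace x with x0 in Ex by lra; lra).
  specialize (Hd1 (x - x0) Hne).
  replace (x0 + (x - x0)) with x in Hd1 by ring.
  assert (Hab : Rabs (x - x0) < d1) by (apply Rabs_def1; lra).
  specialize (Hd1 Hab).
  replace k with (f x - f x0) by lra.
  set (m := (f x - f x0) / (x - x0)) in *.
  apply Rabs_def2 in Hd1.
  assert (Hm : df x0 / 2 < m) by lra.
  replace ((x - x0) / (f x - f x0)) with (/ m).
  2: { unfold m. field. split; [lra|exact Hne]. }
  replace (/ m - / df x0) with ((df x0 - m) / (m * df x0)) by (field; lra).
  assert (Hmd : 0 < m * df x0) by (apply Rmult_lt_0_compat; lra).
  unfold Rdiv. rewrite Rabs_mult, (Rabs_right (/ _)) by (apply Rle_ge, Rlt_le, Rinv_0_lt_compat; lra).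
  apply (Rmult_lt_reg_r (m * df x0)); [lra|].
  rewrite Rmult_assoc, Rinv_l, Rmult_1_r by lra.
  apply Rlt_le_trans with eta; [apply Rabs_def1; lra|].
  apply Rle_trans with (1 := He2).
  assert (df x0 / 2 * df x0 <= m * df x0) by (apply Rmult_le_compat_r; lra).
  nra.
Qed.

(** * The coordinate in which the ovals are circles *)

Definition q (x : R) : R := sqrt ((4 * x ^ 3 + 3 * x ^ 2 + 2 * x + 1) / 10).

(* [phi x ^ 2 / 2 = H x 0 + 1 / 20]: with [u = phi x] the levels of [H] become circles. *)
Definition phi (x : R) : R := (x - 1) * q x.

Lemma radicand_pos (x : R) : 0 <= x -> 0 < (4 * x ^ 3 + 3 * x ^ 2 + 2 * x + 1) / 10.
Proof.
  intros Hx. assert (0 <= x ^ 3) by (apply pow_le; lra).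
  assert (0 <= x ^ 2) by (apply pow_le; lra). lra.
Qed.

Lemma q_pos (x : R) : 0 <= x -> 0 < q x.
Proof. intros Hx. apply sqrt_lt_R0, radicand_pos, Hx. Qed.

Lemma q_sqr (x : R) : 0 <= x -> q x * q x = (4 * x ^ 3 + 3 * x ^ 2 + 2 * x + 1) / 10.
Proof. intros Hx. apply sqrt_sqrt, Rlt_le, radicand_pos, Hx. Qed.

Lemma phi_sqr (x : R) : 0 <= x -> phi x ^ 2 / 2 = 1 / 20 - x ^ 4 / 4 + x ^ 5 / 5.
Proof.
  intros Hx. unfold phi.
  (* The quintic [2 (H x 0 + 1/20)] has a double root at the center [x = 1]; the cubic under the
     square root in [q] is the remaining factor. *)
  replace (((x - 1) * q x) ^ 2) with ((x - 1) ^ 2 * (q x * q x)) by ring.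
  rewrite q_sqr by easy. field.
Qed.

Lemma phi_derive (x : R) : 0 <= x -> is_derive phi x (x ^ 3 / q x).
Proof.
  intros Hx. assert (Hr := radicand_pos x Hx). assert (Hq := q_pos x Hx).
  assert (Hs := q_sqr x Hx).
  unfold phi. unfold q at 1. auto_derive.
  - lra.
  - replace (4 * (x * (x * (x * 1))) + 3 * (x * (x * 1)) + 2 * x + 1)
      with (4 * x ^ 3 + 3 * x ^ 2 + 2 * x + 1) by ring.
    change (sqrt ((4 * x ^ 3 + 3 * x ^ 2 + 2 * x + 1) * / 10)) with (q x).
    apply (Rmult_eq_reg_r (q x)); [|lra].
    field_simplify; [|lra|lra].
    replace (q x ^ 2) with (q x * q x) by ring. rewrite Hs. field.
Qed.

(** [5 / 4] is where the homoclinic loop crosses the positive axis: [H x 0 = x^4 (x/5 - 1/4)]. The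
    circle of the loop has squared radius [1 / 10]. *)
Lemma phi_range (x : R) : 0 < x < 5 / 4 -> phi x ^ 2 < 1 / 10.
Proof.
  intros Hx. assert (E := phi_sqr x ltac:(lra)).
  assert (0 < x ^ 4) by (apply pow_lt; lra).
  replace (x ^ 5) with (x * x ^ 4) in E by ring. nra.
Qed.

Lemma phi_range_inv (x : R) : 0 < x -> phi x ^ 2 < 1 / 10 -> x < 5 / 4.
Proof.
  intros Hx. assert (E := phi_sqr x ltac:(lra)).
  assert (0 < x ^ 4) by (apply pow_lt; lra).
  replace (x ^ 5) with (x * x ^ 4) in E by ring. nra.
Qed.

Lemma phi_surj (u : R) : u ^ 2 < 1 / 10 -> exists x, 0 < x < 5 / 4 /\ phi x = u.
Proof.
  intros Hu.
  assert (E0 := phi_sqr 0 ltac:(lra)). assert (E1 := phi_sqr (5 / 4) ltac:(lra)).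
  assert (Q0 := q_pos 0 ltac:(lra)). assert (Q1 := q_pos (5 / 4) ltac:(lra)).
  assert (N0 : phi 0 < 0) by (unfold phi; nra).
  assert (N1 : 0 < phi (5 / 4)) by (unfold phi; nra).
  assert (L0 : phi 0 < u) by (apply Rnot_le_lt; intro; nra).
  assert (L1 : u < phi (5 / 4)) by (apply Rnot_le_lt; intro; nra).
  destruct (f_interv_is_interv phi 0 (5 / 4) u) as [x [Hx Ex]]; [lra|lra| |].
  { intros a Ha. apply continuity_pt_filterlim. apply (ex_derive_continuous phi a).
    eexists; apply phi_derive; lra. }
  exists x. split; [|exact Ex].
  split.
  - destruct (proj1 Hx); [lra|subst; lra].
  - destruct (proj2 Hx); [lra|subst; lra].
Qed.

Lemma phi_lt (x y : R) : 0 < x -> x < y -> phi x < phi y.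
Proof.
  intros Hx Hxy. apply (deriv_pos_increasing phi (fun x => x ^ 3 / q x)); [lra| |];
    intros z Hz.
  - apply phi_derive; lra.
  - apply Rdiv_lt_0_compat; [apply pow_lt; lra|apply q_pos; lra].
Qed.

Lemma phi_inj (x y : R) : 0 < x -> 0 < y -> phi x = phi y -> x = y.
Proof.
  intros Hx Hy E. destruct (Rtotal_order x y) as [L|[L|L]]; [|exact L|];
    apply phi_lt in L; lra.
Qed.

Definition X (u : R) : R := iota (fun x : R => 0 < x < 5 / 4 /\ phi x = u).

Lemma X_spec (u : R) : u ^ 2 < 1 / 10 -> 0 < X u < 5 / 4 /\ phi (X u) = u.
Proof.
  intros Hu. apply (iota_correct (fun x : R => 0 < x < 5 / 4 /\ phi x = u)).
  destruct (phi_surj u Hu) as [x [Hx Ex]]. exists x; split; [auto|].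
  intros y [Hy Ey]. apply phi_inj; lra.
Qed.

Lemma X_phi (x : R) : 0 < x < 5 / 4 -> X (phi x) = x.
Proof.
  intros Hx. destruct (X_spec (phi x) (phi_range x Hx)) as [A B].
  apply phi_inj; lra.
Qed.

(** The derivative of the inverse [X] of [phi], and also the time spent per unit angle: along the
    flow [u' = y / dX u] and [y' = - u / dX u]. It is unbounded as [X u] tends to 0, that is, at the
    saddle. *)
Definition dX (u : R) : R := q (X u) / X u ^ 3.

Lemma dX_pos (u : R) : u ^ 2 < 1 / 10 -> 0 < dX u.
Proof.
  intros Hu. destruct (X_spec u Hu) as [A _].
  apply Rdiv_lt_0_compat; [apply q_pos; lra|apply pow_lt; lra].
Qed.

Lemma X_derive (u : R) : u ^ 2 < 1 / 10 -> is_derive X u (dX u).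
Proof.
  intros Hu. destruct (X_spec u Hu) as [A E].
  rewrite <- E at 1. unfold dX.
  assert (Hq := q_pos (X u) ltac:(lra)).
  replace (q (X u) / X u ^ 3) with (/ (X u ^ 3 / q (X u))) by (field; lra).
  apply (inverse_derive (fun x => 0 < x < 5 / 4) phi (fun x => x ^ 3 / q x)).
  - intros; lra.
  - intros x Hx. exists (Rmin x (5 / 4 - x) / 2).
    assert (Rmin x (5 / 4 - x) <= x) by apply Rmin_l.
    assert (Rmin x (5 / 4 - x) <= 5 / 4 - x) by apply Rmin_r.
    assert (0 < Rmin x (5 / 4 - x)) by (apply Rmin_glb_lt; lra). lra.
  - intros; apply phi_derive; lra.
  - intros x Hx. apply Rdiv_lt_0_compat; [apply pow_lt; lra|apply q_pos; lra].
  - apply X_phi.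
  - lra.
Qed.

(* The Hamiltonian equation [y' = x^3 (1 - x)] in the coordinate [u]. *)
Lemma X_force (u : R) : u ^ 2 < 1 / 10 -> X u ^ 3 * (1 - X u) * dX u = - u.
Proof.
  intros Hu. destruct (X_spec u Hu) as [A E].
  unfold phi in E. unfold dX.
  transitivity (- ((X u - 1) * q (X u))); [field|]; lra.
Qed.

Lemma X_level (u : R) : u ^ 2 < 1 / 10 ->
  u ^ 2 = 1 / 10 - X u ^ 4 / 2 + 2 * X u ^ 5 / 5.
Proof.
  intros Hu. destruct (X_spec u Hu) as [A E].
  assert (S := phi_sqr (X u) ltac:(lra)). rewrite E in S. lra.
Qed.

Ltac as_R := match goal with |- @eq _ ?a ?b => change (@eq R a b) end.

(** * Integrals along the ovals *)

Definition rad (h : R) : R := sqrt (2 * h + 1 / 10).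

(** Phase and sign are chosen so that [uu' = yy] and [yy' = - uu]: the circle is run in the
    direction of the flow, starting at its leftmost point, where [y = 0]. *)
Definition uu (h t : R) : R := - rad h * cos t.
Definition yy (h t : R) : R := rad h * sin t.

Definition oval_level (h : R) : Prop := - (1 / 20) < h < 0.

Lemma rad_pos (h : R) : oval_level h -> 0 < rad h.
Proof. intros Hh. apply sqrt_lt_R0. unfold oval_level in Hh; lra. Qed.

Lemma rad_sqr (h : R) : oval_level h -> rad h * rad h = 2 * h + 1 / 10.
Proof. intros Hh. apply sqrt_sqrt. unfold oval_level in Hh; lra. Qed.

Lemma rad_derive (h : R) : oval_level h -> is_derive rad h (/ rad h).
Proof.
  intros Hh. unfold oval_level in Hh. assert (Hr := rad_pos h Hh). unfold rad at 1.
  auto_derive; [lra|].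
  replace (2 * h + 1 * / 10) with (2 * h + 1 / 10) by field. fold (rad h).
  field. lra.
Qed.

Lemma cos_sin_sqr (t : R) : cos t ^ 2 + sin t ^ 2 = 1.
Proof. generalize (sin2_cos2 t); unfold Rsqr; lra. Qed.

Lemma uu_yy (h t : R) : oval_level h -> uu h t ^ 2 + yy h t ^ 2 = 2 * h + 1 / 10.
Proof.
  intros Hh. unfold uu, yy. rewrite <- (rad_sqr h Hh).
  generalize (cos_sin_sqr t). intros E.
  replace ((- rad h * cos t) ^ 2 + (rad h * sin t) ^ 2)
    with (rad h * rad h * (cos t ^ 2 + sin t ^ 2)) by ring.
  rewrite E; ring.
Qed.

Lemma uu_range (h t : R) : oval_level h -> uu h t ^ 2 < 1 / 10.
Proof.
  intros Hh. assert (E := uu_yy h t Hh). unfold oval_level in Hh.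
  assert (0 <= yy h t ^ 2) by apply pow2_ge_0. lra.
Qed.

Lemma XX_range (h t : R) : oval_level h -> 0 < X (uu h t) < 5 / 4.
Proof. intros Hh. apply X_spec, uu_range, Hh. Qed.

Lemma yy_level (h t : R) : oval_level h ->
  yy h t ^ 2 = 2 * h + X (uu h t) ^ 4 / 2 - 2 * X (uu h t) ^ 5 / 5.
Proof.
  intros Hh. assert (E := uu_yy h t Hh).
  assert (F := X_level _ (uu_range h t Hh)). lra.
Qed.

Lemma uu_derive (h t : R) : is_derive (uu h) t (yy h t).
Proof. unfold uu, yy. auto_derive; [exact I|ring]. Qed.

Lemma yy_derive (h t : R) : is_derive (yy h) t (- uu h t).
Proof. unfold uu, yy. auto_derive; [exact I|ring]. Qed.

Lemma uu_derive_h (h t : R) : oval_level h -> is_derive (fun z => uu z t) h (- cos t / rad h).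
Proof.
  intros Hh. assert (Hr := rad_pos h Hh). unfold uu.
  apply (is_derive_ext (fun z => - cos t * rad z)); [intros; simpl; ring|].
  replace (- cos t / rad h) with (- cos t * / rad h) by (unfold Rdiv; ring).
  apply is_derive_scal. apply rad_derive, Hh.
Qed.

Lemma continuous_XX (g : R -> R) (u : R) :
  u ^ 2 < 1 / 10 -> (forall x, 0 < x -> continuous g x) ->
  continuous (fun u => g (X u)) u.
Proof.
  intros Hu Hg. apply continuous_comp.
  - apply (ex_derive_continuous X). eexists. apply X_derive, Hu.
  - apply Hg. apply X_spec, Hu.
Qed.

Lemma q_continuous (x : R) : 0 < x -> continuous q x.
Proof.
  intros Hx. apply (ex_derive_continuous q). unfold q. auto_derive.
  generalize (radicand_pos x ltac:(lra)). simpl. lra.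
Qed.

Lemma dX_continuous (u : R) : u ^ 2 < 1 / 10 -> continuous dX u.
Proof.
  intros Hu. unfold dX.
  apply (continuous_XX (fun x => q x / x ^ 3) u Hu).
  intros x Hx. apply (continuous_mult (K := R_AbsRing) q (fun x => / x ^ 3)).
  - apply q_continuous, Hx.
  - apply (ex_derive_continuous (fun x => / x ^ 3)). auto_derive.
    assert (0 < x ^ 3) by (apply pow_lt; lra). simpl in *; lra.
Qed.

Lemma continuous_uu (F : R -> R) (h t : R) :
  oval_level h -> (forall u, u ^ 2 < 1 / 10 -> continuous F u) ->
  continuous (fun t => F (uu h t)) t.
Proof.
  intros Hh HF. apply continuous_comp.
  - apply (ex_derive_continuous (uu h)). eexists; apply uu_derive.
  - apply HF, uu_range, Hh.
Qed.

Lemma yy_continuous (h t : R) (m : nat) : continuous (fun t => yy h t ^ m) t.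
Proof.
  apply (ex_derive_continuous (fun t => yy h t ^ m)). unfold yy. auto_derive. exact I.
Qed.

(* [J g m h = oint g(x) y^m dt = oint g(x) y^(m-1) dx]; the time differential along the
   circle is [dX (uu h t) dt]. *)
Definition J (g : R -> R) (m : nat) (h : R) : R :=
  RInt (fun t => g (X (uu h t)) * dX (uu h t) * yy h t ^ m) 0 (2 * PI).

Lemma J_cont (g : R -> R) (m : nat) (h : R) :
  oval_level h -> (forall x, 0 < x -> continuous g x) ->
  forall t, continuous (fun t => g (X (uu h t)) * dX (uu h t) * yy h t ^ m) t.
Proof.
  intros Hh Hg t.
  apply (continuous_mult (K := R_AbsRing)
    (fun t => g (X (uu h t)) * dX (uu h t)) (fun t => yy h t ^ m)).
  - apply (continuous_uu (fun u => g (X u) * dX u)); [exact Hh|].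
    intros u Hu. apply (continuous_mult (K := R_AbsRing) (fun u => g (X u)) dX).
    + apply continuous_XX; auto.
    + apply dX_continuous, Hu.
  - apply yy_continuous.
Qed.

Lemma J_ex (g : R -> R) (m : nat) (h a b : R) :
  oval_level h -> (forall x, 0 < x -> continuous g x) ->
  ex_RInt (fun t => g (X (uu h t)) * dX (uu h t) * yy h t ^ m) a b.
Proof.
  intros Hh Hg. apply (ex_RInt_continuous (V := R_CompleteNormedModule)).
  intros t _. apply J_cont; auto.
Qed.

Lemma J_ext (f g : R -> R) (m : nat) (h : R) :
  oval_level h -> (forall x, 0 < x -> f x = g x) -> J f m h = J g m h.
Proof.
  intros Hh E. apply RInt_ext. intros t _. rewrite E; [reflexivity|].
  apply XX_range, Hh.
Qed.

Lemma J_plus (f g : R -> R) (m : nat) (h : R) :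
  oval_level h -> (forall x, 0 < x -> continuous f x) -> (forall x, 0 < x -> continuous g x) ->
  J (fun x => f x + g x) m h = J f m h + J g m h.
Proof.
  intros Hh Hf Hg. unfold J.
  rewrite <- (RInt_plus (V := R_CompleteNormedModule)) by (apply J_ex; auto).
  apply RInt_ext. intros t _. unfold plus; simpl. ring.
Qed.

Lemma J_scal (c : R) (f : R -> R) (m : nat) (h : R) :
  oval_level h -> (forall x, 0 < x -> continuous f x) ->
  J (fun x => c * f x) m h = c * J f m h.
Proof.
  intros Hh Hf. unfold J.
  rewrite <- (RInt_scal (V := R_CompleteNormedModule)) by (apply J_ex; auto).
  apply RInt_ext. intros t _. unfold scal; simpl; unfold mult; simpl. ring.
Qed.

Lemma J_pos (g : R -> R) (h : R) :
  oval_level h -> (forall x, 0 < x -> continuous g x) ->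
  (forall x, 0 < x < 5 / 4 -> 0 < g x) -> 0 < J g 0 h.
Proof.
  intros Hh Hc Hg. apply RInt_gt_0.
  - generalize PI_RGT_0; lra.
  - intros t _. rewrite pow_O, Rmult_1_r. apply Rmult_lt_0_compat.
    + apply Hg, XX_range, Hh.
    + apply dX_pos, uu_range, Hh.
  - intros t _. apply J_cont; auto.
Qed.

Lemma J_nonneg (g : R -> R) (h : R) :
  oval_level h -> (forall x, 0 < x -> continuous g x) ->
  (forall x, 0 < x < 5 / 4 -> 0 <= g x) -> 0 <= J g 2 h.
Proof.
  intros Hh Hc Hg. apply RInt_ge_0.
  - generalize PI_RGT_0; lra.
  - apply J_ex; auto.
  - intros t _. apply Rmult_le_pos; [|apply pow2_ge_0]. apply Rmult_le_pos.
    + apply Hg, XX_range, Hh.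
    + apply Rlt_le, dX_pos, uu_range, Hh.
Qed.

Lemma J_level (g : R -> R) (m : nat) (h : R) : oval_level h ->
  J g (S (S m)) h = J (fun x => g x * (2 * h + x ^ 4 / 2 - 2 * x ^ 5 / 5)) m h.
Proof.
  intros Hh. apply RInt_ext. intros t _.
  rewrite <- (yy_level h t Hh). simpl. ring.
Qed.

Lemma yy_ends (h : R) : yy h 0 = 0 /\ yy h (2 * PI) = 0.
Proof. unfold yy. rewrite sin_0, sin_2PI. split; ring. Qed.

(* The integral of [d (G x * y ^ (m + 1))] along the orbit vanishes. *)
Lemma J_parts (G g : R -> R) (m : nat) (h : R) :
  oval_level h -> (forall x, 0 < x -> is_derive G x (g x)) ->
  (forall x, 0 < x -> continuous g x) ->
  J g (S (S m)) h = INR (S m) * J (fun x => G x * (x ^ 4 - x ^ 3)) m h.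
Proof.
  intros Hh HG Hg.
  assert (HcG : forall x, 0 < x -> continuous G x).
  { intros x Hx. apply (ex_derive_continuous G). eexists; apply HG, Hx. }
  assert (HcP : forall x, continuous (fun x => x ^ 4 - x ^ 3) x).
  { intros x. apply (ex_derive_continuous (fun x => x ^ 4 - x ^ 3)). auto_derive. exact I. }
  assert (HcGP : forall x, 0 < x -> continuous (fun x => G x * (x ^ 4 - x ^ 3)) x).
  { intros x Hx. apply (continuous_mult (K := R_AbsRing) G); auto. }
  assert (Ex1 := J_ex g (S (S m)) h 0 (2 * PI) Hh Hg).
  assert (Ex2 := J_ex _ m h 0 (2 * PI) Hh HcGP). simpl in Ex2.
  unfold J.
  rewrite <- (RInt_scal (V := R_CompleteNormedModule)) by exact Ex2.
  apply Rminus_diag_uniq.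
  rewrite <- (RInt_minus (V := R_CompleteNormedModule)).
  2: exact Ex1.
  2: apply (ex_RInt_scal (V := R_CompleteNormedModule)); exact Ex2.
  apply is_RInt_unique.
  replace 0 with (minus (G (X (uu h (2 * PI))) * yy h (2 * PI) ^ S m)
                        (G (X (uu h 0)) * yy h 0 ^ S m)) at 2.
  2: { destruct (yy_ends h) as [-> ->]. unfold minus, plus, opp; simpl. ring. }
  apply (is_RInt_derive (V := R_CompleteNormedModule)
    (fun t => G (X (uu h t)) * yy h t ^ S m)).
  - intros t _.
    assert (E := X_force _ (uu_range h t Hh)).
    unfold minus, plus, opp, scal; simpl; unfold mult; simpl.
    evar_last.
    + apply (is_derive_mult (fun t => G (X (uu h t))) (fun t => yy h t ^ S m)).
      * apply (is_derive_comp G (fun t => X (uu h t))).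
        -- apply HG, XX_range, Hh.
        -- apply (is_derive_comp X (uu h)); [apply X_derive, uu_range, Hh|apply uu_derive].
      * apply is_derive_pow, yy_derive.
      * intros; apply Rmult_comm.
    + unfold scal, plus, mult; simpl; unfold mult; simpl.
      replace (- uu h t) with (X (uu h t) ^ 3 * (1 - X (uu h t)) * dX (uu h t)) by lra.
      change (match m with 0%nat => 1 | S _ => INR m + 1 end) with (INR (S m)).
      ring.
  - intros t _. apply (continuous_minus (V := R_NormedModule)).
    + apply (J_cont g (S (S m)) h Hh Hg).
    + apply (continuous_scal_r (V := R_NormedModule)). apply (J_cont _ m h Hh HcGP).
Qed.

Lemma RInt_antisym (f : R -> R) :
  (forall t, continuous f t) -> (forall t, f (2 * PI - t) = - f t) ->
  RInt f 0 (2 * PI) = 0.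
Proof.
  intros Hc Hf.
  assert (Hex : forall a b, ex_RInt f a b).
  { intros; apply (ex_RInt_continuous (V := R_CompleteNormedModule)); auto. }
  assert (E := RInt_comp_lin (V := R_CompleteNormedModule) f (-1) (2 * PI) 0 (2 * PI) (Hex _ _)).
  replace (-1 * 0 + 2 * PI) with (2 * PI) in E by ring.
  replace (-1 * (2 * PI) + 2 * PI) with 0 in E by ring.
  rewrite (RInt_ext _ f) in E.
  - rewrite <- (opp_RInt_swap f (2 * PI) 0) in E |- * by auto.
    unfold opp in *; simpl in *. lra.
  - intros t _. unfold scal; simpl; unfold mult; simpl.
    replace (-1 * t + 2 * PI) with (2 * PI - t) by ring. rewrite Hf. ring.
Qed.

(** The substitution [t -> 2 PI - t] is the reflection of the oval in the [x]-axis: it keeps [uu]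
    and changes the sign of [yy]. *)
Lemma J_odd (g : R -> R) (k : nat) (h : R) :
  oval_level h -> (forall x, 0 < x -> continuous g x) -> J g (S (2 * k)) h = 0.
Proof.
  intros Hh Hg. apply RInt_antisym.
  - intros t. apply J_cont; auto.
  - intros t.
    assert (C : cos (2 * PI - t) = cos t).
    { rewrite cos_minus, cos_2PI, sin_2PI. ring. }
    assert (S : sin (2 * PI - t) = - sin t).
    { rewrite sin_minus, cos_2PI, sin_2PI. ring. }
    unfold uu, yy. rewrite C, S.
    replace ((rad h * - sin t) ^ Datatypes.S (2 * k)) with (- (rad h * sin t) ^ Datatypes.S (2 * k)).
    + ring.
    + rewrite <- !tech_pow_Rmult, !pow_mult.
      replace ((rad h * - sin t) ^ 2) with ((rad h * sin t) ^ 2) by ring. ring.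
Qed.

Lemma oval_level_locally (h : R) : oval_level h -> locally h oval_level.
Proof.
  intros [H1 H2].
  assert (He : 0 < Rmin (h + 1 / 20) (- h)) by (apply Rmin_glb_lt; lra).
  exists (mkposreal _ He). intros z Hz.
  unfold ball in Hz; simpl in Hz; unfold AbsRing_ball in Hz; simpl in Hz.
  unfold abs, minus, plus, opp in Hz; simpl in Hz. apply Rabs_def2 in Hz.
  assert (Rmin (h + 1 / 20) (- h) <= h + 1 / 20) by apply Rmin_l.
  assert (Rmin (h + 1 / 20) (- h) <= - h) by apply Rmin_r.
  unfold oval_level; lra.
Qed.

Lemma continuity_2d_uu (F : R -> R) (h t : R) :
  oval_level h -> (forall u, u ^ 2 < 1 / 10 -> continuous F u) ->
  continuity_2d_pt (fun z t => F (uu z t)) h t.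
Proof.
  intros Hh HF. apply continuity_1d_2d_pt_comp.
  - apply continuity_pt_filterlim, HF, uu_range, Hh.
  - unfold uu. apply continuity_2d_pt_mult.
    + apply (continuity_1d_2d_pt_comp (fun z => - rad z) (fun z t => z)).
      * apply continuity_pt_opp, continuity_pt_filterlim.
        apply (ex_derive_continuous rad). eexists; apply rad_derive, Hh.
      * apply continuity_2d_pt_id1.
    + apply (continuity_1d_2d_pt_comp cos (fun z t => t)).
      * apply continuity_cos.
      * apply continuity_2d_pt_id2.
Qed.

(* With [G' = g] one has [J g 2 h = oint G(x) u dt], which is free of [dX] and can be
   differentiated under the integral sign; an integration by parts then removes [G]. *)
Lemma J_derive (G g : R -> R) (h : R) :
  oval_level h -> (forall x, 0 < x -> is_derive G x (g x)) ->
  (forall x, 0 < x -> continuous g x) ->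
  is_derive (J g 2) h (J g 0 h).
Proof.
  intros Hh HG Hg.
  assert (HcG : forall x, 0 < x -> continuous G x).
  { intros x Hx. apply (ex_derive_continuous G). eexists; apply HG, Hx. }
  assert (Hr := rad_pos h Hh).
  set (F := fun u => G (X u) * u).
  set (dF := fun u => g (X u) * dX u * u + G (X u)).
  assert (HF : forall u, u ^ 2 < 1 / 10 -> is_derive F u (dF u)).
  { intros u Hu. unfold F, dF. evar_last.
    - apply (is_derive_mult (fun u => G (X u)) (fun u => u)).
      + apply (is_derive_comp G X); [apply HG, X_spec, Hu|apply X_derive, Hu].
      + apply is_derive_id.
      + intros; apply Rmult_comm.
    - unfold scal, plus, mult, one; simpl; unfold mult; simpl. ring. }
  assert (HdF : forall u, u ^ 2 < 1 / 10 -> continuous dF u).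
  { intros u Hu. apply (continuous_plus (V := R_NormedModule)).
    - apply (continuous_mult (K := R_AbsRing) (fun u => g (X u) * dX u) (fun u => u)).
      + apply (continuous_mult (K := R_AbsRing) (fun u => g (X u)) dX).
        * apply continuous_XX; auto.
        * apply dX_continuous, Hu.
      + apply continuous_id.
    - apply continuous_XX; auto. }
  assert (HFc : forall u, u ^ 2 < 1 / 10 -> continuous F u).
  { intros u Hu. apply (ex_derive_continuous F). eexists; apply HF, Hu. }
  assert (HDh : forall z t, oval_level z ->
            is_derive (fun z => F (uu z t)) z (dF (uu z t) * (- cos t / rad z))).
  { intros z t Hz. evar_last.
    - apply (is_derive_comp F (fun z => uu z t)); [apply HF, uu_range, Hz|apply uu_derive_h, Hz].
    - unfold scal; simpl; unfold mult; simpl. ring. }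
  apply (is_derive_ext_loc (fun z => RInt (fun t => F (uu z t)) 0 (2 * PI))).
  { apply (filter_imp oval_level); [|apply oval_level_locally, Hh]. intros z Hz.
    rewrite (J_parts G g 0 z Hz HG Hg). simpl (INR 1). rewrite Rmult_1_l.
    apply RInt_ext. intros t _. unfold F.
    assert (E := X_force _ (uu_range z t Hz)).
    rewrite pow_O. replace (uu z t) with (- - uu z t) at 2 by ring. rewrite <- E. as_R. ring. }
  evar_last.
  { apply (is_derive_RInt_param (fun z t => F (uu z t)) 0 (2 * PI) h).
    - apply (filter_imp oval_level); [|apply oval_level_locally, Hh]. intros z Hz t _.
      eexists; apply HDh, Hz.
    - intros t _.
      apply (continuity_2d_pt_ext_loc (fun z t => dF (uu z t) * (- cos t / rad z))).
      + destruct (oval_level_locally h Hh) as [e He]. exists e. intros z v Hz _.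
        symmetry; apply is_derive_unique, HDh, He, Hz.
      + apply continuity_2d_pt_mult; [apply continuity_2d_uu; auto|].
        unfold Rdiv. apply continuity_2d_pt_mult.
        * apply (continuity_1d_2d_pt_comp (fun t => - cos t) (fun z t => t)).
          -- apply continuity_pt_opp, continuity_cos.
          -- apply continuity_2d_pt_id2.
        * apply (continuity_1d_2d_pt_comp (fun z => / rad z) (fun z t => z)).
          -- apply continuity_pt_inv; [|lra]. apply continuity_pt_filterlim.
             apply (ex_derive_continuous rad). eexists; apply rad_derive, Hh.
          -- apply continuity_2d_pt_id1.
    - apply (filter_imp oval_level); [|apply oval_level_locally, Hh]. intros z Hz.
      apply (ex_RInt_continuous (V := R_CompleteNormedModule)). intros t _.
      apply continuous_uu; auto. }
  rewrite (RInt_ext _ (fun t => dF (uu h t) * (- cos t / rad h))).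
  2: { intros t _. apply is_derive_unique, HDh, Hh. }
  assert (Hc2 : forall t, continuous (fun t => dF (uu h t) * (- cos t / rad h)) t).
  { intros t. apply (continuous_mult (K := R_AbsRing)
      (fun t => dF (uu h t)) (fun t => - cos t / rad h)).
    - apply continuous_uu; auto.
    - apply (ex_derive_continuous (fun t => - cos t / rad h)). auto_derive. exact I. }
  unfold J. symmetry. apply Rminus_diag_uniq.
  rewrite <- (RInt_minus (V := R_CompleteNormedModule)).
  2: apply J_ex; auto.
  2: apply (ex_RInt_continuous (V := R_CompleteNormedModule)); auto.
  apply is_RInt_unique.
  (* The two integrands differ by the derivative of [G (X (uu h t)) * sin t / rad h], which is zero
     at both ends; [1 - cos^2 = sin^2] matches the terms in [g]. *)
  replace 0 with (minus (G (X (uu h (2 * PI))) * (sin (2 * PI) / rad h))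
                        (G (X (uu h 0)) * (sin 0 / rad h))) at 2.
  2: { rewrite sin_2PI, sin_0. unfold minus, plus, opp; simpl. unfold Rdiv; ring. }
  apply (is_RInt_derive (V := R_CompleteNormedModule)
    (fun t => G (X (uu h t)) * (sin t / rad h))).
  - intros t _.
    unfold minus, plus, opp; simpl.
    evar_last.
    + apply (is_derive_mult (fun t => G (X (uu h t))) (fun t => sin t / rad h)).
      * apply (is_derive_comp G (fun t => X (uu h t))).
        -- apply HG, XX_range, Hh.
        -- apply (is_derive_comp X (uu h)); [apply X_derive, uu_range, Hh|apply uu_derive].
      * instantiate (1 := cos t / rad h). auto_derive; [exact I|field; lra].
      * intros; apply Rmult_comm.
    + unfold scal, plus, mult; simpl; unfold mult; simpl.
      unfold dF, yy.
      generalize (g (X (uu h t))) (G (X (uu h t))) (dX (uu h t)). intros gx Gx d.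
      unfold uu. assert (E := cos_sin_sqr t).
      transitivity (d * gx * sin t ^ 2 + Gx * (cos t / rad h)); [field; lra|].
      replace (sin t ^ 2) with (1 - cos t ^ 2) by lra. field. lra.
  - intros t _. apply (continuous_minus (V := R_NormedModule)).
    + apply J_cont; auto.
    + apply Hc2.
Qed.

(** Integration by parts and [X_force] turn the integral into that of [G (X u) * u] over the circle.
    The unbounded factor [dX] has disappeared and [|u| <= 1], so the bound is uniform up to the
    loop. *)
Lemma J_bound (G g : R -> R) (C h : R) :
  oval_level h -> (forall x, 0 < x -> is_derive G x (g x)) ->
  (forall x, 0 < x -> continuous g x) ->
  (forall x, 0 < x < 5 / 4 -> Rabs (G x) <= C) ->
  Rabs (J g 2 h) <= 2 * PI * C.
Proof.
  intros Hh HG Hg HC.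
  assert (HcG : forall x, 0 < x -> continuous G x).
  { intros x Hx. apply (ex_derive_continuous G). eexists; apply HG, Hx. }
  rewrite (J_parts G g 0 h Hh HG Hg). simpl (INR 1). rewrite Rmult_1_l.
  unfold J. rewrite (RInt_ext _ (fun t => G (X (uu h t)) * uu h t)).
  2: { intros t _. assert (E := X_force _ (uu_range h t Hh)).
    rewrite pow_O. as_R. transitivity (G (X (uu h t)) * (- - uu h t)); [rewrite <- E|]; ring. }
  replace (2 * PI * C) with ((2 * PI - 0) * C) by ring.
  apply abs_RInt_le_const.
  - generalize PI_RGT_0; lra.
  - apply (ex_RInt_continuous (V := R_CompleteNormedModule)). intros t _.
    apply (continuous_uu (fun u => G (X u) * u)); [exact Hh|]. intros u Hu.
    apply (continuous_mult (K := R_AbsRing) (fun u => G (X u)) (fun u => u)).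
    + apply continuous_XX; auto.
    + apply continuous_id.
  - intros t _. rewrite Rabs_mult.
    assert (U := uu_range h t Hh). rewrite <- pow2_abs in U.
    assert (A := Rabs_pos (uu h t)).
    assert (B := HC _ (XX_range h t Hh)).
    assert (D := Rabs_pos (G (X (uu h t)))).
    assert (Rabs (uu h t) <= 1) by nra. nra.
Qed.

(** * Picard-Fuchs equations *)

Definition Ix (n : nat) (h : R) : R := J (fun x => x ^ n) 2 h.
Definition Kx (n : nat) (h : R) : R := J (fun x => x ^ n) 0 h.

Lemma pow_continuous (n : nat) (x : R) : continuous (fun x => x ^ n) x.
Proof.
  apply (ex_derive_continuous (fun x => x ^ n)). auto_derive. exact I.
Qed.

Lemma inv_pow_continuous (n : nat) (x : R) : 0 < x -> continuous (fun x => / x ^ n) x.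
Proof.
  intros Hx. apply (ex_derive_continuous (fun x => / x ^ n)). auto_derive.
  apply Rgt_not_eq, pow_lt, Hx.
Qed.

Lemma pow_primitive (n : nat) (x : R) :
  is_derive (fun x => / INR (S n) * x ^ S n) x (x ^ n).
Proof.
  evar_last.
  - apply is_derive_scal, is_derive_pow, is_derive_id.
  - unfold one; simpl pred. simpl. change (match n with 0%nat => 1 | S _ => INR n + 1 end) with (INR (S n)).
    field. apply not_0_INR. lia.
Qed.

Lemma inv_pow_primitive (n : nat) (x : R) :
  0 < x -> is_derive (fun x => - / INR (S n) * / x ^ S n) x (/ x ^ S (S n)).
Proof.
  intros Hx. assert (Hn : INR (S n) <> 0) by (apply not_0_INR; lia).
  assert (Hp : x ^ n <> 0) by (apply Rgt_not_eq, pow_lt, Hx).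
  evar_last.
  - apply is_derive_scal. apply is_derive_inv.
    + apply is_derive_pow, is_derive_id.
    + apply Rgt_not_eq, pow_lt, Hx.
  - unfold one. change (pred (S n)) with n. simpl (x ^ S _).
    set (N := INR (S n)) in *. simpl. field. repeat split; try lra.
Qed.

Lemma Ix_derive (n : nat) (h : R) : oval_level h -> is_derive (Ix n) h (Kx n h).
Proof.
  intros Hh. apply (J_derive (fun x => / INR (S n) * x ^ S n) (fun x => x ^ n) h Hh).
  - intros; apply pow_primitive.
  - intros; apply pow_continuous.
Qed.

Lemma J_lin2 (a b : R) (f g F : R -> R) (m : nat) (h : R) :
  oval_level h -> (forall x, 0 < x -> continuous f x) -> (forall x, 0 < x -> continuous g x) ->
  (forall x, 0 < x -> F x = a * f x + b * g x) ->
  J F m h = a * J f m h + b * J g m h.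
Proof.
  intros Hh Hf Hg HF. rewrite (J_ext F (fun x => a * f x + b * g x)) by auto.
  rewrite J_plus.
  - rewrite !J_scal; auto.
  - exact Hh.
  - intros. apply (continuous_scal_r (V := R_NormedModule)); auto.
  - intros. apply (continuous_scal_r (V := R_NormedModule)); auto.
Qed.

Lemma J_lin3 (a b c : R) (f g k F : R -> R) (m : nat) (h : R) :
  oval_level h -> (forall x, 0 < x -> continuous f x) -> (forall x, 0 < x -> continuous g x) ->
  (forall x, 0 < x -> continuous k x) ->
  (forall x, 0 < x -> F x = a * f x + b * g x + c * k x) ->
  J F m h = a * J f m h + b * J g m h + c * J k m h.
Proof.
  intros Hh Hf Hg Hk HF.
  rewrite (J_lin2 1 c (fun x => a * f x + b * g x) k F); auto.
  - rewrite (J_lin2 a b f g (fun x => a * f x + b * g x)); auto. ring.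
  - intros x Hx. apply (continuous_plus (V := R_NormedModule));
      apply (continuous_scal_r (V := R_NormedModule)); auto.
  - intros; rewrite HF by auto; ring.
Qed.

(** Exactness of [d (x^(n+1) y^(m+1))] on the oval, where [y dy = (x^3 - x^4) dx]. *)
Lemma Jx_exact (n m : nat) (h : R) : oval_level h ->
  INR (S n) * J (fun x => x ^ n) (S (S m)) h =
  INR (S m) * (J (fun x => x ^ (n + 5)) m h - J (fun x => x ^ (n + 4)) m h).
Proof.
  intros Hh. assert (Hn : INR (S n) <> 0) by (apply not_0_INR; lia).
  rewrite (J_parts (fun x => / INR (S n) * x ^ S n)); auto.
  2: intros; apply pow_primitive. 2: intros; apply pow_continuous.
  rewrite (J_lin2 (/ INR (S n)) (- / INR (S n)) (fun x => x ^ (n + 5)) (fun x => x ^ (n + 4))); auto.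
  - field; auto.
  - intros; apply pow_continuous.
  - intros; apply pow_continuous.
  - intros x Hx. rewrite !pow_add. simpl. ring.
Qed.

Lemma Jx_level (n m : nat) (h : R) : oval_level h ->
  J (fun x => x ^ n) (S (S m)) h =
  2 * h * J (fun x => x ^ n) m h + / 2 * J (fun x => x ^ (n + 4)) m h
  + - (2 / 5) * J (fun x => x ^ (n + 5)) m h.
Proof.
  intros Hh. rewrite J_level by auto.
  apply (J_lin3 (2 * h) (/ 2) (- (2 / 5))); auto; try (intros; apply pow_continuous).
  intros x Hx. rewrite !pow_add. field.
Qed.

(** The form [y^m dy] is exact. This relation lets the family of integrals close on the exponents 0
    to 3. *)
Lemma Jx_34 (m : nat) (h : R) : oval_level h ->
  J (fun x => x ^ 4) m h = J (fun x => x ^ 3) m h.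
Proof.
  intros Hh.
  assert (E := J_parts (fun _ => 1) (fun _ => 0) m h Hh
    ltac:(intros; apply is_derive_Reals, derivable_pt_lim_const)
    ltac:(intros; apply continuous_const)).
  rewrite (J_lin2 1 (- 1) (fun x => x ^ 4) (fun x => x ^ 3) (fun x => 1 * (x ^ 4 - x ^ 3))) in E; auto.
  2,3: intros; apply pow_continuous.
  2: intros; ring.
  replace (J (fun _ => 0) (S (S m)) h) with 0 in E.
  - assert (0 < INR (S m)) by (apply lt_0_INR; lia). nra.
  - symmetry.
    rewrite (J_lin2 0 0 (fun x => x ^ 4) (fun x => x ^ 4) (fun _ => 0)); auto.
    1: ring. 1,2: intros; apply pow_continuous. intros; ring.
Qed.

(** Elimination of [Kx (n + 5)] between the exactness and the level relations, multiplied by 10. *)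
Lemma picard_fuchs (n : nat) (h : R) : oval_level h ->
  (14 + 4 * INR n) * Ix n h = 20 * h * Kx n h + Kx (n + 4) h.
Proof.
  intros Hh. assert (E := Jx_exact n 0 h Hh). assert (L := Jx_level n 0 h Hh).
  fold (Ix n h) (Kx n h) (Kx (n + 4) h) (Kx (n + 5) h) in *.
  rewrite S_INR in E. simpl (INR 1) in E. lra.
Qed.

Lemma Kx_step (n : nat) (h : R) : oval_level h ->
  Kx (n + 5) h = (INR n + 1) * Ix n h + Kx (n + 4) h.
Proof.
  intros Hh. assert (E := Jx_exact n 0 h Hh).
  fold (Ix n h) (Kx n h) (Kx (n + 4) h) (Kx (n + 5) h) in *.
  rewrite S_INR in E. simpl (INR 1) in E. lra.
Qed.

(** [Kx_step] lowers [K_5], [K_6], [K_7] to [K_4], which equals [K_3], so four integrals suffice.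
    The factor [20 h + 1] vanishes only at the level of the center; near the loop the last equation
    can be solved for [K_3]. *)
Lemma picard_fuchs_system (h : R) : oval_level h ->
  14 * Ix 0 h = 20 * h * Kx 0 h + Kx 3 h /\
  18 * Ix 1 h = 20 * h * Kx 1 h + Ix 0 h + Kx 3 h /\
  22 * Ix 2 h = 20 * h * Kx 2 h + 2 * Ix 1 h + Ix 0 h + Kx 3 h /\
  26 * Ix 3 h = (20 * h + 1) * Kx 3 h + 3 * Ix 2 h + 2 * Ix 1 h + Ix 0 h.
Proof.
  intros Hh.
  assert (P0 := picard_fuchs 0 h Hh). assert (P1 := picard_fuchs 1 h Hh).
  assert (P2 := picard_fuchs 2 h Hh). assert (P3 := picard_fuchs 3 h Hh).
  assert (S0 := Kx_step 0 h Hh). assert (S1 := Kx_step 1 h Hh).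
  assert (S2 := Kx_step 2 h Hh).
  assert (S3 : Kx 4 h = Kx 3 h) by exact (Jx_34 0 h Hh).
  simpl Nat.add in *.
  replace (INR 0) with 0 in * by reflexivity. replace (INR 1) with 1 in * by reflexivity.
  replace (INR 2) with 2 in * by (simpl; ring). replace (INR 3) with 3 in * by (simpl; ring).
  repeat split; lra.
Qed.

(** These are the integrals of [y^3 dx] and [x y^3 dx]. The same two relations, taken two powers of
    [y] higher, express them through [I_3], [h I_0] and [h I_1]; this is how [h] enters the
    coefficients. *)
Lemma J4_reduction (h : R) : oval_level h ->
  J (fun x => x ^ 0) 4 h = 3 / 17 * (10 * h * Ix 0 h + Ix 3 h / 2) /\
  J (fun x => x ^ 1) 4 h =
    3 / 38 * (20 * h * Ix 1 h + (10 * h * Ix 0 h + 35 / 2 * Ix 3 h) / 17).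
Proof.
  intros Hh.
  assert (E0 := Jx_exact 0 2 h Hh). assert (L0 := Jx_level 0 2 h Hh).
  assert (E1 := Jx_exact 1 2 h Hh). assert (L1 := Jx_level 1 2 h Hh).
  assert (S3 := Jx_34 2 h Hh).
  unfold Ix. simpl Nat.add in *.
  replace (INR 1) with 1 in * by reflexivity.
  replace (INR 2) with 2 in * by (simpl; ring).
  replace (INR 3) with 3 in * by (simpl; ring).
  split; lra.
Qed.

(* [sp p h] is [s ^ p] for [s = - h]. *)
Definition sp (p h : R) : R := Rpower (- h) p.

Lemma sp_pos (p h : R) : 0 < sp p h.
Proof. apply exp_pos. Qed.

Lemma sp_add (p p' h : R) : sp p h * sp p' h = sp (p + p') h.
Proof. symmetry. apply Rpower_plus. Qed.

Lemma sp_1 (h : R) : h < 0 -> sp 1 h = - h.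
Proof. intros. apply Rpower_1. lra. Qed.

Lemma sp_0 (h : R) : sp 0 h = 1.
Proof. unfold sp, Rpower. rewrite Rmult_0_l. apply exp_0. Qed.

Lemma sp_derive (p h : R) : h < 0 -> is_derive (sp p) h (p * sp p h / h).
Proof.
  intros Hh. unfold sp, Rpower. auto_derive; [lra|].
  replace (ln (- h)) with (ln (-1 * h)) by (f_equal; ring). field. lra.
Qed.

Lemma sp_le (p p' h : R) : -1 <= h < 0 -> p <= p' -> sp p' h <= sp p h.
Proof.
  intros Hh Hp. unfold sp, Rpower.
  assert (L : ln (- h) <= 0) by (rewrite <- ln_1; apply ln_le; lra).
  assert (p' * ln (- h) <= p * ln (- h)) by nra.
  destruct H as [H|H]; [left; apply exp_increasing, H|right; rewrite H; reflexivity].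
Qed.

(** * Lower bounds at the loop *)

(** Half the depth of the center, so that [1 + 20 h >= 1 / 2]. The left end is included because
    monotone quantities are compared with their values there. *)
Definition near_loop (h : R) : Prop := - (1 / 40) <= h < 0.

Lemma near_loop_oval (h : R) : near_loop h -> oval_level h.
Proof. unfold near_loop, oval_level; lra. Qed.

(** The last hypothesis makes [s^p F] nondecreasing in [h], so its value at [- (1 / 40)] is a lower
    bound on the whole range. *)
Lemma power_lower_bound (F dF : R -> R) (p : R) :
  (forall h, oval_level h -> is_derive F h (dF h)) ->
  (forall h, oval_level h -> 0 <= F h) ->
  (forall h, oval_level h -> 0 < dF h) ->
  (forall h, oval_level h -> h * dF h <= - p * F h) ->
  exists c, 0 < c /\ forall h, near_loop h -> c <= sp p h * F h.
Proof.
  intros Hd H0 Hpos Hp.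
  assert (P : 0 < F (- (1 / 40))).
  (* [F] is nonnegative and strictly increasing; a level closer to the center gives strict
     positivity at [- (1 / 40)]. *)
  { apply Rle_lt_trans with (F (- (1 / 30))); [apply H0; unfold oval_level; lra|].
    apply (deriv_pos_increasing F dF); [lra| |]; intros x Hx;
      [apply Hd|apply Hpos]; unfold oval_level; lra. }
  exists (sp p (- (1 / 40)) * F (- (1 / 40))). split.
  - apply Rmult_lt_0_compat; [apply sp_pos|exact P].
  - intros h Hh.
    apply (deriv_nonneg_le (fun h => sp p h * F h)
      (fun h => sp p h / h * (p * F h + h * dF h))); [unfold near_loop in Hh; lra| |];
      intros x Hx.
    + assert (Gx : oval_level x) by (unfold oval_level; unfold near_loop in Hh; lra).
      evar_last.
      * apply (is_derive_mult (sp p) F); [apply sp_derive; unfold oval_level in Gx; lra|apply Hd, Gx|].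
        intros; apply Rmult_comm.
      * unfold plus, mult; simpl. field. unfold oval_level in Gx; lra.
    + assert (Gx : oval_level x) by (unfold oval_level; unfold near_loop in Hh; lra).
      specialize (Hp x Gx). assert (S := sp_pos p x). unfold oval_level in Gx.
      replace (sp p x / x * (p * F x + x * dF x))
        with (sp p x * (- (p * F x + x * dF x)) * / (- x)) by (field; lra).
      apply Rmult_le_pos; [|apply Rlt_le, Rinv_0_lt_compat; lra].
      apply Rmult_le_pos; lra.
Qed.

Lemma Jinv_exact (n : nat) (h : R) : oval_level h ->
  - INR (S n) * J (fun x => / x ^ S (S n)) 2 h =
  J (fun x => / x ^ S n * (x ^ 4 - x ^ 3)) 0 h.
Proof.
  intros Hh. assert (Hn : INR (S n) <> 0) by (apply not_0_INR; lia).
  rewrite (J_parts (fun x => - / INR (S n) * / x ^ S n)); auto.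
  2: intros; apply inv_pow_primitive; auto. 2: intros; apply inv_pow_continuous; auto.
  rewrite (J_ext _ (fun x => - / INR (S n) * (/ x ^ S n * (x ^ 4 - x ^ 3)))); auto.
  - rewrite J_scal; auto.
    + simpl (INR 1). field; auto.
    + intros x Hx. apply (continuous_mult (K := R_AbsRing) (fun x => / x ^ S n)).
      * apply inv_pow_continuous, Hx.
      * apply (continuous_minus (V := R_NormedModule)); apply pow_continuous.
  - intros; ring.
Qed.

Lemma Jinv_derive (n : nat) (h : R) : oval_level h ->
  is_derive (J (fun x => / x ^ S (S n)) 2) h (J (fun x => / x ^ S (S n)) 0 h).
Proof.
  intros Hh.
  apply (J_derive (fun x => - / INR (S n) * / x ^ S n) (fun x => / x ^ S (S n)) h Hh).
  - intros; apply inv_pow_primitive; auto.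
  - intros; apply inv_pow_continuous; auto.
Qed.

(* [K_0 >= 3 oint y dx / x^4], and the latter times [s^(1/4)] decreases in [s]. *)
Lemma Kx0_lower : exists c, 0 < c /\ forall h, near_loop h -> c <= sp (1 / 4) h * Kx 0 h.
Proof.
  assert (Rel : forall h, oval_level h ->
    - 3 * J (fun x => / x ^ 4) 2 h = Kx 1 h - Kx 0 h /\
    J (fun x => / x ^ 4) 2 h =
      2 * h * J (fun x => / x ^ 4) 0 h + / 2 * Kx 0 h + - (2 / 5) * Kx 1 h).
  { intros h Hh. split.
    - assert (E := Jinv_exact 2 h Hh). replace (INR 3) with 3 in E by (simpl; ring).
      eapply eq_trans; [|eapply eq_trans; [exact E|]]; [ring|]. unfold Kx.
      rewrite (J_lin2 1 (-1) (fun x => x ^ 1) (fun x => x ^ 0)); auto.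
      + ring. + intros; apply pow_continuous. + intros; apply pow_continuous.
      + intros; field; lra.
    - rewrite J_level by auto. unfold Kx.
      apply J_lin3; auto; try (intros; apply pow_continuous).
      + intros; apply inv_pow_continuous; auto.
      + intros; field; lra. }
  assert (P : forall n h, oval_level h -> 0 < Kx n h).
  { intros n h Hh. apply (J_pos (fun x => x ^ n) h Hh).
    - intros; apply pow_continuous.
    - intros; apply pow_lt; lra. }
  destruct (power_lower_bound (J (fun x => / x ^ 4) 2) (J (fun x => / x ^ 4) 0) (1 / 4))
    as [c [Hc B]].
  - intros; apply (Jinv_derive 2); auto.
  - intros h Hh. apply J_nonneg; auto.
    + intros; apply inv_pow_continuous; auto.
    + intros. apply Rlt_le, Rinv_0_lt_compat, pow_lt. lra.
  - intros h Hh. apply J_pos; auto.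
    + intros; apply inv_pow_continuous; auto.
    + intros. apply Rinv_0_lt_compat, pow_lt. lra.
  (* For [F = oint y dx / x^4], eliminating [Kx 0] gives [h F' = - F / 4 - Kx 1 h / 20]. *)
  - intros h Hh. destruct (Rel h Hh). assert (P1 := P 1%nat h Hh). lra.
  - exists (3 * c). split; [lra|]. intros h Hh. specialize (B h Hh).
    apply near_loop_oval in Hh. destruct (Rel h Hh). assert (P1 := P 1%nat h Hh).
    assert (S := sp_pos (1 / 4) h).
    assert (sp (1 / 4) h * (3 * J (fun x => / x ^ 4) 2 h) <= sp (1 / 4) h * Kx 0 h)
      by (apply Rmult_le_compat_l; lra).
    lra.
Qed.

(* The difference is [4 s oint dx / (x^2 y) >= 20 s oint y dx / x^6]. *)
Lemma Kx2_gap : exists c, 0 < c /\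
  forall h, near_loop h -> c * sp (1 / 4) h <= 6 / 5 * Kx 3 h - Kx 2 h.
Proof.
  set (K1 := fun h => J (fun x => / x ^ 1) 0 h).
  set (K2 := fun h => J (fun x => / x ^ 2) 0 h).
  assert (Rel : forall h, oval_level h ->
    - 5 * J (fun x => / x ^ 6) 2 h = K1 h - K2 h /\
    J (fun x => / x ^ 6) 2 h =
      2 * h * J (fun x => / x ^ 6) 0 h + / 2 * K2 h + - (2 / 5) * K1 h /\
    - 1 * J (fun x => / x ^ 2) 2 h = Kx 3 h - Kx 2 h /\
    J (fun x => / x ^ 2) 2 h = 2 * h * K2 h + / 2 * Kx 2 h + - (2 / 5) * Kx 3 h).
  { intros h Hh. unfold K1, K2. repeat split.
    - assert (E := Jinv_exact 4 h Hh). replace (INR 5) with 5 in E by (simpl; ring).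
      eapply eq_trans; [|eapply eq_trans; [exact E|]]; [ring|].
      rewrite (J_lin2 1 (-1) (fun x => / x ^ 1) (fun x => / x ^ 2)); auto.
      + ring. + intros; apply inv_pow_continuous; auto.
      + intros; apply inv_pow_continuous; auto.
      + intros; field; lra.
    - rewrite J_level by auto.
      apply J_lin3; auto; try (intros; apply inv_pow_continuous; auto).
      intros; field; lra.
    - assert (E := Jinv_exact 0 h Hh). replace (INR 1) with 1 in E by (simpl; ring).
      eapply eq_trans; [|eapply eq_trans; [exact E|]]; [ring|]. unfold Kx.
      rewrite (J_lin2 1 (-1) (fun x => x ^ 3) (fun x => x ^ 2)); auto.
      + ring. + intros; apply pow_continuous. + intros; apply pow_continuous.
      + intros; field; lra.
    - rewrite J_level by auto. unfold Kx.
      apply J_lin3; auto; try (intros; apply pow_continuous).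
      + intros; apply inv_pow_continuous; auto.
      + intros; field; lra. }
  assert (P : forall h, oval_level h -> 0 < K1 h).
  { intros h Hh. apply J_pos; auto.
    - intros; apply inv_pow_continuous; auto.
    - intros. apply Rinv_0_lt_compat, pow_lt. lra. }
  destruct (power_lower_bound (J (fun x => / x ^ 6) 2) (J (fun x => / x ^ 6) 0) (3 / 4))
    as [c [Hc B]].
  - intros; apply (Jinv_derive 4); auto.
  - intros h Hh. apply J_nonneg; auto.
    + intros; apply inv_pow_continuous; auto.
    + intros. apply Rlt_le, Rinv_0_lt_compat, pow_lt. lra.
  - intros h Hh. apply J_pos; auto.
    + intros; apply inv_pow_continuous; auto.
    + intros. apply Rinv_0_lt_compat, pow_lt. lra.
  (* For [F = oint y dx / x^6], eliminating [K2] gives [h F' = - 3 F / 4 - K1 h / 20]. *)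
  - intros h Hh. destruct (Rel h Hh) as [? [? _]]. assert (P1 := P h Hh). lra.
  - exists (20 * c). split; [lra|]. intros h Hh. specialize (B h Hh).
    assert (Hn : h < 0) by (unfold near_loop in Hh; lra).
    apply near_loop_oval in Hh. destruct (Rel h Hh) as [R1 [R2 [R3 R4]]]. assert (P1 := P h Hh).
    assert (S := sp_pos (1 / 4) h).
    replace (6 / 5 * Kx 3 h - Kx 2 h) with (4 * (- h) * K2 h) by lra.
    rewrite <- (sp_1 h Hn) at 1.
    replace 1 with (1 / 4 + 3 / 4) at 2 by field. rewrite <- sp_add.
    assert (sp (3 / 4) h * (5 * J (fun x => / x ^ 6) 2 h) <= sp (3 / 4) h * K2 h)
      by (apply Rmult_le_compat_l; [apply Rlt_le, sp_pos|lra]).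
    assert (sp (1 / 4) h * (5 * c) <= sp (1 / 4) h * (sp (3 / 4) h * K2 h))
      by (apply Rmult_le_compat_l; lra).
    lra.
Qed.

Lemma Ix_nonneg (n : nat) (h : R) : oval_level h -> 0 <= Ix n h.
Proof.
  intros Hh. apply (J_nonneg (fun x => x ^ n) h Hh).
  - intros; apply pow_continuous.
  - intros; apply pow_le; lra.
Qed.

Lemma Kx_pos (n : nat) (h : R) : oval_level h -> 0 < Kx n h.
Proof.
  intros Hh. apply (J_pos (fun x => x ^ n) h Hh).
  - intros; apply pow_continuous.
  - intros; apply pow_lt; lra.
Qed.

Lemma Ix_bounded (n : nat) : exists C, forall h, oval_level h -> Rabs (Ix n h) <= C.
Proof.
  exists (2 * PI * (/ INR (S n) * (5 / 4) ^ S n)). intros h Hh.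
  assert (Hn : 0 < / INR (S n)) by (apply Rinv_0_lt_compat, lt_0_INR; lia).
  apply (J_bound (fun x => / INR (S n) * x ^ S n) (fun x => x ^ n) _ h Hh).
  - intros; apply pow_primitive.
  - intros; apply pow_continuous.
  - intros x Hx. rewrite Rabs_right.
    + apply Rmult_le_compat_l; [lra|]. apply pow_incr; lra.
    + apply Rle_ge, Rmult_le_pos; [lra|apply pow_le; lra].
Qed.

(** * The Melnikov function as a combination of six integrals *)

(** Here [t] is the angle, not the time; the last factor [dX] converts one into the other. *)
Definition orbit_integrand (a b : nat -> nat -> R) (h t : R) : R :=
  (quartic b (X (uu h t)) (yy h t) * yy h t
   - quartic a (X (uu h t)) (yy h t) * (X (uu h t) ^ 3 * (1 - X (uu h t))))
  * dX (uu h t).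

Lemma continuous_sum_n (f : nat -> R -> R) (n : nat) (t : R) :
  (forall i, continuous (f i) t) -> continuous (fun t => sum_n (fun i => f i t) n) t.
Proof.
  intros Hf. induction n as [|n IH].
  - apply (continuous_ext (f 0%nat)); [intros; rewrite sum_O; reflexivity|apply Hf].
  - apply (continuous_ext (fun t => plus (sum_n (fun i => f i t) n) (f (S n) t))).
    + intros; rewrite sum_Sn; reflexivity.
    + apply (continuous_plus (V := R_NormedModule)); auto.
Qed.

Lemma quartic_continuous (c : nat -> nat -> R) (h t : R) :
  oval_level h -> continuous (fun t => quartic c (X (uu h t)) (yy h t)) t.
Proof.
  intros Hh. unfold quartic.
  apply (continuous_sum_n (fun i t =>
    sum_n (fun j => c i j * X (uu h t) ^ i * yy h t ^ j) (4 - i))). intros i.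
  apply (continuous_sum_n (fun j t => c i j * X (uu h t) ^ i * yy h t ^ j)). intros j.
  apply (continuous_mult (K := R_AbsRing) (fun t => c i j * X (uu h t) ^ i)
    (fun t => yy h t ^ j)); [|apply yy_continuous].
  apply (continuous_uu (fun u => c i j * X u ^ i)); [exact Hh|]. intros u Hu.
  apply (continuous_XX (fun x => c i j * x ^ i)); [exact Hu|].
  intros; apply (continuous_scal_r (V := R_NormedModule)), pow_continuous.
Qed.

Lemma orbit_integrand_continuous (a b : nat -> nat -> R) (h t : R) : oval_level h -> continuous (orbit_integrand a b h) t.
Proof.
  intros Hh. unfold orbit_integrand.
  apply (continuous_mult (K := R_AbsRing) (fun t =>
    quartic b (X (uu h t)) (yy h t) * yy h t
   - quartic a (X (uu h t)) (yy h t) * (X (uu h t) ^ 3 * (1 - X (uu h t))))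
   (fun t => dX (uu h t))).
  2: apply (continuous_uu dX); auto using dX_continuous.
  apply (continuous_minus (V := R_NormedModule)).
  - apply (continuous_mult (K := R_AbsRing) (fun t => quartic b (X (uu h t)) (yy h t)) (yy h)).
    + apply quartic_continuous, Hh.
    + apply (ex_derive_continuous (yy h)). eexists; apply yy_derive.
  - apply (continuous_mult (K := R_AbsRing) (fun t => quartic a (X (uu h t)) (yy h t))
      (fun t => X (uu h t) ^ 3 * (1 - X (uu h t)))).
    + apply quartic_continuous, Hh.
    + apply (continuous_uu (fun u => X u ^ 3 * (1 - X u))); [exact Hh|]. intros u Hu.
      apply (continuous_XX (fun x => x ^ 3 * (1 - x))); [exact Hu|]. intros x _.
      apply (ex_derive_continuous (fun x => x ^ 3 * (1 - x))). auto_derive. exact I.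
Qed.

(** * Parametrizations of the periodic orbits *)

Lemma RInt_periodic (f : R -> R) (c : R) :
  (forall t, continuous f t) -> (forall t, f (t + 2 * PI) = f t) ->
  RInt f c (c + 2 * PI) = RInt f 0 (2 * PI).
Proof.
  intros Hc Hf.
  assert (Hex : forall a b, ex_RInt f a b).
  { intros; apply (ex_RInt_continuous (V := R_CompleteNormedModule)); auto. }
  assert (E := RInt_comp_lin (V := R_CompleteNormedModule) f 1 (2 * PI) 0 c (Hex _ _)).
  rewrite (RInt_ext _ f) in E.
  2: { intros t _. unfold scal; simpl; unfold mult; simpl. rewrite !Rmult_1_l. apply Hf. }
  rewrite Rmult_1_l, Rmult_1_l, Rplus_0_l in E.
  assert (C1 := RInt_Chasles f 0 c (c + 2 * PI) (Hex _ _) (Hex _ _)).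
  assert (C2 := RInt_Chasles f 0 (2 * PI) (c + 2 * PI) (Hex _ _) (Hex _ _)).
  unfold plus in *; simpl in *. lra.
Qed.

Lemma angle_exists (c d r : R) : 0 < r -> c ^ 2 + d ^ 2 = r * r ->
  exists t, c = - r * cos t /\ d = r * sin t.
Proof.
  intros Hr E.
  assert (B : -1 <= - c / r <= 1).
  { split; apply (Rmult_le_reg_r r); auto; unfold Rdiv; rewrite Rmult_assoc, Rinv_l by lra; nra. }
  assert (Cc := cos_acos _ B).
  assert (S : (r * sin (acos (- c / r))) ^ 2 = d ^ 2).
  { assert (S := cos_sin_sqr (acos (- c / r))). rewrite Cc in S.
    replace ((r * sin (acos (- c / r))) ^ 2) with (r * r * (sin (acos (- c / r)) ^ 2)) by ring.
    replace (sin (acos (- c / r)) ^ 2) with (1 - (- c / r) ^ 2) by lra.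
    replace (d ^ 2) with (r * r - c ^ 2) by lra. field. lra. }
  assert (S2 : r * sin (acos (- c / r)) = d \/ r * sin (acos (- c / r)) = - d).
  { destruct (Req_dec (r * sin (acos (- c / r))) d) as [e|ne]; [left; exact e|right].
    apply (Rmult_eq_reg_l (r * sin (acos (- c / r)) - d)); [|lra]. simpl in S. lra. }
  destruct S2 as [S2|S2].
  - exists (acos (- c / r)). rewrite Cc. split; [field; lra|lra].
  - exists (- acos (- c / r)). rewrite cos_neg, sin_neg, Cc. split; [field; lra|lra].
Qed.

Lemma gamma_level (h x y : R) : oval_level h -> 0 < x -> H x y = h ->
  phi x ^ 2 + y ^ 2 = 2 * h + 1 / 10 /\ x < 5 / 4.
Proof.
  intros Hh Hx E. assert (S := phi_sqr x ltac:(lra)). unfold H in E.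
  assert (Eq : phi x ^ 2 + y ^ 2 = 2 * h + 1 / 10) by lra. split; [exact Eq|].
  apply phi_range_inv; auto. assert (0 <= y ^ 2) by apply pow2_ge_0.
  unfold oval_level in Hh. lra.
Qed.

Lemma constant_of_derive (f : R -> R) :
  (forall t, is_derive f t 0) -> forall t, f t = f 0.
Proof.
  intros Hf t.
  destruct (MVT_gen f 0 t (fun _ => 0)) as [c [_ E]]; [auto| |lra].
  intros; apply continuity_pt_filterlim, (ex_derive_continuous f). eexists; apply Hf.
Qed.

(* Rotating [(u, y)] back by the angle [psi] with [psi' = 1 / dX u] freezes the flow. *)
Lemma gamma_angle (h : R) (x y : R -> R) : oval_level h ->
  is_solution x y -> (forall t, H (x t) (y t) = h) -> (forall t, 0 < x t) ->
  exists psi : R -> R,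
    (forall t, x t = X (uu h (psi t)) /\ y t = yy h (psi t)) /\
    (forall t, is_derive psi t (/ dX (uu h (psi t)))).
Proof.
  intros Hh Hsol Hlev Hx.
  assert (L := fun t => gamma_level h (x t) (y t) Hh (Hx t) (Hlev t)).
  set (v := fun t => phi (x t)).
  assert (Xv : forall t, X (v t) = x t).
  { intros t. apply X_phi. split; [apply Hx|apply L]. }
  assert (Vr : forall t, v t ^ 2 < 1 / 10).
  { intros t. apply phi_range. split; [apply Hx|apply L]. }
  assert (dpos : forall t, 0 < dX (v t)) by (intros; apply dX_pos, Vr).
  assert (Hv : forall t, is_derive v t (y t * / dX (v t))).
  { intros t. evar_last.
    - apply (is_derive_comp phi x); [exact (phi_derive (x t) (Rlt_le _ _ (Hx t)))|exact (proj1 (Hsol t))].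
    - unfold scal; simpl; unfold mult; simpl. unfold dX. rewrite Xv.
      assert (Q := q_pos (x t) ltac:(specialize (Hx t); lra)). specialize (Hx t).
      field. split; lra. }
  assert (Hy : forall t, is_derive y t (- v t * / dX (v t))).
  { intros t. evar_last; [exact (proj2 (Hsol t))|].
    assert (E := X_force _ (Vr t)). rewrite Xv in E. rewrite <- E. specialize (dpos t).
    field. lra. }
  assert (Hc : forall t, continuous (fun t => / dX (v t)) t).
  { intros t. apply (continuous_comp v (fun u => / dX u)).
    - apply (ex_derive_continuous v). eexists; apply Hv.
    - apply continuous_comp; [apply dX_continuous, Vr|].
      apply continuous_Rinv. apply Rgt_not_eq, dpos. }
  destruct (angle_exists (v 0) (y 0) (rad h) (rad_pos h Hh)) as [p0 [P1 P2]].
  { rewrite rad_sqr by auto. apply L. }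
  (* The angle is defined by quadrature along the given orbit, which avoids a continuous choice of
     the argument. That it is the angle is the content of the two conserved quantities [A] and
     [B]. *)
  set (psi := fun t => p0 + RInt (fun t => / dX (v t)) 0 t).
  assert (Hpsi : forall t, is_derive psi t (/ dX (v t))).
  { intros t. evar_last.
    - apply (is_derive_plus (fun _ => p0) (fun t => RInt (fun t => / dX (v t)) 0 t)).
      + apply is_derive_const.
      + apply (is_derive_RInt (V := R_CompleteNormedModule) (fun t => / dX (v t)) _ 0); [|apply Hc].
        apply filter_forall. intros s. apply RInt_correct.
        apply (ex_RInt_continuous (V := R_CompleteNormedModule)); auto.
    - unfold plus, zero; simpl. ring. }
  assert (Psi0 : psi 0 = p0).
  { unfold psi. rewrite RInt_point. unfold zero; simpl. ring. }
  assert (Dc : forall t, is_derive (fun t => cos (psi t)) t (- sin (psi t) * / dX (v t))).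
  { intros t. evar_last; [apply (is_derive_comp cos psi); [apply is_derive_cos|apply Hpsi]|].
    unfold scal; simpl; unfold mult; simpl. ring. }
  assert (Ds : forall t, is_derive (fun t => sin (psi t)) t (cos (psi t) * / dX (v t))).
  { intros t. evar_last; [apply (is_derive_comp sin psi); [apply is_derive_sin|apply Hpsi]|].
    unfold scal; simpl; unfold mult; simpl. ring. }
  assert (A : forall t, v t * cos (psi t) - y t * sin (psi t) = - rad h).
  { intros t. rewrite (constant_of_derive (fun t => v t * cos (psi t) - y t * sin (psi t))).
    - rewrite Psi0, P1, P2. assert (E := cos_sin_sqr p0).
      replace (- rad h * cos p0 * cos p0 - rad h * sin p0 * sin p0)
        with (- rad h * (cos p0 ^ 2 + sin p0 ^ 2)) by ring. rewrite E; ring.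
    - intros s. evar_last.
      + apply (is_derive_minus (fun t => v t * cos (psi t)) (fun t => y t * sin (psi t))).
        * apply (is_derive_mult v (fun t => cos (psi t))); auto. intros; apply Rmult_comm.
        * apply (is_derive_mult y (fun t => sin (psi t))); auto. intros; apply Rmult_comm.
      + unfold minus, plus, opp, mult; simpl. ring. }
  assert (B : forall t, v t * sin (psi t) + y t * cos (psi t) = 0).
  { intros t. rewrite (constant_of_derive (fun t => v t * sin (psi t) + y t * cos (psi t))).
    - rewrite Psi0, P1, P2. ring.
    - intros s. evar_last.
      + apply (is_derive_plus (fun t => v t * sin (psi t)) (fun t => y t * cos (psi t))).
        * apply (is_derive_mult v (fun t => sin (psi t))); auto. intros; apply Rmult_comm.
        * apply (is_derive_mult y (fun t => cos (psi t))); auto. intros; apply Rmult_comm.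
      + unfold plus, mult; simpl. ring. }
  assert (Vu : forall t, v t = uu h (psi t)).
  { intros t. unfold uu. specialize (A t). specialize (B t). rewrite <- A.
    assert (E := cos_sin_sqr (psi t)).
    transitivity (v t * (cos (psi t) ^ 2 + sin (psi t) ^ 2)
      - sin (psi t) * (v t * sin (psi t) + y t * cos (psi t))); [rewrite E, B; ring|ring_simplify].
    replace (sin (psi t) * v t * sin (psi t)) with (v t * sin (psi t) ^ 2) by ring. ring. }
  exists psi. split.
  - intros t. split.
    + rewrite <- Vu. symmetry. apply Xv.
    + unfold yy. specialize (A t). specialize (B t).
      replace (rad h) with (- (v t * cos (psi t) - y t * sin (psi t))) by lra.
      assert (E := cos_sin_sqr (psi t)).
      transitivity (y t * (cos (psi t) ^ 2 + sin (psi t) ^ 2)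
        - cos (psi t) * (v t * sin (psi t) + y t * cos (psi t))); [rewrite E, B; ring|ring].
  - intros t. rewrite <- Vu. apply Hpsi.
Qed.

Lemma cos_lt_1 (d : R) : 0 < d < 2 * PI -> cos d < 1.
Proof.
  intros Hd. replace d with (2 * (d / 2)) by field. rewrite cos_2a_sin.
  assert (0 < sin (d / 2)) by (apply sin_gt_0; lra). nra.
Qed.

Lemma uu_inj (h s t : R) : oval_level h ->
  X (uu h s) = X (uu h t) -> yy h s = yy h t -> cos s = cos t /\ sin s = sin t.
Proof.
  intros Hh E1 E2. assert (Hr := rad_pos h Hh).
  assert (E : uu h s = uu h t).
  { destruct (X_spec _ (uu_range h s Hh)) as [_ <-].
    destruct (X_spec _ (uu_range h t Hh)) as [_ <-]. rewrite E1. reflexivity. }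
  unfold uu, yy in *. split; apply (Rmult_eq_reg_l (rad h)); lra.
Qed.

(** [psi] increases and at time [T] the point is back. An advance below [2 PI] would contradict
    [cos < 1] inside a full turn; an advance above it would pass through exactly one turn earlier,
    against the minimality of [T]. *)
Lemma gamma_turn (h T : R) (x y psi : R -> R) : oval_level h ->
  periodic_orbit x y T ->
  (forall t, x t = X (uu h (psi t)) /\ y t = yy h (psi t)) ->
  (forall t, is_derive psi t (/ dX (uu h (psi t)))) ->
  psi T = psi 0 + 2 * PI.
Proof.
  intros Hh [_ [HT [Hper Hmin]]] Hpsi Dpsi.
  assert (Hinc : psi 0 < psi T).
  { apply (deriv_pos_increasing psi (fun t => / dX (uu h (psi t)))); auto.
    intros; apply Rinv_0_lt_compat, dX_pos, uu_range, Hh. }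
  destruct (Hper 0) as [Px Py]. rewrite Rplus_0_l in Px, Py.
  destruct (Hpsi T) as [XT YT]. destruct (Hpsi 0) as [X0 Y0].
  destruct (uu_inj h (psi T) (psi 0) Hh) as [Ec Es]; [congruence|congruence|].
  destruct (Rtotal_order (psi T) (psi 0 + 2 * PI)) as [L|[L|L]]; [|exact L|].
  - exfalso. assert (C := cos_lt_1 (psi T - psi 0) ltac:(lra)).
    rewrite cos_minus, Ec, Es in C. assert (E := cos_sin_sqr (psi 0)). simpl in E. lra.
  - exfalso.
    destruct (f_interv_is_interv psi 0 T (psi 0 + 2 * PI)) as [s [Hs Es']];
      [exact HT|generalize PI_RGT_0; lra| |].
    { intros a _. apply continuity_pt_filterlim, (ex_derive_continuous psi).
      eexists; apply Dpsi. }
    assert (HPI := PI_RGT_0).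
    apply (Hmin s).
    + split.
      * destruct (proj1 Hs); [auto|subst; lra].
      * destruct (proj2 Hs); [auto|subst; lra].
    + destruct (Hpsi s) as [Xs Ys]. rewrite Xs, Ys, X0, Y0, Es'.
      unfold uu, yy. rewrite cos_plus, sin_plus, cos_2PI, sin_2PI. split; [f_equal|]; ring.
Qed.

(** Substituting [psi] changes the time integral into one over an angular interval of length [2 PI];
    periodicity moves its start to 0. The value therefore depends on [h] alone and not on the
    parametrization. *)
Lemma gamma_integral (a b : nat -> nat -> R) (h T : R) (x y : R -> R) : oval_level h ->
  is_Gamma h x y T ->
  is_line_integral (quartic a) (quartic b) x y T (RInt (orbit_integrand a b h) 0 (2 * PI)).
Proof.
  intros Hh [Hper [Hlev Hx]]. assert (Hsol := proj1 Hper).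
  destruct (gamma_angle h x y Hh Hsol Hlev Hx) as [psi [P D]].
  assert (Turn := gamma_turn h T x y psi Hh Hper P D).
  unfold is_line_integral.
  rewrite <- (RInt_periodic (orbit_integrand a b h) (psi 0)).
  2: intros; apply orbit_integrand_continuous, Hh.
  2: { intros t. unfold orbit_integrand, uu, yy. rewrite cos_plus, sin_plus, cos_2PI, sin_2PI.
       rewrite !Rmult_1_r, !Rmult_0_r, Rminus_0_r, Rplus_0_r. reflexivity. }
  rewrite <- Turn.
  apply (is_RInt_ext (fun t => scal (/ dX (uu h (psi t))) (orbit_integrand a b h (psi t)))).
  - intros t _. destruct (Hsol t) as [D1 D2].
    replace (Derive x t) with (y t) by (symmetry; apply is_derive_unique, D1).
    replace (Derive y t) with (x t ^ 3 * (1 - x t)) by (symmetry; apply is_derive_unique, D2).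
    destruct (P t) as [-> ->]. unfold scal; simpl; unfold mult; simpl. unfold orbit_integrand.
    assert (N := dX_pos _ (uu_range h (psi t) Hh)). simpl. field. lra.
  - apply (is_RInt_comp (V := R_CompleteNormedModule)).
    + intros t _. apply orbit_integrand_continuous, Hh.
    + intros t _. split; [apply D|].
      apply (continuous_comp psi (fun s => / dX (uu h s))).
      * apply (ex_derive_continuous psi). eexists; apply D.
      * apply (continuous_uu (fun u => / dX u)); [exact Hh|]. intros u Hu.
        apply continuous_comp; [apply dX_continuous, Hu|].
        apply continuous_Rinv. apply Rgt_not_eq, dX_pos, Hu.
Qed.

(** A positive lower bound makes the time tend to infinity with the angle, hence makes time a
    surjective function of the angle. The numbers are crude: [q^2 >= 1 / 10] and [(5/4)^3 < 3]. *)
Lemma dX_lower (u : R) : u ^ 2 < 1 / 10 -> 1 / 10 <= dX u.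
Proof.
  intros Hu. destruct (X_spec u Hu) as [A _]. unfold dX.
  assert (Q := q_pos (X u) ltac:(lra)). assert (S := q_sqr (X u) ltac:(lra)).
  set (x := X u) in *. assert (P2 : 0 < x ^ 2) by (apply pow_lt; lra).
  assert (P3 : 0 < x ^ 3) by (apply pow_lt; lra).
  assert (3 / 10 <= q x) by nra.
  assert (x ^ 2 <= 25 / 16) by (simpl; nra).
  assert (x ^ 3 <= 3) by (replace (x ^ 3) with (x * x ^ 2) by ring; nra).
  apply (Rmult_le_reg_r (x ^ 3)); auto. unfold Rdiv.
  rewrite (Rmult_assoc (q x)), Rinv_l by lra. lra.
Qed.

(** The orbit is built by quadrature: the time [S] is the integral of [dX] over the angle, and its
    inverse [psi] is inserted into the circle. Since [S] maps the line onto itself the solution is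
    global, with period [S (2 * PI)]. *)
Lemma gamma_exists (h : R) : oval_level h -> exists x y T, is_Gamma h x y T.
Proof.
  intros Hh.
  set (f := fun t => dX (uu h t)).
  assert (Fc : forall t, continuous f t) by (intros; apply continuous_uu; auto using dX_continuous).
  assert (Fl : forall t, 1 / 10 <= f t) by (intros; apply dX_lower, uu_range, Hh).
  set (S := fun t => RInt f 0 t).
  assert (DS : forall t, is_derive S t (f t)).
  { intros t. apply (is_derive_RInt (V := R_CompleteNormedModule) f _ 0); [|apply Fc].
    apply filter_forall. intros s. apply RInt_correct.
    apply (ex_RInt_continuous (V := R_CompleteNormedModule)); auto. }
  assert (Sinc : forall s t, s < t -> S s < S t).
  { intros s t Hst. apply (deriv_pos_increasing S f); auto. intros z _; specialize (Fl z); lra. }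
  assert (S0 : S 0 = 0) by (unfold S; rewrite RInt_point; reflexivity).
  assert (Sinj : forall s t, S s = S t -> s = t).
  { intros s t E. destruct (Rtotal_order s t) as [L|[L|L]]; [|exact L|];
      apply Sinc in L; lra. }
  assert (Sgrow : forall s t, s <= t -> (t - s) / 10 <= S t - S s).
  { intros s t Hst.
    assert (S s - s / 10 <= S t - t / 10); [|lra].
    apply (deriv_nonneg_le (fun t => S t - t / 10) (fun t => f t - 1 / 10)); auto.
    - intros z _. apply (is_derive_minus S (fun t => t / 10)); [apply DS|].
      auto_derive; [exact I|field].
    - intros z _. specialize (Fl z); lra. }
  assert (Ssurj : forall t, exists s, S s = t).
  { intros t. set (B := 10 * Rabs t + 1).
    assert (Ht := Rabs_pos t). assert (G1 := Sgrow 0 B ltac:(unfold B; lra)).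
    assert (G2 := Sgrow (- B) 0 ltac:(unfold B; lra)). rewrite S0 in *.
    assert (A1 := Rle_abs t). assert (A2 := Rle_abs (- t)). rewrite Rabs_Ropp in A2.
    destruct (f_interv_is_interv S (- B) B t) as [s [_ Es]]; [unfold B; lra|unfold B in *; lra| |].
    - intros z _. apply continuity_pt_filterlim, (ex_derive_continuous S). eexists; apply DS.
    - exists s; exact Es. }
  set (psi := fun t : R => iota (fun s : R => S s = t)).
  assert (Spsi : forall t, S (psi t) = t).
  { intros t. apply (iota_correct (fun s : R => S s = t)).
    destruct (Ssurj t) as [s Es]. exists s; split; [exact Es|].
    intros s' E'. apply Sinj. congruence. }
  assert (psiS : forall s, psi (S s) = s) by (intros s; apply Sinj, Spsi).
  assert (Dpsi : forall t, is_derive psi t (/ dX (uu h (psi t)))).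
  { intros t. rewrite <- (Spsi t) at 1.
    apply (inverse_derive (fun _ => True) S f psi); auto.
    - intros x _. exists 1. repeat split; lra.
    - intros x _. specialize (Fl x). lra. }
  assert (Sper : forall s, S (s + 2 * PI) = S s + S (2 * PI)).
  { intros s.
    assert (E := constant_of_derive (fun s => S (s + 2 * PI) - S s)). simpl in E.
    rewrite Rplus_0_l, S0 in E.
    assert (E' : S (s + 2 * PI) - S s = S (2 * PI) - 0); [apply E|lra].
    - intros t. evar_last.
      + apply (is_derive_minus (fun s => S (s + 2 * PI)) S); [|apply DS].
        apply (is_derive_comp S (fun s => s + 2 * PI)); [apply DS|].
        instantiate (1 := 1). auto_derive; [exact I|ring].
      + unfold minus, plus, opp, scal; simpl; unfold mult; simpl. unfold f, uu.
        rewrite cos_plus, cos_2PI, sin_2PI.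
        rewrite !Rmult_1_r, !Rmult_0_r, Rminus_0_r. ring. }
  assert (HPI := PI_RGT_0).
  assert (psiper : forall t, psi (t + S (2 * PI)) = psi t + 2 * PI).
  { intros t. apply Sinj. rewrite Sper, !Spsi. reflexivity. }
  exists (fun t => X (uu h (psi t))), (fun t => yy h (psi t)), (S (2 * PI)).
  split; [|split].
  - split; [|split; [|split]].
    + intros t. assert (N := dX_pos _ (uu_range h (psi t) Hh)). split.
      * evar_last.
        -- apply (is_derive_comp X (fun t => uu h (psi t))); [apply X_derive, uu_range, Hh|].
           apply (is_derive_comp (uu h) psi); [apply uu_derive|apply Dpsi].
        -- unfold scal; simpl; unfold mult; simpl. field. lra.
      * evar_last.
        -- apply (is_derive_comp (yy h) psi); [apply yy_derive|apply Dpsi].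
        -- unfold scal; simpl; unfold mult; simpl.
           rewrite <- (X_force _ (uu_range h (psi t) Hh)). simpl. field. lra.
    + rewrite <- S0. apply Sinc. lra.
    + intros t. rewrite psiper. unfold uu, yy.
      rewrite cos_plus, sin_plus, cos_2PI, sin_2PI. split; [f_equal|]; ring.
    + intros s Hs [E1 E2].
      destruct (uu_inj h (psi s) (psi 0) Hh E1 E2) as [Ec Es].
      replace (psi 0) with 0 in * by (symmetry; rewrite <- S0 at 1; apply psiS).
      assert (0 < psi s).
      { apply Rnot_le_lt. intros [L|L]; [apply Sinc in L; rewrite Spsi, S0 in L; lra|].
        apply (f_equal S) in L. rewrite Spsi, S0 in L. lra. }
      assert (psi s < 2 * PI).
      { apply Rnot_le_lt. intros [L|L]; [apply Sinc in L; rewrite Spsi in L; lra|].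
        apply (f_equal S) in L. rewrite Spsi in L. lra. }
      assert (C := cos_lt_1 (psi s) ltac:(lra)). rewrite Ec, cos_0 in C. lra.
  - intros t. unfold H. assert (E := yy_level h (psi t) Hh). lra.
  - intros t. apply XX_range, Hh.
Qed.

(** [gamma_exists] and [gamma_integral] give the existence and the uniqueness that [iota]
    requires. *)
Lemma M1_integral (a b : nat -> nat -> R) (h : R) : oval_level h ->
  M1 a b h = RInt (orbit_integrand a b h) 0 (2 * PI).
Proof.
  intros Hh. apply (iota_unique (K := R_AbsRing) (V := R_CompleteNormedModule)).
  - intros v [x [y [T [G L]]]].
    assert (L' := gamma_integral a b h T x y Hh G). unfold is_line_integral in *.

    apply (is_RInt_unique (V := R_CompleteNormedModule)) in L.
    apply (is_RInt_unique (V := R_CompleteNormedModule)) in L'. congruence.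
  - destruct (gamma_exists h Hh) as [x [y [T G]]]. exists x, y, T. split; [exact G|].
    apply gamma_integral; auto.
Qed.

(** * Reduction of the quartic perturbation to six integrals *)

Lemma is_RInt_sum_n (f : nat -> R -> R) (v : nat -> R) (a b : R) (n : nat) :
  (forall i, is_RInt (f i) a b (v i)) ->
  is_RInt (fun t => sum_n (fun i => f i t) n) a b (sum_n v n).
Proof.
  intros Hf. induction n as [|n IH].
  - rewrite sum_O. apply (is_RInt_ext (f 0%nat)); [intros; rewrite sum_O; reflexivity|apply Hf].
  - rewrite sum_Sn.
    apply (is_RInt_ext (fun t => plus (sum_n (fun i => f i t) n) (f (S n) t))).
    + intros; rewrite sum_Sn; reflexivity.
    + apply (is_RInt_plus (V := R_NormedModule)); auto.
Qed.

Lemma J_is (g : R -> R) (m : nat) (h : R) :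
  oval_level h -> (forall x, 0 < x -> continuous g x) ->
  is_RInt (fun t => g (X (uu h t)) * dX (uu h t) * yy h t ^ m) 0 (2 * PI) (J g m h).
Proof.
  intros Hh Hg. apply (RInt_correct (V := R_CompleteNormedModule)).
  exact (J_ex g m h _ _ Hh Hg).
Qed.

(** The weight serves both halves of the integrand: [g = 1], [m = 1] for [Q dx], and
    [g = x^4 - x^3], [m = 0] for [- P dy]. *)
Lemma quartic_integral (c : nat -> nat -> R) (g : R -> R) (m : nat) (h : R) :
  oval_level h -> (forall x, 0 < x -> continuous g x) ->
  is_RInt (fun t => quartic c (X (uu h t)) (yy h t) * g (X (uu h t)) * dX (uu h t) * yy h t ^ m)
    0 (2 * PI)
    (sum_n (fun i => sum_n (fun j => c i j * J (fun x => x ^ i * g x) (j + m) h) (4 - i)) 4).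
Proof.
  intros Hh Hg.
  apply (is_RInt_ext (fun t => sum_n (fun i => sum_n (fun j =>
    c i j * (X (uu h t) ^ i * g (X (uu h t)) * dX (uu h t) * yy h t ^ (j + m))) (4 - i)) 4)).
  - intros t _. unfold quartic.
    rewrite !sum_Sn, !sum_O. simpl Nat.sub. rewrite !sum_Sn, !sum_O.
    unfold plus; simpl. as_R. ring.
  - apply (is_RInt_sum_n (fun i t => sum_n (fun j =>
    c i j * (X (uu h t) ^ i * g (X (uu h t)) * dX (uu h t) * yy h t ^ (j + m))) (4 - i))).
    intros i.
    apply (is_RInt_sum_n (fun j t =>
      c i j * (X (uu h t) ^ i * g (X (uu h t)) * dX (uu h t) * yy h t ^ (j + m)))).
    intros j. apply (is_RInt_scal (V := R_NormedModule)).
    apply (J_is (fun x => x ^ i * g x)); auto.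
    intros x Hx. apply (continuous_mult (K := R_AbsRing) (fun x => x ^ i) g); auto.
    apply pow_continuous.
Qed.

(** Green's formula for a monomial: [- x^(n+1) y^j dy] and [(n+1)/(j+1) x^n y^(j+1) dx] differ by an
    exact form. *)
Lemma J_reduce_a (n j : nat) (h : R) : oval_level h ->
  J (fun x => x ^ S n * (x ^ 4 - x ^ 3)) j h =
  INR (S n) / INR (S j) * J (fun x => x ^ n) (S (S j)) h.
Proof.
  intros Hh. assert (Hn : INR (S n) <> 0) by (apply not_0_INR; lia).
  assert (Hj : INR (S j) <> 0) by (apply not_0_INR; lia).
  rewrite (J_parts (fun x => / INR (S n) * x ^ S n) (fun x => x ^ n) j h Hh).
  2: intros; apply pow_primitive. 2: intros; apply pow_continuous.
  rewrite (J_ext (fun x => / INR (S n) * x ^ S n * (x ^ 4 - x ^ 3))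
    (fun x => / INR (S n) * (x ^ S n * (x ^ 4 - x ^ 3))) j h Hh) by (intros; ring).
  rewrite J_scal; auto.
  - field; auto.
  - intros x _. apply (ex_derive_continuous (fun x => x ^ S n * (x ^ 4 - x ^ 3))).
    auto_derive. exact I.
Qed.

Lemma J_reduce_a0 (j : nat) (h : R) : oval_level h ->
  J (fun x => x ^ 0 * (x ^ 4 - x ^ 3)) j h = 0.
Proof.
  intros Hh.
  rewrite (J_lin2 1 (- 1) (fun x => x ^ 4) (fun x => x ^ 3)
    (fun x => x ^ 0 * (x ^ 4 - x ^ 3)) j h Hh);
    try (intros; apply pow_continuous).
  - rewrite Jx_34 by exact Hh. ring.
  - intros; ring.
Qed.

(** Reflection kills the even powers of [y] in [Q] and the odd ones in [P], and the terms [y^j] of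
    [P] are exact. What remains pairs off: [x^i y^j] of [Q] with [x^(i+1) y^(j-1)] of [P], for
    [j = 1], [i <= 3] and [j = 3], [i <= 1]. *)
Lemma M1_formula (a b : nat -> nat -> R) (h : R) : oval_level h ->
  M1 a b h =
    (b 0%nat 1%nat + a 1%nat 0%nat) * Ix 0 h + (b 1%nat 1%nat + 2 * a 2%nat 0%nat) * Ix 1 h
    + (b 2%nat 1%nat + 3 * a 3%nat 0%nat) * Ix 2 h + (b 3%nat 1%nat + 4 * a 4%nat 0%nat) * Ix 3 h
    + (b 0%nat 3%nat + a 1%nat 2%nat / 3) * J (fun x => x ^ 0) 4 h
    + (b 1%nat 3%nat + 2 / 3 * a 2%nat 2%nat) * J (fun x => x ^ 1) 4 h.
Proof.
  intros Hh. rewrite M1_integral by exact Hh.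
  assert (Qb := quartic_integral b (fun _ => 1) 1 h Hh ltac:(intros; apply continuous_const)).
  assert (Qa := quartic_integral a (fun x => x ^ 4 - x ^ 3) 0 h Hh
    ltac:(intros; apply (continuous_minus (V := R_NormedModule)); apply pow_continuous)).
  assert (Q := is_RInt_plus (V := R_NormedModule) _ _ _ _ _ _ Qb Qa).
  apply (is_RInt_unique (V := R_CompleteNormedModule)).
  evar_last.
  - eapply (is_RInt_ext (V := R_NormedModule)); [|exact Q].
    intros t _. unfold orbit_integrand, plus; simpl. ring.
  - assert (B1 : forall i m, J (fun x => x ^ i * 1) m h = J (fun x => x ^ i) m h).
    { intros; apply J_ext; auto; intros; ring. }
    assert (Odd : forall i m, Nat.odd m = true -> J (fun x => x ^ i) m h = 0).
    { intros i m Hm. apply Nat.odd_spec in Hm. destruct Hm as [k ->].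
      rewrite Nat.add_1_r. apply (J_odd (fun x => x ^ i)); auto.
      intros; apply pow_continuous. }
    rewrite !sum_Sn, !sum_O. unfold plus. simpl Nat.sub. rewrite !sum_Sn, !sum_O.
    unfold plus. simpl Nat.add.
    rewrite !B1, !J_reduce_a, !J_reduce_a0 by exact Hh.
    rewrite !(Odd _ 1%nat), !(Odd _ 3%nat), !(Odd _ 5%nat) by reflexivity.
    fold (Ix 0 h) (Ix 1 h) (Ix 2 h) (Ix 3 h).
    simpl. field.
Qed.

(** * Asymptotic expansions at the loop *)

(* [OO n p B f]: the functions [f, theta f, ..., theta^n f], [theta = h d/dh],
   are bounded by [B s^p] for [s = - h <= 1/40]. *)
Fixpoint OO (n : nat) (p B : R) (f : R -> R) : Prop :=
  (forall h, near_loop h -> Rabs (f h) <= B * sp p h) /\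
  match n with
  | 0%nat => True
  | S n' => exists f1, (forall h, oval_level h -> is_derive f h (f1 h / h)) /\ OO n' p B f1
  end.

Lemma OO_bound (n : nat) (p B : R) (f : R -> R) :
  OO n p B f -> forall h, near_loop h -> Rabs (f h) <= B * sp p h.
Proof. destruct n; intros [H1 _]; exact H1. Qed.

Lemma OO_const_nonneg (n : nat) (p B : R) (f : R -> R) : OO n p B f -> 0 <= B.
Proof.
  intros Hf. assert (N : near_loop (- (1 / 40))) by (unfold near_loop; lra).
  assert (H1 := OO_bound n p B f Hf _ N). assert (A := Rabs_pos (f (- (1 / 40)))).
  assert (P := sp_pos p (- (1 / 40))). nra.
Qed.

Lemma OO_ext (n : nat) (p B : R) (f g : R -> R) :
  (forall h, oval_level h -> f h = g h) -> OO n p B f -> OO n p B g.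
Proof.
  intros E. destruct n as [|n]; intros [H1 H2]; (split; [|]).
  - intros h Hh. rewrite <- E by (apply near_loop_oval, Hh). auto.
  - exact I.
  - intros h Hh. rewrite <- E by (apply near_loop_oval, Hh). auto.
  - destruct H2 as [f1 [D O]]. exists f1. split; [|exact O].
    intros h Hh. apply (is_derive_ext_loc f); [|auto].
    apply (filter_imp oval_level); [exact E|apply oval_level_locally, Hh].
Qed.

Lemma OO_weaken (n : nat) (p p' B B' : R) (f : R -> R) :
  p' <= p -> B <= B' -> OO n p B f -> OO n p' B' f.
Proof.
  intros Hp HB. revert f. induction n as [|n IH]; intros f Hf;
    (assert (B0 := OO_const_nonneg _ _ _ _ Hf)); destruct Hf as [H1 H2].
  all: assert (H1' : forall h, near_loop h -> Rabs (f h) <= B' * sp p' h).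
  all: try (intros h Hh; specialize (H1 h Hh);
    assert (Q := sp_le p' p h ltac:(unfold near_loop in Hh; lra) Hp);
    assert (P := sp_pos p h); nra).
  - split; auto.
  - split; [exact H1'|]. destruct H2 as [f1 [D O]]. exists f1. split; auto.
Qed.

Lemma OO_S (n : nat) (p B : R) (f : R -> R) : OO (S n) p B f -> OO n p B f.
Proof.
  revert f. induction n as [|n IH]; intros f [H1 [f1 [D O]]].
  - split; [exact H1|exact I].
  - split; [exact H1|]. exists f1. split; auto.
Qed.

Lemma OO_plus (n : nat) (p B B' : R) (f g : R -> R) :
  OO n p B f -> OO n p B' g -> OO n p (B + B') (fun h => f h + g h).
Proof.
  revert f g. induction n as [|n IH]; intros f g [F1 F2] [G1 G2].
  all: assert (A : forall h, near_loop h -> Rabs (f h + g h) <= (B + B') * sp p h)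
    by (intros h Hh; eapply Rle_trans; [apply Rabs_triang|];
        specialize (F1 h Hh); specialize (G1 h Hh); lra).
  - split; auto.
  - split; [exact A|]. destruct F2 as [f1 [Df Of]]. destruct G2 as [g1 [Dg Og]].
    exists (fun h => f1 h + g1 h). split; [|auto].
    intros h Hh. replace ((f1 h + g1 h) / h) with (f1 h / h + g1 h / h)
      by (field; unfold oval_level in Hh; lra).
    apply (is_derive_plus f g); auto.
Qed.

Lemma OO_scal (n : nat) (p B c : R) (f : R -> R) :
  OO n p B f -> OO n p (Rabs c * B) (fun h => c * f h).
Proof.
  revert f. induction n as [|n IH]; intros f [F1 F2].
  all: assert (A : forall h, near_loop h -> Rabs (c * f h) <= Rabs c * B * sp p h)
    by (intros h Hh; rewrite Rabs_mult, Rmult_assoc; apply Rmult_le_compat_l;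
        [apply Rabs_pos|auto]).
  - split; auto.
  - split; [exact A|]. destruct F2 as [f1 [Df Of]].
    exists (fun h => c * f1 h). split; [|auto].
    intros h Hh. replace (c * f1 h / h) with (c * (f1 h / h)) by (unfold Rdiv; ring).
    apply is_derive_scal; auto.
Qed.

(** [theta] is a derivation: each application doubles the number of products, hence [2 ^ n]. *)
Lemma OO_mult (n : nat) (p p' B B' : R) (f g : R -> R) :
  OO n p B f -> OO n p' B' g -> OO n (p + p') (2 ^ n * (B * B')) (fun h => f h * g h).
Proof.
  revert f g. induction n as [|n IH]; intros f g Hf Hg;
    assert (B0 := OO_const_nonneg _ _ _ _ Hf); assert (B0' := OO_const_nonneg _ _ _ _ Hg).
  all: assert (A : forall h, near_loop h -> Rabs (f h * g h) <= B * B' * sp (p + p') h).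
  1,3: intros h Hh; rewrite Rabs_mult, <- sp_add;
    assert (F := OO_bound _ _ _ _ Hf h Hh); assert (G := OO_bound _ _ _ _ Hg h Hh);
    replace (B * B' * (sp p h * sp p' h)) with ((B * sp p h) * (B' * sp p' h)) by ring;
    apply Rmult_le_compat; auto using Rabs_pos.
  - split; [|exact I]. intros h Hh. simpl. rewrite Rmult_1_l. auto.
  - assert (Hf' := OO_S _ _ _ _ Hf). assert (Hg' := OO_S _ _ _ _ Hg).
    destruct Hf as [F1 [f1 [Df Of]]]. destruct Hg as [G1 [g1 [Dg Og]]].
    split.
    + intros h Hh. eapply Rle_trans; [apply A, Hh|].
      assert (P := sp_pos (p + p') h). apply Rmult_le_compat_r; [lra|].
      assert (1 <= 2 ^ S n) by (apply pow_R1_Rle; lra).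
      assert (0 <= B * B') by (apply Rmult_le_pos; auto). nra.
    + exists (fun h => f1 h * g h + f h * g1 h). split.
      * intros h Hh. evar_last.
        -- apply (is_derive_mult f g); [apply Df, Hh|apply Dg, Hh|intros; apply Rmult_comm].
        -- unfold plus, mult; simpl. field. unfold oval_level in Hh; lra.
      * replace (2 ^ S n * (B * B')) with (2 ^ n * (B * B') + 2 ^ n * (B * B')) by (simpl; ring).
        apply OO_plus; apply IH; auto.
Qed.

(** Expansions are manipulated in this form, with hidden constants; the counting of zeros returns to
    [OO 6] with an explicit constant, which must be linear in the parameters. *)
Definition EO (p : R) (f : R -> R) : Prop := forall n, exists B, OO n p B f.

Lemma EO_ext (p : R) (f g : R -> R) :
  (forall h, oval_level h -> f h = g h) -> EO p f -> EO p g.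
Proof. intros E Hf n. destruct (Hf n) as [B O]. exists B. eapply OO_ext; eauto. Qed.

Lemma EO_weaken (p p' : R) (f : R -> R) : p' <= p -> EO p f -> EO p' f.
Proof.
  intros Hp Hf n. destruct (Hf n) as [B O]. exists B.
  eapply OO_weaken; eauto. lra.
Qed.

Lemma EO_plus (p : R) (f g : R -> R) : EO p f -> EO p g -> EO p (fun h => f h + g h).
Proof.
  intros Hf Hg n. destruct (Hf n) as [B O]. destruct (Hg n) as [B' O'].
  exists (B + B'). apply OO_plus; auto.
Qed.

Lemma EO_scal (p c : R) (f : R -> R) : EO p f -> EO p (fun h => c * f h).
Proof.
  intros Hf n. destruct (Hf n) as [B O]. exists (Rabs c * B). apply OO_scal; auto.
Qed.

Lemma EO_mult (p p' : R) (f g : R -> R) :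
  EO p f -> EO p' g -> EO (p + p') (fun h => f h * g h).
Proof.
  intros Hf Hg n. destruct (Hf n) as [B O]. destruct (Hg n) as [B' O'].
  eexists. apply OO_mult; eauto.
Qed.

Lemma EO_sp (p : R) : EO p (sp p).
Proof.
  assert (B0 : forall h, Rabs (sp p h) = 1 * sp p h)
    by (intros; rewrite Rabs_right; [ring|apply Rle_ge, Rlt_le, sp_pos]).
  intros n. induction n as [|n [B IH]].
  - exists 1. split; [|exact I]. intros h _. rewrite B0. lra.
  - exists (Rmax 1 (Rabs p * B)). split.
    + intros h _. rewrite B0. apply Rmult_le_compat_r; [apply Rlt_le, sp_pos|apply Rmax_l].
    + exists (fun h => p * sp p h). split.
      * intros h Hh. apply sp_derive. unfold oval_level in Hh; lra.
      * eapply OO_weaken; [apply Rle_refl|apply Rmax_r|]. apply OO_scal, IH.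
Qed.

Lemma EO_id : EO 1 (fun h => h).
Proof.
  apply (EO_ext 1 (fun h => (-1) * sp 1 h)).
  - intros h Hh. rewrite sp_1; [ring|]. unfold oval_level in Hh; lra.
  - apply EO_scal, EO_sp.
Qed.

Lemma EO_step (p : R) (f f1 : R -> R) (n : nat) :
  (exists C, forall h, near_loop h -> Rabs (f h) <= C * sp p h) ->
  (forall h, oval_level h -> is_derive f h (f1 h / h)) ->
  (exists B, OO n p B f1) -> exists B, OO (S n) p B f.
Proof.
  intros [C HC] D [B O]. exists (Rmax C B). split.
  - intros h Hh. eapply Rle_trans; [apply HC, Hh|].
    apply Rmult_le_compat_r; [apply Rlt_le, sp_pos|apply Rmax_l].
  - exists f1. split; [exact D|]. eapply OO_weaken; [apply Rle_refl|apply Rmax_r|exact O].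
Qed.

Lemma EO_inv : EO 0 (fun h => / (1 + 20 * h)).
Proof.
  intros n. induction n as [|n [B IH]].
  - exists 2. split; [|exact I]. intros h Hh. unfold near_loop in Hh. rewrite sp_0.
    rewrite Rabs_right by (apply Rle_ge, Rlt_le, Rinv_0_lt_compat; lra).
    replace (2 * 1) with (/ (1 / 2)) by field. apply Rinv_le_contravar; lra.
  (* For [w = 1 / (1 + 20 h)] one has [theta w = w^2 - w], which closes the induction. *)
  - apply (EO_step 0 _ (fun h => / (1 + 20 * h) * / (1 + 20 * h) + (-1) * / (1 + 20 * h))).
    + exists 2. intros h Hh. unfold near_loop in Hh. rewrite sp_0.
      rewrite Rabs_right by (apply Rle_ge, Rlt_le, Rinv_0_lt_compat; lra).
      replace (2 * 1) with (/ (1 / 2)) by field. apply Rinv_le_contravar; lra.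
    + intros h Hh. unfold oval_level in Hh. auto_derive; [lra|]. field. lra.
    + eexists. apply OO_plus.
      * replace 0 with (0 + 0) by ring. apply OO_mult; exact IH.
      * apply OO_scal, IH.
Qed.

(** This is [ln z <= z] at [z = s^(-1/8)]. The loss 1/8 is small enough for [s ln s], of order 7/8,
    to stay above the term [s^(3/4)]. *)
Lemma ln_bound (h : R) : near_loop h -> Rabs (ln (- h)) <= 8 * sp (- (1 / 8)) h.
Proof.
  intros Hh. unfold near_loop in Hh.
  assert (L : ln (- h) <= 0) by (rewrite <- ln_1; apply ln_le; lra).
  rewrite Rabs_left1 by exact L.
  assert (P := sp_pos (- (1 / 8)) h).
  assert (E : ln (sp (- (1 / 8)) h) = - (1 / 8) * ln (- h)) by (unfold sp, Rpower; apply ln_exp).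
  assert (Q : ln (sp (- (1 / 8)) h) <= sp (- (1 / 8)) h).
  { assert (T := exp_ineq1_le (ln (sp (- (1 / 8)) h))). rewrite exp_ln in T by exact P. lra. }
  lra.
Qed.

Definition slog (h : R) : R := sp 1 h * ln (- h).

Lemma slog_derive (h : R) : h < 0 -> is_derive slog h ((slog h + sp 1 h) / h).
Proof.
  intros Hh. unfold slog. evar_last.
  - apply (is_derive_mult (sp 1) (fun h => ln (- h))); [apply sp_derive, Hh| |].
    + instantiate (1 := / h). auto_derive; [lra|]. field. lra.
    + intros; apply Rmult_comm.
  - unfold plus, mult; simpl. field. lra.
Qed.

Lemma EO_slog : EO (7 / 8) slog.
Proof.
  assert (B : forall h, near_loop h -> Rabs (slog h) <= 8 * sp (7 / 8) h).
  { intros h Hh. assert (L := ln_bound h Hh). unfold slog. rewrite Rabs_mult.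
    rewrite (Rabs_right (sp 1 h)) by (apply Rle_ge, Rlt_le, sp_pos).
    replace (sp (7 / 8) h) with (sp 1 h * sp (- (1 / 8)) h) by (rewrite sp_add; f_equal; field).
    assert (P := sp_pos 1 h). nra. }
  intros n. induction n as [|n [C IH]].
  - exists 8. split; [exact B|exact I].
  - apply (EO_step _ _ (fun h => slog h + sp 1 h)).
    + exists 8. exact B.
    + intros h Hh. apply slog_derive. unfold oval_level in Hh; lra.
    + destruct (EO_weaken 1 (7 / 8) (sp 1) ltac:(lra) (EO_sp 1) n) as [C' O'].
      exists (C + C'). apply OO_plus; auto.
Qed.

(** * The equations [theta f = p f + w] *)

Lemma ratio_derive (p : R) (f w : R -> R) :
  (forall h, oval_level h -> is_derive f h ((p * f h + w h) / h)) ->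
  forall h, oval_level h -> is_derive (fun h => sp (- p) h * f h) h (sp (- p) h * w h / h).
Proof.
  intros Hf h Hh. evar_last.
  - apply (is_derive_mult (sp (- p)) f); [apply sp_derive; unfold oval_level in Hh; lra|apply Hf, Hh|].
    intros; apply Rmult_comm.
  - unfold plus, mult; simpl. field. unfold oval_level in Hh; lra.
Qed.

Lemma near_loop_between (h1 h2 x : R) : near_loop h1 -> near_loop h2 -> h1 <= x <= h2 -> near_loop x.
Proof. unfold near_loop; lra. Qed.

(** The function [s^(-p) f] has [theta]-derivative [s^(-p) w], bounded by [B s^(r-p)], which is
    [theta] of [B / (r-p) s^(r-p)]. Adding or subtracting the latter gives two monotone functions,
    whatever the sign of [r - p]. *)
Lemma fuchs_sides (p r B : R) (f w : R -> R) :
  r <> p ->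
  (forall h, oval_level h -> is_derive f h ((p * f h + w h) / h)) ->
  (forall h, near_loop h -> Rabs (w h) <= B * sp r h) ->
  forall h1 h2, near_loop h1 -> near_loop h2 -> h1 <= h2 ->
    sp (- p) h2 * f h2 + B / (r - p) * sp (r - p) h2 <=
    sp (- p) h1 * f h1 + B / (r - p) * sp (r - p) h1 /\
    sp (- p) h1 * f h1 - B / (r - p) * sp (r - p) h1 <=
    sp (- p) h2 * f h2 - B / (r - p) * sp (r - p) h2.
Proof.
  intros Hrp Hf Hw h1 h2 H1 H2 H12.
  assert (D := ratio_derive p f w Hf).
  assert (D2 : forall h, oval_level h ->
    is_derive (fun h => B / (r - p) * sp (r - p) h) h (B * sp (r - p) h / h)).
  { intros h Hh. evar_last.
    - apply is_derive_scal, sp_derive. unfold oval_level in Hh; lra.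
    - field. unfold oval_level in Hh; lra. }
  assert (Est : forall h, near_loop h -> Rabs (sp (- p) h * w h) <= B * sp (r - p) h).
  { intros h Hh. rewrite Rabs_mult, Rabs_right by (apply Rle_ge, Rlt_le, sp_pos).
    replace (r - p) with (- p + r) by ring. rewrite <- sp_add.
    specialize (Hw h Hh). assert (P := sp_pos (- p) h). nra. }
  split.
  - apply Ropp_le_cancel.
    apply (deriv_nonneg_le (fun h => - (sp (- p) h * f h + B / (r - p) * sp (r - p) h))
      (fun h => - (sp (- p) h * w h / h + B * sp (r - p) h / h))); [exact H12| |];
      intros x Hx; assert (N := near_loop_between h1 h2 x H1 H2 Hx); assert (G := near_loop_oval x N).
    + apply (is_derive_opp (fun h => sp (- p) h * f h + B / (r - p) * sp (r - p) h)).
      apply (is_derive_plus (fun h => sp (- p) h * f h)); auto.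
    + specialize (Est x N). assert (A := Rabs_le_between (sp (- p) x * w x) (B * sp (r - p) x)).
      apply A in Est. unfold near_loop in N.
      replace (- (sp (- p) x * w x / x + B * sp (r - p) x / x))
        with ((sp (- p) x * w x + B * sp (r - p) x) * / (- x)) by (field; lra).
      apply Rmult_le_pos; [lra|apply Rlt_le, Rinv_0_lt_compat; lra].
  - apply (deriv_nonneg_le (fun h => sp (- p) h * f h - B / (r - p) * sp (r - p) h)
      (fun h => sp (- p) h * w h / h - B * sp (r - p) h / h)); [exact H12| |];
      intros x Hx; assert (N := near_loop_between h1 h2 x H1 H2 Hx); assert (G := near_loop_oval x N).
    + apply (is_derive_minus (fun h => sp (- p) h * f h)); auto.
    + specialize (Est x N). assert (A := Rabs_le_between (sp (- p) x * w x) (B * sp (r - p) x)).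
      apply A in Est. unfold near_loop in N.
      replace (sp (- p) x * w x / x - B * sp (r - p) x / x)
        with ((B * sp (r - p) x - sp (- p) x * w x) * / (- x)) by (field; lra).
      apply Rmult_le_pos; [lra|apply Rlt_le, Rinv_0_lt_compat; lra].
Qed.

Lemma sp_unratio (p x y h : R) : sp (- p) h * x = y -> x = sp p h * y.
Proof.
  intros <-. rewrite <- Rmult_assoc, sp_add.
  replace (p + - p) with 0 by ring. rewrite sp_0. ring.
Qed.

(** For [p < r] the two monotone functions [L <= U] squeeze the limit of [s^(-p) f] at the loop. The
    constant is taken as the supremum of [L], so completeness replaces a passage to the limit. *)
Lemma fuchs_high (p r B : R) (f w : R -> R) :
  p < r ->
  (forall h, oval_level h -> is_derive f h ((p * f h + w h) / h)) ->
  (forall h, near_loop h -> Rabs (w h) <= B * sp r h) ->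
  exists c, forall h, near_loop h -> Rabs (f h - c * sp p h) <= B / (r - p) * sp r h.
Proof.
  intros Hpr Hf Hw.
  set (U := fun h => sp (- p) h * f h + B / (r - p) * sp (r - p) h).
  set (L := fun h => sp (- p) h * f h - B / (r - p) * sp (r - p) h).
  assert (B0 : 0 <= B).
  { assert (N : near_loop (- (1 / 40))) by (unfold near_loop; lra). specialize (Hw _ N).
    assert (A := Rabs_pos (w (- (1 / 40)))). assert (P := sp_pos r (- (1 / 40))). nra. }
  assert (LU : forall h, L h <= U h).
  { intros h. unfold L, U. assert (P := sp_pos (r - p) h).
    assert (0 <= B / (r - p)) by (apply Rmult_le_pos; [lra|apply Rlt_le, Rinv_0_lt_compat; lra]).
    nra. }
  assert (S := fuchs_sides p r B f w ltac:(lra) Hf Hw).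
  assert (All : forall h1 h2, near_loop h1 -> near_loop h2 -> L h1 <= U h2).
  { intros h1 h2 N1 N2. destruct (Rle_or_lt h1 h2) as [l|l].
    - destruct (S h1 h2 N1 N2 l) as [_ S2]. apply Rle_trans with (1 := S2), LU.
    - destruct (S h2 h1 N2 N1 (Rlt_le _ _ l)) as [S1 _].
      apply Rle_trans with (2 := S1), LU. }
  assert (N0 : near_loop (- (1 / 40))) by (unfold near_loop; lra).
  destruct (completeness (fun y => exists h, near_loop h /\ y = L h)) as [c [Cu Cl]].
  - exists (U (- (1 / 40))). intros y [h [N ->]]. auto.
  - exists (L (- (1 / 40))), (- (1 / 40)). auto.
  - exists c. intros h N.
    assert (c1 : L h <= c) by (apply Cu; exists h; auto).
    assert (c2 : c <= U h) by (apply Cl; intros y [h' [N' ->]]; auto).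
    rewrite (sp_unratio p (f h) (sp (- p) h * f h) h) by reflexivity.
    replace (sp p h * (sp (- p) h * f h) - c * sp p h)
      with (sp p h * (sp (- p) h * f h - c)) by ring.
    rewrite Rabs_mult, Rabs_right by (apply Rle_ge, Rlt_le, sp_pos).
    replace (sp r h) with (sp p h * sp (r - p) h) by (rewrite sp_add; f_equal; ring).
    assert (P := sp_pos p h).
    assert (Rabs (sp (- p) h * f h - c) <= B / (r - p) * sp (r - p) h)
      by (apply Rabs_le; unfold L, U in *; lra).
    nra.
Qed.

(** For [r < p] the homogeneous solution [s^p] is smaller than [s^r], so comparison with the left
    end [- (1 / 40)] suffices and no constant has to be split off. *)
Lemma fuchs_low (p r B : R) (f w : R -> R) :
  r < p ->
  (forall h, oval_level h -> is_derive f h ((p * f h + w h) / h)) ->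
  (forall h, near_loop h -> Rabs (w h) <= B * sp r h) ->
  exists C, forall h, near_loop h -> Rabs (f h) <= C * sp r h.
Proof.
  intros Hpr Hf Hw.
  assert (S := fuchs_sides p r B f w ltac:(lra) Hf Hw).
  assert (N0 : near_loop (- (1 / 40))) by (unfold near_loop; lra).
  set (h0 := - (1 / 40)) in *.
  set (g := fun h => sp (- p) h * f h) in *.
  assert (B0 : 0 <= B).
  { specialize (Hw _ N0). assert (A := Rabs_pos (w h0)). assert (P := sp_pos r h0). nra. }
  exists (Rabs (g h0) + B / (p - r)). intros h N.
  assert (Hh : h0 <= h) by (unfold near_loop in N; unfold h0; lra).
  destruct (S h0 h N0 N Hh) as [S1 S2]. fold (g h0) (g h) in *.
  rewrite (sp_unratio p (f h) (g h) h) by reflexivity.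
  rewrite Rabs_mult, Rabs_right by (apply Rle_ge, Rlt_le, sp_pos).
  assert (b0 : 0 <= B / (p - r)) by (apply Rmult_le_pos; [lra|apply Rlt_le, Rinv_0_lt_compat; lra]).
  replace (B / (r - p)) with (- (B / (p - r))) in * by (field; lra).
  assert (P0 := sp_pos (r - p) h0). assert (P1 := sp_pos (r - p) h).
  assert (A : Rabs (g h) <= Rabs (g h0) + B / (p - r) * sp (r - p) h).
  { assert (A1 := Rle_abs (g h0)). assert (A2 := Rle_abs (- g h0)). rewrite Rabs_Ropp in A2.
    assert (0 <= B / (p - r) * sp (r - p) h0) by (apply Rmult_le_pos; lra).
    apply Rabs_le. lra. }
  assert (P := sp_pos p h).
  assert (Q := sp_le r p h ltac:(unfold near_loop in N; lra) ltac:(lra)).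
  replace (sp r h) with (sp p h * sp (r - p) h) in * by (rewrite sp_add; f_equal; ring).
  assert (Rabs (g h0) * sp p h <= Rabs (g h0) * (sp p h * sp (r - p) h))
    by (apply Rmult_le_compat_l; [apply Rabs_pos|exact Q]).
  assert (sp p h * Rabs (g h) <= sp p h * (Rabs (g h0) + B / (p - r) * sp (r - p) h))
    by (apply Rmult_le_compat_l; lra).
  lra.
Qed.

(** The equation expresses [theta f] by [f] and [w]; a bound of [f] itself therefore propagates to
    all its [theta]-derivatives. *)
Lemma EO_fuchs (p r : R) (f w : R -> R) :
  (exists C, forall h, near_loop h -> Rabs (f h) <= C * sp r h) ->
  (forall h, oval_level h -> is_derive f h ((p * f h + w h) / h)) ->
  EO r w -> EO r f.
Proof.
  intros Hb D Hw n. induction n as [|n [B IH]].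
  - destruct Hb as [C HC]. exists C. split; auto.
  - apply (EO_step r f (fun h => p * f h + w h)); auto.
    destruct (Hw n) as [B' O']. exists (Rabs p * B + B').
    apply OO_plus; [apply OO_scal; exact IH|exact O'].
Qed.

Lemma EO_fuchs_low (p r : R) (f w : R -> R) : r < p ->
  (forall h, oval_level h -> is_derive f h ((p * f h + w h) / h)) ->
  EO r w -> EO r f.
Proof.
  intros Hpr D Hw. apply (EO_fuchs p r f w); auto.
  destruct (Hw 0%nat) as [B O]. apply (fuchs_low p r B f w); auto.
  apply (OO_bound _ _ _ _ O).
Qed.

Lemma EO_fuchs_high (p r : R) (f w : R -> R) : p < r ->
  (forall h, oval_level h -> is_derive f h ((p * f h + w h) / h)) ->
  EO r w -> exists c, EO r (fun h => f h - c * sp p h).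
Proof.
  intros Hpr D Hw. destruct (Hw 0%nat) as [B O].
  destruct (fuchs_high p r B f w Hpr D (OO_bound _ _ _ _ O)) as [c Hc].
  exists c. apply (EO_fuchs p r _ w); auto.
  - eexists; exact Hc.
  - intros h Hh. evar_last.
    + apply (is_derive_minus f (fun h => c * sp p h)); [apply D, Hh|].
      apply is_derive_scal, sp_derive. unfold oval_level in Hh; lra.
    + unfold minus, plus, opp; simpl. field. unfold oval_level in Hh; lra.
Qed.

Lemma sp_small (d C c : R) : 0 < d -> 0 < c -> exists h, near_loop h /\ C * sp d h < c.
Proof.
  intros Hd Hc.
  set (k := c / (Rabs C + 1)).
  assert (AC := Rabs_pos C).
  assert (Hk : 0 < k) by (apply Rdiv_lt_0_compat; lra).
  set (s := Rmin (1 / 40) (Rpower k (/ d) / 2)).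
  assert (Hp : 0 < Rpower k (/ d)) by apply exp_pos.
  assert (s1 : s <= 1 / 40) by apply Rmin_l.
  assert (s2 : s <= Rpower k (/ d) / 2) by apply Rmin_r.
  assert (s0 : 0 < s) by (apply Rmin_glb_lt; lra).
  exists (- s). split; [unfold near_loop; lra|].
  assert (Q : sp d (- s) < k).
  { unfold sp. rewrite Ropp_involutive.
    replace k with (Rpower (Rpower k (/ d)) d).
    - apply Rlt_Rpower_l; lra.
    - rewrite Rpower_mult, Rinv_l by lra. apply Rpower_1, Hk. }
  assert (P := sp_pos d (- s)).
  apply Rle_lt_trans with (Rabs C * sp d (- s)).
  - apply Rmult_le_compat_r; [lra|apply Rle_abs].
  - apply Rle_lt_trans with ((Rabs C + 1) * sp d (- s)); [nra|].
    replace c with ((Rabs C + 1) * k) by (unfold k; field; lra).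
    apply Rmult_lt_compat_l; lra.
Qed.

(* An error of higher order cannot absorb a term of exact order [p]. *)
Lemma EO_no_gap (p r c : R) (f : R -> R) : p < r -> 0 < c -> EO r f ->
  ~ (forall h, near_loop h -> c * sp p h <= Rabs (f h)).
Proof.
  intros Hpr Hc Hf L. destruct (Hf 0%nat) as [B O].
  destruct (sp_small (r - p) B c) as [h [N S]]; [lra|exact Hc|].
  specialize (L h N). assert (U := OO_bound _ _ _ _ O h N).
  replace (sp r h) with (sp p h * sp (r - p) h) in U by (rewrite sp_add; f_equal; ring).
  assert (P := sp_pos p h). nra.
Qed.

Lemma EO_theta (p : R) (f f1 : R -> R) : EO p f ->
  (forall h, oval_level h -> is_derive f h (f1 h / h)) -> EO p f1.
Proof.
  intros Hf D n. destruct (Hf (S n)) as [B [_ [f2 [D2 O]]]]. exists B.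
  apply (OO_ext n p B f2); [|exact O]. intros h Hh.
  assert (E : f2 h / h = f1 h / h).
  { rewrite <- (is_derive_unique f h _ (D h Hh)). symmetry. apply is_derive_unique, D2, Hh. }
  unfold oval_level in Hh. apply (Rmult_eq_reg_r (/ h)); [exact E|].
  apply Rinv_neq_0_compat; lra.
Qed.

(* The combinations that diagonalize the Picard-Fuchs system at [h = 0]. *)
Definition Z (h : R) : R := Kx 3 h.
Definition Y2 (h : R) : R := Ix 2 h - 26 / 25 * Ix 3 h.
Definition Y1 (h : R) : R := Ix 1 h - 3 / 5 * Y2 h - 143 / 125 * Ix 3 h.
Definition Y0 (h : R) : R :=
  Ix 0 h - 2 / 5 * Y1 h - 21 / 50 * Y2 h - 858 / 625 * Ix 3 h.

(** * The triangular system and its expansions *)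

Lemma Ix3_ode (h : R) : oval_level h -> is_derive (Ix 3) h ((0 * Ix 3 h + h * Z h) / h).
Proof.
  intros Hh. evar_last; [apply Ix_derive, Hh|]. unfold Z. field. unfold oval_level in Hh; lra.
Qed.

(** Substituting [K_3 = 26 I_3 - 3 I_2 - 2 I_1 - I_0 - 20 h K_3] makes [theta], modulo [h K_3],
    triangular on [I_0, ..., I_3] with eigenvalues 3/4, 1, 5/4, 0; for instance
    [theta I_2 = 5/4 I_2 - 13/10 I_3 + h K_3]. The constants in [Y2], [Y1], [Y0] are those of the
    eigenvectors. *)
Lemma Y2_ode (h : R) : oval_level h ->
  is_derive Y2 h ((5 / 4 * Y2 h + (- (1 / 25)) * (h * Z h)) / h).
Proof.
  intros Hh. destruct (picard_fuchs_system h Hh) as [P0 [P1 [P2 P3]]].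
  assert (h <> 0) by (unfold oval_level in Hh; lra).
  evar_last.
  - apply (is_derive_minus (Ix 2) (fun h => 26 / 25 * Ix 3 h)); [apply Ix_derive, Hh|].
    apply is_derive_scal, Ix_derive, Hh.
  - unfold minus, plus, opp; simpl. unfold Z, Y2. apply (Rmult_eq_reg_r (20 * h)); [|lra].
    field_simplify; [|lra]. lra.
Qed.

Lemma Y1_ode (h : R) : oval_level h ->
  is_derive Y1 h ((1 * Y1 h + (- (3 / 25)) * (h * Z h)) / h).
Proof.
  intros Hh. destruct (picard_fuchs_system h Hh) as [P0 [P1 [P2 P3]]].
  assert (h <> 0) by (unfold oval_level in Hh; lra).
  evar_last.
  - apply (is_derive_minus (fun h => Ix 1 h - 3 / 5 * Y2 h) (fun h => 143 / 125 * Ix 3 h)).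
    + apply (is_derive_minus (Ix 1) (fun h => 3 / 5 * Y2 h)); [apply Ix_derive, Hh|].
      apply is_derive_scal, Y2_ode, Hh.
    + apply is_derive_scal, Ix_derive, Hh.
  - unfold minus, plus, opp; simpl. unfold Y1, Y2, Z. apply (Rmult_eq_reg_r (20 * h)); [|lra].
    field_simplify; [|lra|lra]. lra.
Qed.

Lemma Y0_ode (h : R) : oval_level h ->
  is_derive Y0 h ((3 / 4 * Y0 h + (- (77 / 250)) * (h * Z h)) / h).
Proof.
  intros Hh. destruct (picard_fuchs_system h Hh) as [P0 [P1 [P2 P3]]].
  assert (h <> 0) by (unfold oval_level in Hh; lra).
  evar_last.
  - apply (is_derive_minus (fun h => Ix 0 h - 2 / 5 * Y1 h - 21 / 50 * Y2 h)
      (fun h => 858 / 625 * Ix 3 h)).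
    + apply (is_derive_minus (fun h => Ix 0 h - 2 / 5 * Y1 h) (fun h => 21 / 50 * Y2 h)).
      * apply (is_derive_minus (Ix 0) (fun h => 2 / 5 * Y1 h)); [apply Ix_derive, Hh|].
        apply is_derive_scal, Y1_ode, Hh.
      * apply is_derive_scal, Y2_ode, Hh.
    + apply is_derive_scal, Ix_derive, Hh.
  - unfold minus, plus, opp; simpl. unfold Y0, Y1, Y2, Z. apply (Rmult_eq_reg_r (20 * h)); [|lra].
    field_simplify; [|lra|lra]. lra.
Qed.

Lemma Z_system (h : R) : oval_level h ->
  (1 + 20 * h) * Z h =
  12012 / 625 * Ix 3 h - Y0 h - 12 / 5 * Y1 h - 231 / 50 * Y2 h.
Proof.
  intros Hh. destruct (picard_fuchs_system h Hh) as [P0 [P1 [P2 P3]]].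
  unfold Y0, Y1, Y2, Z. lra.
Qed.

Lemma OO_Z (n : nat) :
  (exists B, OO n 0 B (Ix 0)) -> (exists B, OO n 0 B (Ix 1)) ->
  (exists B, OO n 0 B (Ix 2)) -> (exists B, OO n 0 B (Ix 3)) -> exists B, OO n 0 B Z.
Proof.
  intros [B0 O0] [B1 O1] [B2 O2] [B3 O3]. destruct (EO_inv n) as [Bw Ow].
  assert (S := OO_plus _ _ _ _ _ _ (OO_scal n 0 B3 26 _ O3)
    (OO_plus _ _ _ _ _ _ (OO_scal n 0 B2 (-3) _ O2)
      (OO_plus _ _ _ _ _ _ (OO_scal n 0 B1 (-2) _ O1) (OO_scal n 0 B0 (-1) _ O0)))).
  assert (M := OO_mult _ _ _ _ _ _ _ Ow S). rewrite Rplus_0_l in M.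
  eexists. eapply OO_ext; [|exact M].
  intros h Hh. destruct (picard_fuchs_system h Hh) as [_ [_ [_ P3]]].
  unfold oval_level in Hh. unfold Z. simpl.
  replace (26 * Ix 3 h + (-3 * Ix 2 h + (-2 * Ix 1 h + -1 * Ix 0 h)))
    with ((20 * h + 1) * Kx 3 h) by lra.
  field. lra.
Qed.

Lemma OO_hZ (n : nat) : (exists B, OO n 0 B Z) -> exists B, OO n 0 B (fun h => h * Z h).
Proof.
  intros [B O]. destruct (EO_weaken 1 0 _ ltac:(lra) EO_id n) as [B' O'].
  eexists. rewrite <- (Rplus_0_l 0). eapply OO_mult; eauto.
Qed.

(** The only analytic input is the boundedness of the [I_k]. The Picard-Fuchs system gives [Z] from
    them, dividing by [1 + 20 h], and then each [theta I_k] from the [I_k] and [Z], which raises [n]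
    by one. *)
Lemma OO_periods (n : nat) :
  (exists B, OO n 0 B (Ix 0)) /\ (exists B, OO n 0 B (Ix 1)) /\
  (exists B, OO n 0 B (Ix 2)) /\ (exists B, OO n 0 B (Ix 3)).
Proof.
  assert (Bd : forall k, exists C, forall h, near_loop h -> Rabs (Ix k h) <= C * sp 0 h).
  { intros k. destruct (Ix_bounded k) as [C HC]. exists C. intros h N.
    rewrite sp_0, Rmult_1_r. apply HC, near_loop_oval, N. }
  assert (D : forall k h, oval_level h -> is_derive (Ix k) h ((h * Kx k h) / h)).
  { intros k h Hh. evar_last; [apply Ix_derive, Hh|]. field. unfold oval_level in Hh; lra. }
  induction n as [|n [H0 [H1 [H2 H3]]]].
  - repeat split; match goal with |- exists B, OO 0 0 B (Ix ?k) =>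
      destruct (Bd k) as [C HC]; exists C; split; auto end.
  - assert (HZ := OO_Z n H0 H1 H2 H3). assert (HhZ := OO_hZ n HZ).
    destruct H0 as [B0 O0]. destruct H1 as [B1 O1]. destruct H2 as [B2 O2].
    destruct H3 as [B3 O3]. destruct HZ as [BZ OZ].
    repeat split; match goal with |- exists B, OO _ 0 B (Ix ?k) =>
      apply (EO_step 0 (Ix k) (fun h => h * Kx k h) n (Bd k) (D k)) end.
    + eexists. eapply OO_ext.
      2: exact (OO_plus _ _ _ _ _ _ (OO_scal n 0 B0 (7 / 10) _ O0) (OO_scal n 0 BZ (- (1 / 20)) _ OZ)).
      intros h Hh. destruct (picard_fuchs_system h Hh) as [P0 [P1 [P2 P3]]]. unfold Z. simpl. lra.
    + eexists. eapply OO_ext.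
      2: exact (OO_plus _ _ _ _ _ _ (OO_scal n 0 B1 (9 / 10) _ O1)
           (OO_plus _ _ _ _ _ _ (OO_scal n 0 B0 (- (1 / 20)) _ O0) (OO_scal n 0 BZ (- (1 / 20)) _ OZ))).
      intros h Hh. destruct (picard_fuchs_system h Hh) as [P0 [P1 [P2 P3]]]. unfold Z. simpl. lra.
    + eexists. eapply OO_ext.
      2: exact (OO_plus _ _ _ _ _ _ (OO_scal n 0 B2 (11 / 10) _ O2)
           (OO_plus _ _ _ _ _ _ (OO_scal n 0 B1 (- (1 / 10)) _ O1)
             (OO_plus _ _ _ _ _ _ (OO_scal n 0 B0 (- (1 / 20)) _ O0) (OO_scal n 0 BZ (- (1 / 20)) _ OZ)))).
      intros h Hh. destruct (picard_fuchs_system h Hh) as [P0 [P1 [P2 P3]]]. unfold Z. simpl. lra.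
    + exact HhZ.
Qed.

Lemma EO_Z : EO 0 Z.
Proof. intros n. destruct (OO_periods n) as [H0 [H1 [H2 H3]]]. apply OO_Z; auto. Qed.

(** The order 1 is lowered on purpose: 1 is also the exponent of the equation for [Y1], and this
    resonance produces a logarithm. *)
Lemma EO_hZ : EO (7 / 8) (fun h => h * Z h).
Proof.
  apply (EO_weaken (1 + 0)); [lra|]. apply (EO_mult 1 0 (fun h => h) Z EO_id EO_Z).
Qed.

Lemma limit_lower (c i : R) (F : R -> R) (r : R) : 0 < r ->
  EO r (fun h => F h - c) -> (forall h, near_loop h -> i <= F h) -> i <= c.
Proof.
  intros Hr E L. apply Rnot_lt_le. intros Hlt.
  apply (EO_no_gap 0 r (i - c) (fun h => F h - c)); [exact Hr|lra|exact E|].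
  intros h N. rewrite sp_0, Rmult_1_r. specialize (L h N).
  apply Rle_trans with (2 := Rle_abs _). lra.
Qed.

Lemma Ix_lower (n : nat) : exists i, 0 < i /\ forall h, near_loop h -> i <= Ix n h.
Proof.
  exists (Ix n (- (1 / 40))). split.
  - apply Rle_lt_trans with (Ix n (- (1 / 30))); [apply Ix_nonneg; unfold oval_level; lra|].
    apply (deriv_pos_increasing (Ix n) (Kx n)); [lra| |]; intros x Hx;
      [apply Ix_derive|apply Kx_pos]; unfold oval_level; lra.
  - intros h N. unfold near_loop in N.
    apply (deriv_nonneg_le (Ix n) (Kx n)); [lra| |]; intros x Hx;
      [apply Ix_derive|apply Rlt_le, Kx_pos]; unfold oval_level; lra.
Qed.

(** The crude pass: with [h Z] treated as an error of order 7/8, only the exponents 0 of [I_3] and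
    3/4 of [Y0] survive, those of [Y1] and [Y2] being absorbed. *)
Lemma Z_expansion : exists A C,
  0 < A /\ EO (7 / 8) (fun h => Z h - (A + C * sp (3 / 4) h)).
Proof.
  assert (Sc : forall k, EO (7 / 8) (fun h => k * (h * Z h))) by (intros; apply EO_scal, EO_hZ).
  destruct (EO_fuchs_high 0 (7 / 8) (Ix 3) (fun h => h * Z h)) as [A EA];
    [lra|exact Ix3_ode|exact EO_hZ|].
  destruct (EO_fuchs_high (3 / 4) (7 / 8) Y0 (fun h => - (77 / 250) * (h * Z h))) as [C EC];
    [lra|exact Y0_ode|apply Sc|].
  assert (E1 : EO (7 / 8) Y1) by exact (EO_fuchs_low 1 (7 / 8) Y1 _ ltac:(lra) Y1_ode (Sc _)).
  assert (E2 : EO (7 / 8) Y2) by exact (EO_fuchs_low (5 / 4) (7 / 8) Y2 _ ltac:(lra) Y2_ode (Sc _)).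
  exists (12012 / 625 * A), (- C). split.
  - destruct (Ix_lower 3) as [i [Hi Li]].
    assert (i <= A); [|lra].
    apply (limit_lower A i (Ix 3) (7 / 8)); [lra| |exact Li].
    eapply EO_ext; [|exact EA]. intros h _. simpl. rewrite sp_0. ring.
  - eapply EO_ext.
    2: exact (EO_plus _ _ _ (EO_scal _ (12012 / 625) _ EA)
         (EO_plus _ _ _ (EO_scal _ (-1) _ EC)
           (EO_plus _ _ _ (EO_scal _ (- (12 / 5)) _ E1)
             (EO_plus _ _ _ (EO_scal _ (- (231 / 50)) _ E2) (Sc (-20)))))).
    intros h Hh. simpl. assert (S := Z_system h Hh). rewrite sp_0. lra.
Qed.

Definition ex6 (c0 c1 c2 c3 c4 c5 : R) (h : R) : R :=
  c0 + c1 * sp (3 / 4) h + c2 * slog h + c3 * sp 1 h + c4 * sp (5 / 4) h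
  + c5 * sp (7 / 4) h.

Lemma sp_74 (h : R) : h < 0 -> h * sp (3 / 4) h = - sp (7 / 4) h.
Proof.
  intros Hh. replace (7 / 4) with (1 + 3 / 4) by field.
  rewrite <- sp_add, sp_1 by exact Hh. ring.
Qed.

Lemma EO_hrho (A C k : R) : EO (7 / 8) (fun h => Z h - (A + C * sp (3 / 4) h)) ->
  EO (15 / 8) (fun h => k * (h * (Z h - (A + C * sp (3 / 4) h)))).
Proof.
  intros E. apply EO_scal. replace (15 / 8) with (1 + 7 / 8) by field.
  apply (EO_mult 1 (7 / 8) (fun h => h) _ EO_id E).
Qed.

(** Away from the resonances 1 and 7/4, [a s + b s^(7/4)] solves the equation with source
    [k h (A + C s^(3/4))], and what remains is of order 15/8. The relation for [a] is kept because
    it later cancels the term in [s] when the coefficient of [s^(5/4)] is examined. *)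
Lemma refine_expansion (A C p k : R) (Y : R -> R) :
  EO (7 / 8) (fun h => Z h - (A + C * sp (3 / 4) h)) ->
  p < 15 / 8 -> p <> 1 -> p <> 7 / 4 ->
  (forall h, oval_level h -> is_derive Y h ((p * Y h + k * (h * Z h)) / h)) ->
  exists c a b, (1 - p) * a = - k * A /\ EO (15 / 8) (fun h => Y h -
    (c * sp p h + a * sp 1 h + b * sp (7 / 4) h)).
Proof.
  intros EZ Hp p1 p2 D.
  set (a := - k * A / (1 - p)). set (b := - k * C / (7 / 4 - p)).
  destruct (EO_fuchs_high p (15 / 8) (fun h => Y h - (a * sp 1 h + b * sp (7 / 4) h))
    (fun h => k * (h * (Z h - (A + C * sp (3 / 4) h))))) as [c Ec].
  - exact Hp.
  - intros h Hh. assert (h < 0) by (unfold oval_level in Hh; lra).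
    evar_last.
    + apply (is_derive_minus Y (fun h => a * sp 1 h + b * sp (7 / 4) h)); [apply D, Hh|].
      apply (is_derive_plus (fun h => a * sp 1 h) (fun h => b * sp (7 / 4) h));
        apply is_derive_scal, sp_derive; lra.
    + unfold minus, plus, opp; simpl.
      replace (k * (h * (Z h - (A + C * sp (3 / 4) h))))
        with (k * (h * Z h) - k * A * h - k * C * (h * sp (3 / 4) h)) by ring.
      rewrite sp_74 by lra. rewrite sp_1 by lra.
      unfold a, b. field. repeat split; lra.
  - apply EO_hrho, EZ.
  - exists c, a, b. split; [unfold a; field; lra|].
    eapply EO_ext; [|exact Ec]. intros h _. simpl. ring.
Qed.

(** The resonant case: [(theta - 1) (s ln s) = s], so the source [k h A] produces [- k A s ln s],
    with an explicit coefficient. *)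
Lemma refine_expansion_log (A C k : R) (Y : R -> R) :
  EO (7 / 8) (fun h => Z h - (A + C * sp (3 / 4) h)) ->
  (forall h, oval_level h -> is_derive Y h ((1 * Y h + k * (h * Z h)) / h)) ->
  exists c b, EO (15 / 8) (fun h => Y h -
    (c * sp 1 h + (- k * A) * slog h + b * sp (7 / 4) h)).
Proof.
  intros EZ D.
  set (a := - k * A). set (b := - k * C * (4 / 3)).
  destruct (EO_fuchs_high 1 (15 / 8) (fun h => Y h - (a * slog h + b * sp (7 / 4) h))
    (fun h => k * (h * (Z h - (A + C * sp (3 / 4) h))))) as [c Ec].
  - lra.
  - intros h Hh. assert (h < 0) by (unfold oval_level in Hh; lra).
    evar_last.
    + apply (is_derive_minus Y (fun h => a * slog h + b * sp (7 / 4) h)); [apply D, Hh|].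
      apply (is_derive_plus (fun h => a * slog h) (fun h => b * sp (7 / 4) h));
        apply is_derive_scal; [apply slog_derive; lra|apply sp_derive; lra].
    + unfold minus, plus, opp; simpl.
      replace (k * (h * (Z h - (A + C * sp (3 / 4) h))))
        with (k * (h * Z h) - k * A * h - k * C * (h * sp (3 / 4) h)) by ring.
      rewrite sp_74 by lra. rewrite sp_1 by lra.
      unfold a, b. field. lra.
  - apply EO_hrho, EZ.
  - exists c, b. eapply EO_ext; [|exact Ec]. intros h _. simpl. unfold a. ring.
Qed.

Lemma EO_high (p c : R) : 7 / 8 <= p -> EO (7 / 8) (fun h => c * sp p h).
Proof. intros Hp. apply EO_scal, (EO_weaken p); [exact Hp|apply EO_sp]. Qed.

Lemma EO_h_shift (a c : R) (f : R -> R) :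
  EO (7 / 8) (fun h => f h - (a + c * sp (3 / 4) h)) ->
  EO (15 / 8) (fun h => h * f h - ex6 0 0 0 (- a) 0 (- c) h).
Proof.
  intros E.
  apply (EO_ext _ (fun h => h * (f h - (a + c * sp (3 / 4) h)))).
  - intros h Hh. unfold ex6. assert (S := sp_74 h ltac:(unfold oval_level in Hh; lra)).
    rewrite sp_1 by (unfold oval_level in Hh; lra).
    replace (h * (f h - (a + c * sp (3 / 4) h)))
      with (h * f h - a * h - c * (h * sp (3 / 4) h)) by ring.
    rewrite S. ring.
  - replace (15 / 8) with (1 + 7 / 8) by field.
    apply (EO_mult 1 (7 / 8) (fun h => h) _ EO_id E).
Qed.

(** The position of the zeros matters: [A], [C0], [k], [C2] are pivots for [I_3], [Y0], [Y1], [Y2];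
    then [s^(7/4)] isolates [h I_0], because [I_1] has no term [s^(3/4)], and finally [s] isolates
    [h I_1]. *)
Lemma expansions : exists A C0 C1 C2 k a0 a2 a3 b0 b1 b2 b3 A0 A1 : R,
  A <> 0 /\ C0 <> 0 /\ C2 <> 0 /\ k <> 0 /\ A1 <> 0 /\
  EO (15 / 8) (fun h => Y0 h - ex6 0 C0 0 a0 0 b0 h) /\
  EO (15 / 8) (fun h => Y1 h - ex6 0 0 k C1 0 b1 h) /\
  EO (15 / 8) (fun h => Y2 h - ex6 0 0 0 a2 C2 b2 h) /\
  EO (15 / 8) (fun h => Ix 3 h - ex6 A 0 0 a3 0 b3 h) /\
  EO (15 / 8) (fun h => h * Ix 0 h - ex6 0 0 0 (- A0) 0 (- C0) h) /\
  EO (15 / 8) (fun h => h * Ix 1 h - ex6 0 0 0 (- A1) 0 0 h).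
Proof.
  destruct Z_expansion as [z0 [z1 [Hz EZ]]].
  destruct (refine_expansion z0 z1 0 1 (Ix 3) EZ) as [A [a3 [b3 [_ EA]]]]; try lra.
  { intros h Hh. rewrite Rmult_1_l. apply Ix3_ode, Hh. }
  destruct (refine_expansion z0 z1 (3 / 4) _ Y0 EZ ltac:(lra) ltac:(lra) ltac:(lra) Y0_ode)
    as [C0 [a0 [b0 [_ EC0]]]].
  destruct (refine_expansion z0 z1 (5 / 4) _ Y2 EZ ltac:(lra) ltac:(lra) ltac:(lra) Y2_ode)
    as [C2 [a2 [b2 [Ea2 EC2]]]].
  destruct (refine_expansion_log z0 z1 _ Y1 EZ Y1_ode) as [C1 [b1 EC1]].
  set (k := - - (3 / 25) * z0) in *.
  assert (W78 : forall f, EO (15 / 8) f -> EO (7 / 8) f) by (intros f; apply EO_weaken; lra).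
  assert (L3 : EO (7 / 8) (fun h => Ix 3 h - A)).
  { eapply EO_ext.
    2: exact (EO_plus _ _ _ (W78 _ EA) (EO_plus _ _ _ (EO_high 1 a3 ltac:(lra)) (EO_high (7 / 4) b3 ltac:(lra)))).
    intros h _. simpl. rewrite sp_0. ring. }
  assert (L1 : EO (7 / 8) Y1).
  { eapply EO_ext.
    2: exact (EO_plus _ _ _ (W78 _ EC1) (EO_plus _ _ _ (EO_high 1 C1 ltac:(lra))
         (EO_plus _ _ _ (EO_scal _ k _ EO_slog) (EO_high (7 / 4) b1 ltac:(lra))))).
    intros h _. simpl. ring. }
  assert (L2 : EO (7 / 8) Y2).
  { eapply EO_ext.
    2: exact (EO_plus _ _ _ (W78 _ EC2) (EO_plus _ _ _ (EO_high (5 / 4) C2 ltac:(lra))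
         (EO_plus _ _ _ (EO_high 1 a2 ltac:(lra)) (EO_high (7 / 4) b2 ltac:(lra))))).
    intros h _. simpl. ring. }
  assert (L0 : EO (7 / 8) (fun h => Y0 h - C0 * sp (3 / 4) h)).
  { eapply EO_ext.
    2: exact (EO_plus _ _ _ (W78 _ EC0) (EO_plus _ _ _ (EO_high 1 a0 ltac:(lra)) (EO_high (7 / 4) b0 ltac:(lra)))).
    intros h _. simpl. ring. }
  assert (I1 : EO (7 / 8) (fun h => Ix 1 h - (143 / 125 * A + 0 * sp (3 / 4) h))).
  { eapply EO_ext.
    2: exact (EO_plus _ _ _ L1 (EO_plus _ _ _ (EO_scal _ (3 / 5) _ L2) (EO_scal _ (143 / 125) _ L3))).
    intros h _. simpl. unfold Y1. ring. }
  assert (I0 : EO (7 / 8) (fun h => Ix 0 h - (858 / 625 * A + C0 * sp (3 / 4) h))).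
  { eapply EO_ext.
    2: exact (EO_plus _ _ _ L0 (EO_plus _ _ _ (EO_scal _ (2 / 5) _ L1)
         (EO_plus _ _ _ (EO_scal _ (21 / 50) _ L2) (EO_scal _ (858 / 625) _ L3)))).
    intros h _. simpl. unfold Y0. ring. }
  assert (HA : 0 < A).
  { destruct (Ix_lower 3) as [i [Hi Li]].
    assert (i <= A) by (apply (limit_lower A i (Ix 3) (7 / 8)); auto; lra). lra. }
  (* Otherwise [theta I_0 = h K_0] would be of order 7/8, against [K_0 >= c s^(-1/4)]. *)
  assert (HC0 : C0 <> 0).
  { intros E0. rewrite E0 in I0. destruct Kx0_lower as [c [Hc Lc]].
    apply (EO_no_gap (3 / 4) (7 / 8) c (fun h => h * Kx 0 h)); [lra|exact Hc| |].
    - apply (EO_theta _ _ _ I0). intros h Hh. evar_last.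
      + apply (is_derive_minus (Ix 0) (fun h => 858 / 625 * A + 0 * sp (3 / 4) h));
          [apply Ix_derive, Hh|].
        apply (is_derive_ext (fun _ => 858 / 625 * A)); [intros; simpl; ring|].
        apply is_derive_const.
      + unfold minus, plus, opp, zero; simpl. field. unfold oval_level in Hh; lra.
    - intros h N. specialize (Lc h N).
      assert (P := sp_pos (3 / 4) h). assert (Kp := Kx_pos 0 h (near_loop_oval h N)).
      unfold near_loop in N. rewrite Rabs_left by nra.
      replace (- (h * Kx 0 h)) with (sp (3 / 4) h * (sp (1 / 4) h * Kx 0 h)); [nra|].
      rewrite <- Rmult_assoc, sp_add. replace (3 / 4 + 1 / 4) with 1 by field.
      rewrite sp_1 by lra. ring. }
  (* By the relation for [a2] the combination [5/4 Y2 - 1/5 h Z] has no term in [s], so [C2 = 0]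
     would make it of order 7/4. By the equation of [Y2] it equals [- h (6/5 K_3 - K_2)], which
     [Kx2_gap] bounds below by [c s^(5/4)]. *)
  assert (HC2 : C2 <> 0).
  { intros E2. rewrite E2 in EC2. destruct Kx2_gap as [c [Hc Lc]].
    assert (EZs : EO (15 / 8) (fun h => - (1 / 5) * (h * (Z h - (z0 + z1 * sp (3 / 4) h)))))
      by (apply EO_hrho, EZ).
    apply (EO_no_gap (5 / 4) (7 / 4) c (fun h => 5 / 4 * Y2 h + - (1 / 5) * (h * Z h)));
      [lra|exact Hc| |].
    - eapply EO_ext.
      2: exact (EO_plus _ _ _ (EO_weaken (15 / 8) (7 / 4) _ ltac:(lra) (EO_scal _ (5 / 4) _ EC2))
           (EO_plus _ _ _ (EO_weaken (15 / 8) (7 / 4) _ ltac:(lra) EZs)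
             (EO_scal _ (5 / 4 * b2 + 1 / 5 * z1) _ (EO_sp (7 / 4))))).
      intros h Hh. simpl. assert (S := sp_74 h ltac:(unfold oval_level in Hh; lra)).
      rewrite sp_1 by (unfold oval_level in Hh; lra).
      replace (h * (Z h - (z0 + z1 * sp (3 / 4) h)))
        with (h * Z h - z0 * h - z1 * (h * sp (3 / 4) h)) by ring.
      rewrite S. replace z0 with (- (25 / 4) * a2) by lra. field.
    - intros h N. specialize (Lc h N). assert (G := near_loop_oval h N).
      assert (E : h * (Kx 2 h - 26 / 25 * Kx 3 h) = 5 / 4 * Y2 h + - (1 / 25) * (h * Z h)).
      { assert (D1 := Y2_ode h G). apply is_derive_unique in D1.
        assert (D2 : is_derive Y2 h (Kx 2 h - 26 / 25 * Kx 3 h)).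
        { apply (is_derive_minus (Ix 2) (fun h => 26 / 25 * Ix 3 h)); [apply Ix_derive, G|].
          apply is_derive_scal, Ix_derive, G. }
        apply is_derive_unique in D2. rewrite D1 in D2. rewrite <- D2. field.
        unfold near_loop in N; lra. }
      replace (5 / 4 * Y2 h + - (1 / 5) * (h * Z h))
        with ((- h) * (6 / 5 * Kx 3 h - Kx 2 h)) by (unfold Z in *; lra).
      apply Rle_trans with (2 := Rle_abs _). unfold near_loop in N.
      replace (5 / 4) with (1 + 1 / 4) by field. rewrite <- sp_add, sp_1 by lra.
      nra. }
  exists A, C0, C1, C2, k, a0, a2, a3, b0, b1, b2, b3,
    (858 / 625 * A), (143 / 125 * A).
  split; [lra|]. split; [exact HC0|]. split; [exact HC2|].
  split; [unfold k; lra|]. split; [lra|].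
  split; [|split; [|split; [|split; [|split]]]].
  - eapply EO_ext; [|exact EC0]. intros h _. unfold ex6. simpl. ring.
  - eapply EO_ext; [|exact EC1]. intros h _. unfold ex6. simpl. ring.
  - eapply EO_ext; [|exact EC2]. intros h _. unfold ex6. simpl. ring.
  - eapply EO_ext; [|exact EA]. intros h _. unfold ex6. simpl. rewrite sp_0. ring.
  - exact (EO_h_shift _ _ _ I0).
  - eapply EO_ext; [|exact (EO_h_shift _ _ _ I1)]. intros h _. unfold ex6. simpl. ring.
Qed.

(** * Counting zeros *)

Fixpoint smooth (n : nat) (f : R -> R) : Prop :=
  match n with
  | 0%nat => True
  | S n' => exists f', (forall h, oval_level h -> is_derive f h (f' h)) /\ smooth n' f'
  end.

(** The successive derivatives are carried as functions on all oval levels; in this form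
    multiplicity passes easily through sums, products and [theta - p], which [Derive_n] would
    obscure. *)
Fixpoint vanishes (m : nat) (f : R -> R) (z : R) : Prop :=
  match m with
  | 0%nat => True
  | S m' => f z = 0 /\
      exists f', (forall h, oval_level h -> is_derive f h (f' h)) /\ vanishes m' f' z
  end.

Lemma smooth_S (n : nat) (f : R -> R) : smooth (S n) f -> smooth n f.
Proof.
  revert f. induction n as [|n IH]; intros f [f' [D S]]; [exact I|].
  exists f'. split; auto.
Qed.

Lemma smooth_ext (n : nat) (f g : R -> R) :
  (forall h, oval_level h -> f h = g h) -> smooth n f -> smooth n g.
Proof.
  intros E. destruct n; [auto|]. intros [f' [D S]]. exists f'. split; [|exact S].
  intros h Hh. apply (is_derive_ext_loc f); [|auto].
  apply (filter_imp oval_level); [exact E|apply oval_level_locally, Hh].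
Qed.

Lemma smooth_plus (n : nat) (f g : R -> R) :
  smooth n f -> smooth n g -> smooth n (fun h => f h + g h).
Proof.
  revert f g. induction n as [|n IH]; intros f g; [auto|].
  intros [f' [Df Sf]] [g' [Dg Sg]]. exists (fun h => f' h + g' h). split; [|auto].
  intros h Hh. apply (is_derive_plus f g); auto.
Qed.

Lemma smooth_mult (n : nat) (f g : R -> R) :
  smooth n f -> smooth n g -> smooth n (fun h => f h * g h).
Proof.
  revert f g. induction n as [|n IH]; intros f g Hf Hg; [exact I|].
  assert (Hf' := smooth_S _ _ Hf). assert (Hg' := smooth_S _ _ Hg).
  destruct Hf as [f' [Df Sf]]. destruct Hg as [g' [Dg Sg]].
  exists (fun h => f' h * g h + f h * g' h). split.
  - intros h Hh. apply (is_derive_mult f g); auto. intros; apply Rmult_comm.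
  - apply smooth_plus; apply IH; auto.
Qed.

Lemma smooth_const (n : nat) (c : R) : smooth n (fun _ => c).
Proof.
  revert c. induction n as [|n IH]; intros c; [exact I|].
  exists (fun _ => 0). split; [|apply IH]. intros; apply is_derive_Reals, derivable_pt_lim_const.
Qed.

Lemma smooth_id (n : nat) : smooth n (fun h => h).
Proof.
  destruct n; [exact I|]. exists (fun _ => 1). split; [|apply smooth_const].
  intros; apply is_derive_Reals, derivable_pt_lim_id.
Qed.

Lemma smooth_inv (n : nat) : smooth n (fun h => / h).
Proof.
  induction n as [|n IH]; [exact I|].
  exists (fun h => (-1) * (/ h * / h)). split.
  - intros h Hh. unfold oval_level in Hh. auto_derive; [lra|]. field. lra.
  - apply smooth_mult; [apply smooth_const|apply smooth_mult; exact IH].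
Qed.

Lemma OO_smooth (n : nat) (p B : R) (f : R -> R) : OO n p B f -> smooth n f.
Proof.
  revert f. induction n as [|n IH]; intros f [_ O]; [exact I|].
  destruct O as [f1 [D O]]. exists (fun h => f1 h * / h). split; [exact D|].
  apply smooth_mult; [apply IH, O|apply smooth_inv].
Qed.

Lemma vanishes_S (m : nat) (f : R -> R) (z : R) : vanishes (S m) f z -> vanishes m f z.
Proof.
  revert f. induction m as [|m IH]; intros f [E [f' [D M]]]; [exact I|].
  split; [exact E|]. exists f'. split; auto.
Qed.

Lemma vanishes_plus (m : nat) (f g : R -> R) (z : R) :
  vanishes m f z -> vanishes m g z -> vanishes m (fun h => f h + g h) z.
Proof.
  revert f g. induction m as [|m IH]; intros f g; [auto|].
  intros [Ef [f' [Df Mf]]] [Eg [g' [Dg Mg]]]. split; [rewrite Ef, Eg; ring|].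
  exists (fun h => f' h + g' h). split; [|auto].
  intros h Hh. apply (is_derive_plus f g); auto.
Qed.

Lemma vanishes_mult (m : nat) (w f : R -> R) (z : R) :
  smooth m w -> vanishes m f z -> vanishes m (fun h => w h * f h) z.
Proof.
  revert w f. induction m as [|m IH]; intros w f Hw Hf; [exact I|].
  assert (Hw' := smooth_S _ _ Hw). assert (Hf' := vanishes_S _ _ _ Hf).
  destruct Hw as [w' [Dw Sw]]. destruct Hf as [Ef [f' [Df Mf]]].
  split; [rewrite Ef; ring|].
  exists (fun h => w' h * f h + w h * f' h). split.
  - intros h Hh. apply (is_derive_mult w f); auto. intros; apply Rmult_comm.
  - apply vanishes_plus; apply IH; auto.
Qed.

Lemma vanishes_ext (m : nat) (f g : R -> R) (z : R) : oval_level z ->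
  (forall h, oval_level h -> f h = g h) -> vanishes m f z -> vanishes m g z.
Proof.
  intros Hz E. destruct m; [auto|]. intros [Ef [f' [D M]]].
  split; [rewrite <- E; auto|]. exists f'. split; [|exact M].
  intros h Hh. apply (is_derive_ext_loc f); [|auto].
  apply (filter_imp oval_level); [exact E|apply oval_level_locally, Hh].
Qed.

Lemma vanishes_of_order (m : nat) (f : R -> R) (z : R) : oval_level z ->
  smooth m f -> zero_of_order f m z -> vanishes m f z.
Proof.
  intros Hz. revert f. induction m as [|m IH]; intros f Sf Ho; [exact I|].
  destruct Sf as [f' [D Sf]]. split; [apply (Ho 0%nat); lia|].
  exists f'. split; [exact D|]. apply IH; [exact Sf|].
  intros k Hk. rewrite <- (Ho (S k)) by lia.
  rewrite <- (Nat.add_1_r k), <- Derive_n_comp.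
  apply Derive_n_ext_loc. apply (filter_imp oval_level); [|apply oval_level_locally, Hz].
  intros h Hh. symmetry. apply is_derive_unique, D, Hh.
Qed.

(** * Rolle's theorem for [theta - p], with multiplicities *)

Section Rolle.

Variables (p : R) (f f1 : R -> R).
Hypothesis Hf : forall h, oval_level h -> is_derive f h ((p * f h + f1 h) / h).
Hypothesis Hf1 : exists f1', forall h, oval_level h -> is_derive f1 h (f1' h).

Lemma vanishes_theta (m : nat) (z : R) : oval_level z -> vanishes (S m) f z -> vanishes m f1 z.
Proof.
  intros Hz M. assert (M' := vanishes_S _ _ _ M). destruct M as [E [f' [D M]]].
  apply (vanishes_ext m (fun h => h * f' h + (- p) * f h) f1 z Hz).
  - intros h Hh.
    assert (U : f' h = (p * f h + f1 h) / h).
    { rewrite <- (is_derive_unique f h _ (D h Hh)). apply is_derive_unique, Hf, Hh. }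
    rewrite U. field. unfold oval_level in Hh; lra.
  - apply vanishes_plus; apply vanishes_mult; auto.
    + apply smooth_id.
    + apply smooth_const.
Qed.

(** Rolle's theorem for [s^(-p) f], whose derivative is [s^(-p) f1 / h]. *)
Lemma rolle_point (z1 z2 : R) : oval_level z1 -> z1 < z2 < 0 -> f z1 = 0 -> f z2 = 0 ->
  exists x, z1 < x < z2 /\ vanishes 1 f1 x.
Proof.
  intros G1 H12 E1 E2. unfold oval_level in G1.
  destruct (MVT_cor2 (fun h => sp (- p) h * f h) (fun h => sp (- p) h * f1 h / h) z1 z2)
    as [x [Ex Hx]]; [lra| |].
  - intros c Hc. apply is_derive_Reals. apply ratio_derive; [exact Hf|unfold oval_level; lra].
  - exists x. split; [exact Hx|]. destruct Hf1 as [f1' D1].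
    split; [|exists f1'; split; [exact D1|exact I]].
    rewrite E1, E2, !Rmult_0_r, Rminus_0_r in Ex.
    assert (P := sp_pos (- p) x).
    apply Rmult_eq_reg_l with (sp (- p) x * (/ x * (z2 - z1))).
    + unfold Rdiv in Ex. lra.
    + apply Rmult_integral_contrapositive_currified; [lra|].
      apply Rmult_integral_contrapositive_currified; [apply Rinv_neq_0_compat; lra|lra].
Qed.

End Rolle.

(* [Zeros f lo n]: at least [n] zeros of [f] in [(lo, 0)], counted with multiplicity. *)
Inductive Zeros (f : R -> R) : R -> nat -> Prop :=
| Zeros_nil : forall lo, Zeros f lo 0
| Zeros_cons : forall lo z m n, lo < z < 0 -> vanishes (S m) f z -> Zeros f z n ->
    Zeros f lo (S m + n).

Lemma Zeros_lower (f : R -> R) (lo lo' : R) (n : nat) :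
  lo' <= lo -> Zeros f lo n -> Zeros f lo' n.
Proof.
  intros H Z. destruct Z; [apply Zeros_nil|].
  apply (Zeros_cons f lo' z); auto. lra.
Qed.

Section RolleZeros.

Variables (p : R) (f f1 : R -> R).
Hypothesis Hf : forall h, oval_level h -> is_derive f h ((p * f h + f1 h) / h).
Hypothesis Hf1 : exists f1', forall h, oval_level h -> is_derive f1 h (f1' h).

Lemma Zeros_drop (lo z : R) (m n : nat) : oval_level z -> lo <= z -> vanishes (S m) f z ->
  (lo < z \/ m = 0%nat) -> Zeros f1 z n -> Zeros f1 lo (m + n).
Proof.
  intros G Hz M Hm Zn. destruct m as [|m].
  - apply (Zeros_lower f1 z); auto.
  - destruct Hm as [Hm|Hm]; [|discriminate].
    apply (Zeros_cons f1 lo z m n); [unfold oval_level in G; lra| |exact Zn].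
    apply (vanishes_theta p f f1 Hf); auto.
Qed.

(** Here [lo] is itself a zero that is not counted. The Rolle point before each counted zero makes
    up for the order lost at that zero, so the total is kept; only the first zero of all costs
    one. *)
Lemma Zeros_rolle_after (lo : R) (n : nat) :
  Zeros f lo n -> oval_level lo -> f lo = 0 -> Zeros f1 lo n.
Proof.
  intros Z. induction Z as [lo|lo z m n Hz M Zn IH]; intros G E; [apply Zeros_nil|].
  assert (Gz : oval_level z) by (unfold oval_level in *; lra).
  destruct (rolle_point p f f1 Hf Hf1 lo z G Hz E (proj1 M)) as [x [Hx Mx]].
  apply (Zeros_cons f1 lo x 0 (m + n)); [lra|exact Mx|].
  apply (Zeros_drop x z); auto; try lra. apply IH; [exact Gz|apply M].
Qed.

Lemma Zeros_rolle (lo : R) (n : nat) : - (1 / 20) <= lo ->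
  Zeros f lo (S n) -> Zeros f1 lo n.
Proof.
  intros Hlo Z. inversion Z as [|lo' z m k Hz M Zk E1 E2]; subst.
  assert (Gz : oval_level z) by (unfold oval_level in *; lra).
  apply (Zeros_drop lo z); auto; try lra.
  apply Zeros_rolle_after; auto. apply M.
Qed.

(** Two distinct zeros give a Rolle point to the right of the first, a multiple zero gives [x = z].
    The order [z <= x] matters: a bound by a power of [s] obtained at [x] holds a fortiori at
    [z]. *)
Lemma Zeros_pair (lo : R) (n : nat) : - (1 / 20) <= lo ->
  Zeros f lo (S (S n)) ->
  exists z x, lo < z /\ z <= x /\ x < 0 /\ f z = 0 /\ f1 x = 0.
Proof.
  intros Hlo Z. inversion Z as [|lo' z m k Hz M Zk E1 E2]; subst.
  assert (Gz : oval_level z) by (unfold oval_level in *; lra).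
  destruct m as [|m].
  - assert (k = S n) as -> by lia.
    inversion Zk as [|lo' z' m' k' Hz' M' Zk' E1 E2']; subst.
    destruct (rolle_point p f f1 Hf Hf1 z z' Gz Hz' (proj1 M) (proj1 M')) as [x [Hx Mx]].
    exists z, x. repeat split; try lra; [apply M|apply Mx].
  - exists z, z. repeat split; try lra; [apply M|].
    apply (vanishes_theta p f f1 Hf (S m) z Gz) in M. apply M.
Qed.

End RolleZeros.

Lemma Zeros_exists (f : R -> R) (lo : R) (n : nat) :
  Zeros f lo (S n) -> exists z, lo < z < 0 /\ f z = 0.
Proof.
  intros Z. inversion Z as [|lo' z m k Hz M Zk E1 E2]; subst.
  exists z. split; [exact Hz|apply M].
Qed.

(** * Six zeros make the coefficients small *)

(** [theta - p] is diagonal on the powers; [s ln s] also produces [s], hence the extra [c2] in the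
    fourth place. *)
Lemma ex6_derive (c0 c1 c2 c3 c4 c5 p h : R) : h < 0 ->
  is_derive (ex6 c0 c1 c2 c3 c4 c5) h
    ((p * ex6 c0 c1 c2 c3 c4 c5 h
      + ex6 (- p * c0) ((3 / 4 - p) * c1) ((1 - p) * c2) ((1 - p) * c3 + c2)
            ((5 / 4 - p) * c4) ((7 / 4 - p) * c5) h) / h).
Proof.
  intros Hh. unfold ex6. evar_last.
  - repeat match goal with
    | |- is_derive (fun _ => _ + ?c * sp ?q _) _ _ =>
      apply (is_derive_plus _ (fun h => c * sp q h)); [|apply is_derive_scal, sp_derive, Hh]
    | |- is_derive (fun _ => _ + ?c * slog _) _ _ =>
      apply (is_derive_plus _ (fun h => c * slog h)); [|apply is_derive_scal, slog_derive, Hh]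
    end.
    apply is_derive_const.
  - unfold plus, zero; simpl. field. lra.
Qed.

(** The new coefficients enter through equations so that they can be supplied already simplified.
    The factor 3 is [1 + |p|] for [|p| <= 2]. *)
Lemma theta_step (n : nat) (q B p c0 c1 c2 c3 c4 c5 d0 d1 d2 d3 d4 d5 : R) (E : R -> R) :
  - 2 <= p <= 2 ->
  d0 = - p * c0 -> d1 = (3 / 4 - p) * c1 -> d2 = (1 - p) * c2 ->
  d3 = (1 - p) * c3 + c2 -> d4 = (5 / 4 - p) * c4 -> d5 = (7 / 4 - p) * c5 ->
  OO (S n) q B E ->
  exists E1, OO n q (3 * B) E1 /\
    forall h, oval_level h -> is_derive (fun h => ex6 c0 c1 c2 c3 c4 c5 h + E h) h
      ((p * (ex6 c0 c1 c2 c3 c4 c5 h + E h) + (ex6 d0 d1 d2 d3 d4 d5 h + E1 h)) / h).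
Proof.
  intros Hp -> -> -> -> -> -> O.
  assert (B0 := OO_const_nonneg _ _ _ _ O). assert (O' := OO_S _ _ _ _ O).
  destruct O as [_ [E' [D O]]].
  exists (fun h => E' h + - p * E h). split.
  - apply (OO_weaken n q q (B + Rabs (- p) * B)); [lra| |].
    + assert (Rabs (- p) <= 2) by (apply Rabs_le; lra). nra.
    + apply OO_plus; [exact O|apply OO_scal, O'].
  - intros h Hh. assert (h < 0) by (unfold oval_level in Hh; lra).
    evar_last.
    + apply (is_derive_plus (ex6 c0 c1 c2 c3 c4 c5) E); [apply (ex6_derive _ _ _ _ _ _ p); lra|auto].
    + unfold plus; simpl. field. lra.
Qed.

Lemma sp_mono (p h h' : R) : 0 <= p -> h <= h' < 0 -> sp p h' <= sp p h.
Proof. intros Hp Hh. apply Rle_Rpower_l; lra. Qed.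

Lemma divide_bound (k c p d A h : R) : 0 < k ->
  Rabs (k * c * sp p h) <= A * (sp p h * sp d h) -> Rabs c <= A / k * sp d h.
Proof.
  intros Hk. assert (P := sp_pos p h).
  rewrite !Rabs_mult, (Rabs_right k), (Rabs_right (sp p h)) by lra.
  intros Hb. apply (Rmult_le_reg_l (k * sp p h)); [nra|].
  replace (k * sp p h * (A / k * sp d h)) with (A * (sp p h * sp d h)) by (field; lra). lra.
Qed.

Lemma term_bound (a c M p d q h : R) : near_loop h -> 0 <= a -> Rabs c <= M -> p + d <= q ->
  Rabs (a * c * sp q h) <= a * M * (sp p h * sp d h).
Proof.
  intros N Ha Hc Hq. rewrite sp_add, !Rabs_mult, (Rabs_right a) by lra.
  assert (P := sp_pos q h). rewrite (Rabs_right (sp q h)) by lra.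
  assert (Q := sp_le (p + d) q h ltac:(unfold near_loop in N; lra) Hq).
  assert (0 <= Rabs c) by apply Rabs_pos.
  apply Rmult_le_compat; auto; nra.
Qed.

Lemma OO_term (n : nat) (B M p d : R) (E : R -> R) (h : R) : near_loop h ->
  OO n (15 / 8) B E -> B <= M -> p + d <= 15 / 8 ->
  Rabs (E h) <= M * (sp p h * sp d h).
Proof.
  intros N O HB Hq. rewrite sp_add.
  assert (U := OO_bound _ _ _ _ O h N).
  assert (Q := sp_le (p + d) (15 / 8) h ltac:(unfold near_loop in N; lra) Hq).
  assert (B0 := OO_const_nonneg _ _ _ _ O). assert (P := sp_pos (15 / 8) h). nra.
Qed.

Lemma slog_abs (h : R) : near_loop h -> Rabs (slog h) <= 8 * sp (7 / 8) h.
Proof.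
  intros Hh. assert (L := ln_bound h Hh). unfold slog. rewrite Rabs_mult.
  rewrite (Rabs_right (sp 1 h)) by (apply Rle_ge, Rlt_le, sp_pos).
  replace (sp (7 / 8) h) with (sp 1 h * sp (- (1 / 8)) h) by (rewrite sp_add; f_equal; field).
  assert (P := sp_pos 1 h). nra.
Qed.

(* Six zeros of [ex6 c + E] leave, after killing the leading terms one by one with
   [theta - p], a zero at which each coefficient in turn is dominant. The coefficient of
   [s] is compared with that of [s ln s] at two zeros [x <= z] (in [s]) given by Rolle. *)
Lemma coefficients_small : exists K, 0 < K /\
  forall (e M c0 c1 c2 c3 c4 c5 : R) (E : R -> R), 0 < e <= 1 / 40 ->
    OO 6 (15 / 8) M E ->
    Rabs c0 <= M -> Rabs c1 <= M -> Rabs c2 <= M ->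
    Rabs c3 <= M -> Rabs c4 <= M -> Rabs c5 <= M ->
    Zeros (fun h => ex6 c0 c1 c2 c3 c4 c5 h + E h) (- e) 6 ->
    let t := K * M * sp (1 / 8) (- e) in
    Rabs c0 <= t /\ Rabs c1 <= t /\ Rabs c2 <= t /\
    Rabs c3 <= t /\ Rabs c4 <= t /\ Rabs c5 <= t.
Proof.
  (* Any number above the numerical factors below works; the largest of them is 6000. *)
  exists 10000. split; [lra|]. intros e M c0 c1 c2 c3 c4 c5 E He O0 b0 b1 b2 b3 b4 b5 Z0 t.
  assert (M0 : 0 <= M) by (apply Rle_trans with (2 := b0), Rabs_pos).
  assert (Nr : forall h, - e < h < 0 -> near_loop h) by (unfold near_loop; intros; lra).
  assert (Le : - (1 / 20) <= - e) by lra.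
  assert (Up : forall A h x, 0 <= A <= 10000 -> - e < h < 0 -> Rabs x <= A * M * sp (1 / 8) h ->
    Rabs x <= t).
  { intros A h x HA Hh Hx. apply Rle_trans with (1 := Hx). unfold t.
    assert (S := sp_mono (1 / 8) (- e) h ltac:(lra) ltac:(lra)).
    assert (P := sp_pos (1 / 8) h).
    apply Rmult_le_compat; auto; nra. }
  assert (D : forall n q B f, OO (S n) q B f -> exists f', forall h, oval_level h -> is_derive f h (f' h)).
  { intros n q B f O. apply (OO_smooth _ _ _ _) in O. destruct O as [f' [Df _]].
    exists f'. exact Df. }
  assert (DX : forall a0 a1 a2 a3 a4 a5 n q B f, OO (S n) q B f ->
    exists f', forall h, oval_level h -> is_derive (fun h => ex6 a0 a1 a2 a3 a4 a5 h + f h) h (f' h)).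
  { intros a0 a1 a2 a3 a4 a5 n q B f O. destruct (D _ _ _ _ O) as [f' Df].
    eexists. intros h Hh. apply (is_derive_plus (ex6 a0 a1 a2 a3 a4 a5) f); [|apply Df, Hh].
    apply (ex6_derive _ _ _ _ _ _ 0). unfold oval_level in Hh; lra. }
  destruct (theta_step 5 (15 / 8) M 0 c0 c1 c2 c3 c4 c5
    0 (3 / 4 * c1) c2 (c3 + c2) (5 / 4 * c4) (7 / 4 * c5) E) as [E1 [O1 D1]]; [lra..|exact O0|].
  assert (Z1 := Zeros_rolle _ _ _ D1 (DX _ _ _ _ _ _ _ _ _ _ O1) _ _ Le Z0).
  destruct (theta_step 4 (15 / 8) (3 * M) (3 / 4) 0 (3 / 4 * c1) c2 (c3 + c2) (5 / 4 * c4) (7 / 4 * c5)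
    0 0 (1 / 4 * c2) (1 / 4 * c3 + 5 / 4 * c2) (5 / 8 * c4) (7 / 4 * c5) E1) as [E2 [O2 D2]]; [lra..|exact O1|].
  assert (Z2 := Zeros_rolle _ _ _ D2 (DX _ _ _ _ _ _ _ _ _ _ O2) _ _ Le Z1).
  destruct (theta_step 3 (15 / 8) (3 * (3 * M)) 1 0 0 (1 / 4 * c2) (1 / 4 * c3 + 5 / 4 * c2) (5 / 8 * c4) (7 / 4 * c5)
    0 0 0 (1 / 4 * c2) (5 / 32 * c4) (21 / 16 * c5) E2) as [E3 [O3 D3]]; [lra..|exact O2|].
  assert (Z3 := Zeros_rolle _ _ _ D3 (DX _ _ _ _ _ _ _ _ _ _ O3) _ _ Le Z2).
  (* At this stage [s ln s] and [s] lead at the zero [z], while after one more [theta - 1] only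
     [c2 / 4 * s] leads at [x]. So [c2] is bounded at [x] first and [c3] at [z] afterwards. *)
  destruct (Zeros_pair _ _ _ D3 (DX _ _ _ _ _ _ _ _ _ _ O3) _ _ Le Z2)
    as [z [x [z1 [zx [x0 [Ez Ex]]]]]].
  destruct (theta_step 2 (15 / 8) (3 * (3 * (3 * M))) 1 0 0 0 (1 / 4 * c2) (5 / 32 * c4) (21 / 16 * c5)
    0 0 0 0 (5 / 128 * c4) (63 / 64 * c5) E3) as [E4 [O4 D4]]; [lra..|exact O3|].
  assert (Z4 := Zeros_rolle _ _ _ D4 (DX _ _ _ _ _ _ _ _ _ _ O4) _ _ Le Z3).
  destruct (theta_step 1 (15 / 8) (3 * (3 * (3 * (3 * M)))) (5 / 4) 0 0 0 0 (5 / 128 * c4) (63 / 64 * c5)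
    0 0 0 0 0 (63 / 128 * c5) E4) as [E5 [O5 D5]]; [lra..|exact O4|].
  assert (Z5 := Zeros_rolle _ _ _ D5 (DX _ _ _ _ _ _ _ _ _ _ O5) _ _ Le Z4).
  clear D1 D2 D3 D4 D5 D DX.
  destruct (Zeros_exists _ _ _ Z0) as [x00 [H0 R0]].
  destruct (Zeros_exists _ _ _ Z1) as [x1 [H1 R1]].
  destruct (Zeros_exists _ _ _ Z4) as [x4 [H4 R4]].
  destruct (Zeros_exists _ _ _ Z5) as [x5 [H5 R5]].
  clear Z0 Z1 Z2 Z3 Z4 Z5. unfold ex6 in R0, R1, R4, R5, Ex, Ez.
  cbv beta in R0, R1, R4, R5, Ex, Ez.
  assert (Hz : - e < z < 0) by lra. assert (Hx : - e < x < 0) by lra.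
  assert (C5 : Rabs c5 <= t).
  { apply (Up (243 / (63 / 128)) x5); [lra|exact H5|].
    replace (243 / (63 / 128) * M) with (243 * M / (63 / 128)) by field.
    apply (divide_bound (63 / 128) c5 (7 / 4)); [lra|].
    assert (T := OO_term _ _ (243 * M) (7 / 4) (1 / 8) _ _ (Nr _ H5) O5 ltac:(lra) ltac:(lra)).
    replace (63 / 128 * c5 * sp (7 / 4) x5) with (- E5 x5) by lra.
    rewrite Rabs_Ropp. exact T. }
  assert (C4 : Rabs c4 <= t).
  { apply (Up ((63 / 64 + 81) / (5 / 128)) x4); [lra|exact H4|].
    replace ((63 / 64 + 81) / (5 / 128) * M) with ((63 / 64 + 81) * M / (5 / 128)) by field.
    apply (divide_bound (5 / 128) c4 (5 / 4)); [lra|].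
    assert (T := OO_term _ _ (81 * M) (5 / 4) (1 / 8) _ _ (Nr _ H4) O4 ltac:(lra) ltac:(lra)).
    assert (T5 := term_bound (63 / 64) c5 M (5 / 4) (1 / 8) (7 / 4) _ (Nr _ H4) ltac:(lra) b5 ltac:(lra)).
    replace (5 / 128 * c4 * sp (5 / 4) x4)
      with (- (63 / 64 * c5 * sp (7 / 4) x4 + E4 x4)) by lra.
    rewrite Rabs_Ropp. eapply Rle_trans; [apply Rabs_triang|]. lra. }
  (* The gain is 1/4, the distance from [s] to [s^(5/4)], and not just 1/8: in the estimate of [c3]
     this bound is multiplied by [ln s], which costs 1/8 and must leave 1/8. *)
  assert (C2' : Rabs c2 <= 120 * M * sp (1 / 4) x).
  { replace (120 * M) with (30 * M / (1 / 4)) by field.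
    apply (divide_bound (1 / 4) c2 1); [lra|].
    assert (T := OO_term _ _ (27 * M) 1 (1 / 4) _ _ (Nr _ Hx) O3 ltac:(lra) ltac:(lra)).
    assert (T4 := term_bound (5 / 32) c4 M 1 (1 / 4) (5 / 4) _ (Nr _ Hx) ltac:(lra) b4 ltac:(lra)).
    assert (T5 := term_bound (21 / 16) c5 M 1 (1 / 4) (7 / 4) _ (Nr _ Hx) ltac:(lra) b5 ltac:(lra)).
    replace (1 / 4 * c2 * sp 1 x)
      with (- (5 / 32 * c4 * sp (5 / 4) x + 21 / 16 * c5 * sp (7 / 4) x + E3 x)) by lra.
    assert (P : 0 <= M * (sp 1 x * sp (1 / 4) x)).
    { apply Rmult_le_pos; [lra|]. apply Rmult_le_pos; apply Rlt_le, sp_pos. }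
    rewrite Rabs_Ropp. eapply Rle_trans; [apply Rabs_triang|].
    assert (T' := Rabs_triang (5 / 32 * c4 * sp (5 / 4) x) (21 / 16 * c5 * sp (7 / 4) x)). lra. }
  assert (C2 : Rabs c2 <= t).
  { apply (Up 120 x); [lra|exact Hx|]. apply Rle_trans with (1 := C2').
    apply Rmult_le_compat_l; [lra|]. apply sp_le; lra. }
  assert (C2z : Rabs c2 <= 120 * M * sp (1 / 4) z).
  { apply Rle_trans with (1 := C2'). apply Rmult_le_compat_l; [lra|]. apply sp_mono; lra. }
  assert (C3 : Rabs c3 <= t).
  { apply (Up 6000 z); [lra|exact Hz|].
    replace (6000 * M) with (1500 * M / (1 / 4)) by field.
    apply (divide_bound (1 / 4) c3 1); [lra|].
    assert (T := OO_term _ _ (9 * M) 1 (1 / 8) _ _ (Nr _ Hz) O2 ltac:(lra) ltac:(lra)).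
    assert (T4 := term_bound (5 / 8) c4 M 1 (1 / 8) (5 / 4) _ (Nr _ Hz) ltac:(lra) b4 ltac:(lra)).
    assert (T5 := term_bound (7 / 4) c5 M 1 (1 / 8) (7 / 4) _ (Nr _ Hz) ltac:(lra) b5 ltac:(lra)).
    set (P := sp 1 z * sp (1 / 8) z) in *.
    assert (P0 : 0 <= M * P) by (apply Rmult_le_pos; [lra|]; apply Rmult_le_pos; apply Rlt_le, sp_pos).
    assert (Tl : Rabs (1 / 4 * (c2 * slog z)) <= 240 * (M * P)).
    { rewrite !Rabs_mult, (Rabs_right (1 / 4)) by lra.
      assert (S := slog_abs z (Nr _ Hz)).
      apply Rle_trans with (1 / 4 * ((120 * M * sp (1 / 4) z) * (8 * sp (7 / 8) z))).
      - apply Rmult_le_compat_l; [lra|]. apply Rmult_le_compat; auto using Rabs_pos.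
      - right. unfold P. rewrite sp_add.
        replace (1 + 1 / 8) with (1 / 4 + 7 / 8) by field.
        rewrite <- (sp_add (1 / 4) (7 / 8) z). field. }
    assert (Ts : Rabs (5 / 4 * c2 * sp 1 z) <= 150 * (M * P)).
    { rewrite !Rabs_mult, (Rabs_right (5 / 4)), (Rabs_right (sp 1 z)) by
        (try apply Rle_ge, Rlt_le, sp_pos; lra).
      assert (Q := sp_pos 1 z). assert (S := sp_le (1 / 8) (1 / 4) z ltac:(lra) ltac:(lra)).
      apply Rle_trans with (5 / 4 * (120 * M * sp (1 / 4) z) * sp 1 z).
      - apply Rmult_le_compat_r; lra.
      - unfold P. assert (0 <= M * sp 1 z) by nra.
        assert (M * sp 1 z * sp (1 / 4) z <= M * sp 1 z * sp (1 / 8) z)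
          by (apply Rmult_le_compat_l; lra). lra. }
    replace (1 / 4 * c3 * sp 1 z)
      with (- (1 / 4 * (c2 * slog z) + 5 / 4 * c2 * sp 1 z + 5 / 8 * c4 * sp (5 / 4) z
              + 7 / 4 * c5 * sp (7 / 4) z + E2 z)) by lra.
    rewrite Rabs_Ropp.
    eapply Rle_trans; [apply Rabs_triang|].
    eapply Rle_trans; [apply Rplus_le_compat_r, Rabs_triang|].
    eapply Rle_trans; [apply Rplus_le_compat_r, Rplus_le_compat_r, Rabs_triang|].
    eapply Rle_trans; [apply Rplus_le_compat_r, Rplus_le_compat_r, Rplus_le_compat_r, Rabs_triang|].
    lra. }
  assert (C1 : Rabs c1 <= t).
  { apply (Up ((8 + 2 + 5 / 4 + 7 / 4 + 3) / (3 / 4)) x1); [lra|exact H1|].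
    replace ((8 + 2 + 5 / 4 + 7 / 4 + 3) / (3 / 4) * M)
      with ((8 + 2 + 5 / 4 + 7 / 4 + 3) * M / (3 / 4)) by field.
    apply (divide_bound (3 / 4) c1 (3 / 4)); [lra|].
    assert (T := OO_term _ _ (3 * M) (3 / 4) (1 / 8) _ _ (Nr _ H1) O1 ltac:(lra) ltac:(lra)).
    assert (T3 := term_bound 1 c3 M (3 / 4) (1 / 8) 1 _ (Nr _ H1) ltac:(lra) b3 ltac:(lra)).
    assert (T2 := term_bound 1 c2 M (3 / 4) (1 / 8) 1 _ (Nr _ H1) ltac:(lra) b2 ltac:(lra)).
    assert (T4 := term_bound (5 / 4) c4 M (3 / 4) (1 / 8) (5 / 4) _ (Nr _ H1) ltac:(lra) b4 ltac:(lra)).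
    assert (T5 := term_bound (7 / 4) c5 M (3 / 4) (1 / 8) (7 / 4) _ (Nr _ H1) ltac:(lra) b5 ltac:(lra)).
    set (P := sp (3 / 4) x1 * sp (1 / 8) x1) in *.
    assert (Tl : Rabs (c2 * slog x1) <= 8 * M * P).
    { rewrite Rabs_mult. assert (S := slog_abs x1 (Nr _ H1)).
      apply Rle_trans with (M * (8 * sp (7 / 8) x1)).
      - apply Rmult_le_compat; auto using Rabs_pos.
      - right. unfold P. rewrite sp_add. replace (3 / 4 + 1 / 8) with (7 / 8) by field. ring. }
    replace (3 / 4 * c1 * sp (3 / 4) x1)
      with (- (c2 * slog x1 + 1 * c2 * sp 1 x1 + 1 * c3 * sp 1 x1 + 5 / 4 * c4 * sp (5 / 4) x1
              + 7 / 4 * c5 * sp (7 / 4) x1 + E1 x1)) by lra.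
    rewrite Rabs_Ropp.
    eapply Rle_trans; [apply Rabs_triang|].
    eapply Rle_trans; [apply Rplus_le_compat_r, Rabs_triang|].
    eapply Rle_trans; [apply Rplus_le_compat_r, Rplus_le_compat_r, Rabs_triang|].
    eapply Rle_trans; [apply Rplus_le_compat_r, Rplus_le_compat_r, Rplus_le_compat_r, Rabs_triang|].
    eapply Rle_trans; [apply Rplus_le_compat_r, Rplus_le_compat_r, Rplus_le_compat_r,
      Rplus_le_compat_r, Rabs_triang|].
    lra. }
  assert (C0 : Rabs c0 <= t).
  { apply (Up ((1 + 8 + 1 + 1 + 1 + 1) / 1) x00); [lra|exact H0|].
    replace ((1 + 8 + 1 + 1 + 1 + 1) / 1 * M) with ((1 + 8 + 1 + 1 + 1 + 1) * M / 1) by field.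
    apply (divide_bound 1 c0 0); [lra|].
    assert (T := OO_term _ _ M 0 (1 / 8) _ _ (Nr _ H0) O0 ltac:(lra) ltac:(lra)).
    assert (T1 := term_bound 1 c1 M 0 (1 / 8) (3 / 4) _ (Nr _ H0) ltac:(lra) b1 ltac:(lra)).
    assert (T3 := term_bound 1 c3 M 0 (1 / 8) 1 _ (Nr _ H0) ltac:(lra) b3 ltac:(lra)).
    assert (T4 := term_bound 1 c4 M 0 (1 / 8) (5 / 4) _ (Nr _ H0) ltac:(lra) b4 ltac:(lra)).
    assert (T5 := term_bound 1 c5 M 0 (1 / 8) (7 / 4) _ (Nr _ H0) ltac:(lra) b5 ltac:(lra)).
    assert (Tl : Rabs (c2 * slog x00) <= 8 * M * (sp 0 x00 * sp (1 / 8) x00)).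
    { rewrite Rabs_mult. assert (S := slog_abs x00 (Nr _ H0)).
      apply Rle_trans with (M * (8 * sp (7 / 8) x00)).
      - apply Rmult_le_compat; auto using Rabs_pos.
      - rewrite sp_0. assert (Q := sp_le (1 / 8) (7 / 8) x00 ltac:(lra) ltac:(lra)). nra. }
    set (P := sp 0 x00 * sp (1 / 8) x00) in *.
    replace (1 * c0 * sp 0 x00)
      with (- (1 * c1 * sp (3 / 4) x00 + c2 * slog x00 + 1 * c3 * sp 1 x00
              + 1 * c4 * sp (5 / 4) x00 + 1 * c5 * sp (7 / 4) x00 + E x00))
      by (rewrite sp_0; lra).
    rewrite Rabs_Ropp.
    eapply Rle_trans; [apply Rabs_triang|].
    eapply Rle_trans; [apply Rplus_le_compat_r, Rabs_triang|].
    eapply Rle_trans; [apply Rplus_le_compat_r, Rplus_le_compat_r, Rabs_triang|].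
    eapply Rle_trans; [apply Rplus_le_compat_r, Rplus_le_compat_r, Rplus_le_compat_r, Rabs_triang|].
    eapply Rle_trans; [apply Rplus_le_compat_r, Rplus_le_compat_r, Rplus_le_compat_r,
      Rplus_le_compat_r, Rabs_triang|].
    lra. }
  repeat split; assumption.
Qed.

Lemma Zeros_ext (f g : R -> R) (lo : R) (n : nat) : - (1 / 20) <= lo ->
  (forall h, oval_level h -> f h = g h) -> Zeros f lo n -> Zeros g lo n.
Proof.
  intros Hlo E Z. revert Hlo.
  induction Z as [lo|lo z m n Hz M Zn IH]; intros Hlo; [apply Zeros_nil|].
  apply (Zeros_cons g lo z); [exact Hz| |apply IH; lra].
  apply (vanishes_ext _ f); auto. unfold oval_level; lra.
Qed.

Lemma Zeros_fewer (f : R -> R) (lo : R) (n k : nat) :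
  (k <= n)%nat -> Zeros f lo n -> Zeros f lo k.
Proof.
  intros Hk Z. revert k Hk.
  induction Z as [lo|lo z m n Hz M Zn IH]; intros k Hk.
  - replace k with 0%nat by lia. apply Zeros_nil.
  - destruct (Nat.le_gt_cases k (S m)) as [L|L].
    + destruct k as [|k]; [apply Zeros_nil|].
      rewrite <- (Nat.add_0_r (S k)). apply (Zeros_cons f lo z); [exact Hz| |apply Zeros_nil].
      assert (Lk : (k <= m)%nat) by lia. clear - M Lk.
      induction Lk as [|m' _ IHl]; [exact M|]. apply IHl, vanishes_S, M.
    + replace k with (S m + (k - S m))%nat by lia.
      apply (Zeros_cons f lo z); auto. apply IH. lia.
Qed.

Lemma min_entry (l : list (R * nat)) : l <> nil ->
  exists z m l1 l2, l = l1 ++ (z, m) :: l2 /\ forall e, In e l -> z <= fst e.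
Proof.
  induction l as [|[z m] l IH]; [congruence|]. intros _.
  destruct l as [|e0 l].
  - exists z, m, nil, nil. split; [reflexivity|]. intros e [<-|[]]. simpl; lra.
  - destruct IH as [z' [m' [l1 [l2 [E Hmin]]]]]; [congruence|].
    destruct (Rle_or_lt z z') as [L|L].
    + exists z, m, nil, (e0 :: l). split; [reflexivity|].
      intros e [<-|He]; [simpl; lra|]. specialize (Hmin e He). lra.
    + exists z', m', ((z, m) :: l1), l2. split; [rewrite E; reflexivity|].
      intros e [<-|He]; [simpl; lra|]. exact (Hmin e He).
Qed.

(** [Zeros] lists the zeros from left to right whereas the list has no order, so the least entry is
    extracted at each step. It may sit in the middle, hence the induction on a bound of the length.
    Entries of multiplicity 0 are dropped. *)
Lemma Zeros_of_list (f : R -> R) : (forall n, smooth n f) ->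
  forall (N : nat) (l : list (R * nat)) (lo : R), (length l <= N)%nat ->
  - (1 / 20) <= lo -> NoDup (map fst l) ->
  (forall z m, In (z, m) l -> lo < z < 0 /\ zero_of_order f m z) ->
  Zeros f lo (list_sum (map snd l)).
Proof.
  intros Sf N. induction N as [|N IH]; intros l lo HN Hlo ND Hl.
  { destruct l; [apply Zeros_nil|simpl in HN; lia]. }
  destruct l as [|e0 l0]; [apply Zeros_nil|].
  destruct (min_entry (e0 :: l0)) as [z [m [l1 [l2 [E Hmin]]]]]; [congruence|].
  rewrite E in *. clear E e0 l0.
  rewrite map_app in ND. simpl in ND. assert (ND' := NoDup_remove _ _ _ ND).
  rewrite <- map_app in ND'. destruct ND' as [ND' Nin].
  rewrite length_app in HN. simpl in HN.
  destruct (Hl z m) as [Hz Oz]; [apply in_elt|].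
  assert (Hl' : forall z' m', In (z', m') (l1 ++ l2) -> z < z' < 0 /\ zero_of_order f m' z').
  { intros z' m' Hin.
    assert (Hin' : In (z', m') (l1 ++ (z, m) :: l2)).
    { apply in_app_or in Hin. apply in_or_app. destruct Hin; [left|right; right]; auto. }
    destruct (Hl z' m' Hin') as [Hz' Oz']. split; [|exact Oz'].
    split; [|lra]. destruct (Hmin _ Hin') as [L|L]; [exact L|]. simpl in L.
    exfalso. apply Nin. rewrite L. apply (in_map fst) in Hin. exact Hin. }
  replace (list_sum (map snd (l1 ++ (z, m) :: l2))) with (m + list_sum (map snd (l1 ++ l2)))%nat.
  2: { rewrite !map_app, !list_sum_app. simpl. lia. }
  assert (Z' : Zeros f z (list_sum (map snd (l1 ++ l2)))).
  { apply IH; auto; [rewrite length_app; lia|lra]. }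
  destruct m as [|m].
  - apply (Zeros_lower f z); [lra|exact Z'].
  - apply (Zeros_cons f lo z); auto.
    apply vanishes_of_order; auto. unfold oval_level; lra.
Qed.

(** * Underdetermined linear systems *)

Lemma last_column (A : nat -> nat -> R) (c n : nat) :
  (forall i, (i < n)%nat -> A i c = 0) \/ (exists i, (i < n)%nat /\ A i c <> 0).
Proof.
  induction n as [|n [IH|[i [Hi Hne]]]].
  - left; intros; lia.
  - destruct (Req_dec (A n c) 0) as [E|E].
    + left. intros i Hi. destruct (Nat.eq_dec i n) as [->|]; [exact E|apply IH; lia].
    + right. exists n. split; [lia|exact E].
  - right. exists i. split; [lia|exact Hne].
Qed.

Lemma sum_elim (f g : nat -> R) (c : R) (x : nat -> R) (n : nat) :
  sum_f_R0 (fun j => (f j - c * g j) * x j) n =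
  sum_f_R0 (fun j => f j * x j) n - c * sum_f_R0 (fun j => g j * x j) n.
Proof. induction n as [|n IH]; simpl; [|rewrite IH]; ring. Qed.

(** Gaussian elimination for [n] equations in [n + 1] unknowns. A zero last column makes the last
    unit vector a solution. Otherwise a pivot row [i0] eliminates the last unknown from the other
    rows, enumerated by [sk], and is then solved for it by [v]. *)
Lemma linear_system (n : nat) : forall A : nat -> nat -> R,
  exists x : nat -> R, (exists j, (j <= n)%nat /\ x j <> 0) /\
    forall i, (i < n)%nat -> sum_f_R0 (fun j => A i j * x j) n = 0.
Proof.
  induction n as [|n IH]; intros A.
  { exists (fun _ => 1). split; [exists 0%nat; split; [lia|lra]|intros; lia]. }
  destruct (last_column A (S n) (S n)) as [Hall|[i0 [Hi0 Hne]]].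
  - exists (fun j => if Nat.eq_dec j (S n) then 1 else 0). split.
    + exists (S n). split; [lia|]. destruct (Nat.eq_dec (S n) (S n)); [lra|congruence].
    + intros i Hi. rewrite tech5, Hall by exact Hi.
      rewrite (sum_eq _ (fun _ => 0)).
      * rewrite sum_cte. ring.
      * intros j Hj. destruct (Nat.eq_dec j (S n)); [lia|ring].
  - pose (sk := fun i => if Nat.ltb i i0 then i else S i).
    destruct (IH (fun i j => A (sk i) j - A (sk i) (S n) / A i0 (S n) * A i0 j))
      as [x [[j [Hj Xj]] Hx]].
    set (v := - sum_f_R0 (fun j => A i0 j * x j) n / A i0 (S n)).
    exists (fun j => if Nat.eq_dec j (S n) then v else x j). split.
    + exists j. split; [lia|]. destruct (Nat.eq_dec j (S n)); [lia|exact Xj].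
    + assert (Row : forall i, sum_f_R0 (fun j => A i j * (if Nat.eq_dec j (S n) then v else x j)) (S n)
        = sum_f_R0 (fun j => A i j * x j) n + A i (S n) * v).
      { intros i. rewrite tech5. f_equal.
        - apply sum_eq. intros k Hk. destruct (Nat.eq_dec k (S n)); [lia|reflexivity].
        - destruct (Nat.eq_dec (S n) (S n)); [reflexivity|congruence]. }
      intros i Hi. rewrite Row. destruct (Nat.eq_dec i i0) as [->|Hii].
      * unfold v. field. exact Hne.
      * assert (exists k, (k < n)%nat /\ sk k = i) as [k [Hk <-]].
        { unfold sk. destruct (Nat.ltb i i0) eqn:E.
          - exists i. apply Nat.ltb_lt in E as E'. split; [lia|]. rewrite E. reflexivity.
          - apply Nat.ltb_ge in E. exists (pred i). split; [lia|].
            assert (E' : Nat.ltb (pred i) i0 = false) by (apply Nat.ltb_ge; lia).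
            rewrite E'. lia. }
        specialize (Hx k Hk). cbv beta in Hx. rewrite sum_elim in Hx.
        unfold v. rewrite <- Hx. field. exact Hne.
Qed.

(** * The Chebyshev property near the loop *)

Definition comb (g0 g1 g2 g3 d0 d1 h : R) : R :=
  g0 * Y0 h + g1 * Y1 h + g2 * Y2 h + g3 * Ix 3 h + d0 * (h * Ix 0 h) + d1 * (h * Ix 1 h).

Lemma solve_bound (a x t : R) : a <> 0 -> Rabs (a * x) <= t -> Rabs x <= / Rabs a * t.
Proof.
  intros Ha Hb. rewrite Rabs_mult in Hb. assert (P := Rabs_pos_lt a Ha).
  apply (Rmult_le_reg_l (Rabs a)); [exact P|].
  rewrite <- Rmult_assoc, Rinv_r, Rmult_1_l by lra. exact Hb.
Qed.

Lemma Rabs_mult_le (a x T : R) : Rabs x <= T -> Rabs (a * x) <= Rabs a * T.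
Proof. intros Hx. rewrite Rabs_mult. apply Rmult_le_compat_l; [apply Rabs_pos|exact Hx]. Qed.

Lemma Rabs_plus_le (x y a b : R) : Rabs x <= a -> Rabs y <= b -> Rabs (x + y) <= a + b.
Proof. intros Hx Hy. eapply Rle_trans; [apply Rabs_triang|lra]. Qed.

(** Let [N] be the sum of the absolute values of the parameters. Coefficients and remainder are at
    most [K1 * N], so six zeros make the coefficients at most [K * K1 * N * s^(1/8)]; inverting the
    triangular map gives [N <= K2 * K * K1 * s^(1/8) * N], where the factor of [N] is below 1. *)
Lemma comb_chebyshev : exists e, 0 < e <= 1 / 40 /\
  forall g0 g1 g2 g3 d0 d1, Zeros (comb g0 g1 g2 g3 d0 d1) (- e) 6 ->
    g0 = 0 /\ g1 = 0 /\ g2 = 0 /\ g3 = 0 /\ d0 = 0 /\ d1 = 0.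
Proof.
  destruct expansions as [A [C0 [C1 [C2 [k [a0 [a2 [a3 [b0 [b1 [b2 [b3 [A0 [A1
    [HA [HC0 [HC2 [Hk [HA1 [E0 [E1 [E2 [E3 [E4 E5]]]]]]]]]]]]]]]]]]]]]]]].
  destruct (E0 6%nat) as [B0 O0]. destruct (E1 6%nat) as [B1 O1].
  destruct (E2 6%nat) as [B2 O2]. destruct (E3 6%nat) as [B3 O3].
  destruct (E4 6%nat) as [B4 O4]. destruct (E5 6%nat) as [B5 O5].
  assert (P0 := OO_const_nonneg _ _ _ _ O0). assert (P1 := OO_const_nonneg _ _ _ _ O1).
  assert (P2 := OO_const_nonneg _ _ _ _ O2). assert (P3 := OO_const_nonneg _ _ _ _ O3).
  assert (P4 := OO_const_nonneg _ _ _ _ O4). assert (P5 := OO_const_nonneg _ _ _ _ O5).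
  destruct coefficients_small as [K [HK Small]].
  pose (K1 := B0 + B1 + B2 + B3 + B4 + B5 + Rabs A + Rabs C0 + Rabs C1 + Rabs C2 + Rabs k
    + Rabs a0 + Rabs a2 + Rabs a3 + Rabs b0 + Rabs b1 + Rabs b2 + Rabs b3 + Rabs A0 + Rabs A1).
  (* [r5] and [r3] bound the back substitution: [d0] is found from the coefficient of [s^(7/4)],
     then [d1] from that of [s]. *)
  pose (r5 := / Rabs C0 * (1 + Rabs b0 * / Rabs C0 + Rabs b1 * / Rabs k
    + Rabs b2 * / Rabs C2 + Rabs b3 * / Rabs A)).
  pose (r3 := / Rabs A1 * (1 + Rabs a0 * / Rabs C0 + Rabs C1 * / Rabs k
    + Rabs a2 * / Rabs C2 + Rabs a3 * / Rabs A + Rabs A0 * r5)).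
  pose (K2 := / Rabs C0 + / Rabs k + / Rabs C2 + / Rabs A + r5 + r3).
  (* The interval is fixed before the parameters are introduced; this is the uniformity. *)
  destruct (sp_small (1 / 8) (K2 * (K * K1)) 1) as [h0 [N0 S0]]; [lra|lra|].
  unfold near_loop in N0. exists (- h0). split; [lra|].
  intros g0 g1 g2 g3 d0 d1 Zs. rewrite Ropp_involutive in Zs.
  pose (N := Rabs g0 + Rabs g1 + Rabs g2 + Rabs g3 + Rabs d0 + Rabs d1).
  assert (Q0 := Rabs_pos g0). assert (Q1 := Rabs_pos g1). assert (Q2 := Rabs_pos g2).
  assert (Q3 := Rabs_pos g3). assert (Q4 := Rabs_pos d0). assert (Q5 := Rabs_pos d1).
  assert (R1 := Rabs_pos A). assert (R2 := Rabs_pos C0). assert (R3 := Rabs_pos C1).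
  assert (R4 := Rabs_pos C2). assert (R5 := Rabs_pos k). assert (R6 := Rabs_pos a0).
  assert (R7 := Rabs_pos a2). assert (R8 := Rabs_pos a3). assert (R9 := Rabs_pos b0).
  assert (R10 := Rabs_pos b1). assert (R11 := Rabs_pos b2). assert (R12 := Rabs_pos b3).
  assert (R13 := Rabs_pos A0). assert (R14 := Rabs_pos A1).
  pose (c0 := A * g3). pose (c1 := C0 * g0). pose (c2 := k * g1).
  pose (c3 := a0 * g0 + C1 * g1 + a2 * g2 + a3 * g3 + - A0 * d0 + - A1 * d1).
  pose (c4 := C2 * g2). pose (c5 := b0 * g0 + b1 * g1 + b2 * g2 + b3 * g3 + - C0 * d0).
  assert (OE : OO 6 (15 / 8) (K1 * N)
    (fun h => comb g0 g1 g2 g3 d0 d1 h - ex6 c0 c1 c2 c3 c4 c5 h)).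
  { apply (OO_weaken 6 (15 / 8) (15 / 8) (Rabs g0 * B0 + (Rabs g1 * B1 + (Rabs g2 * B2
      + (Rabs g3 * B3 + (Rabs d0 * B4 + Rabs d1 * B5)))))); [lra| |].
    - unfold N.
      assert (Hb : forall x B, 0 <= x -> B <= K1 -> x * B <= K1 * x)
        by (intros x B Hx HB; rewrite (Rmult_comm x); apply Rmult_le_compat_r; assumption).
      assert (H0 := Hb _ B0 Q0 ltac:(unfold K1; lra)).
      assert (H1 := Hb _ B1 Q1 ltac:(unfold K1; lra)).
      assert (H2 := Hb _ B2 Q2 ltac:(unfold K1; lra)).
      assert (H3 := Hb _ B3 Q3 ltac:(unfold K1; lra)).
      assert (H4 := Hb _ B4 Q4 ltac:(unfold K1; lra)).
      assert (H5 := Hb _ B5 Q5 ltac:(unfold K1; lra)). lra.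
    - eapply OO_ext.
      2: exact (OO_plus _ _ _ _ _ _ (OO_scal _ _ _ g0 _ O0)
        (OO_plus _ _ _ _ _ _ (OO_scal _ _ _ g1 _ O1)
        (OO_plus _ _ _ _ _ _ (OO_scal _ _ _ g2 _ O2)
        (OO_plus _ _ _ _ _ _ (OO_scal _ _ _ g3 _ O3)
        (OO_plus _ _ _ _ _ _ (OO_scal _ _ _ d0 _ O4) (OO_scal _ _ _ d1 _ O5)))))).
      intros h _. cbv beta. unfold comb, ex6, c0, c1, c2, c3, c4, c5. ring. }
  assert (KN : forall u x, Rabs u <= K1 -> Rabs (u * x) <= K1 * Rabs x).
  { intros u x Hu. rewrite Rabs_mult. apply Rmult_le_compat_r; [apply Rabs_pos|exact Hu]. }
  assert (K0 : 0 <= K1) by (unfold K1; lra).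
  assert (Mono : forall x, x <= N -> K1 * x <= K1 * N) by (intros; apply Rmult_le_compat_l; auto).
  destruct (Small (- h0) (K1 * N) c0 c1 c2 c3 c4 c5
    (fun h => comb g0 g1 g2 g3 d0 d1 h - ex6 c0 c1 c2 c3 c4 c5 h))
    as [T0 [T1 [T2 [T3 [T4 T5]]]]].
  - lra.
  - exact OE.
  - unfold c0. eapply Rle_trans; [apply KN; unfold K1; lra|apply Mono; unfold N; lra].
  - unfold c1. eapply Rle_trans; [apply KN; unfold K1; lra|apply Mono; unfold N; lra].
  - unfold c2. eapply Rle_trans; [apply KN; unfold K1; lra|apply Mono; unfold N; lra].
  - unfold c3. eapply Rle_trans; [repeat apply Rabs_plus_le; apply KN;
      rewrite ?Rabs_Ropp; unfold K1; lra|].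
    unfold N. lra.
  - unfold c4. eapply Rle_trans; [apply KN; unfold K1; lra|apply Mono; unfold N; lra].
  - unfold c5. eapply Rle_trans; [repeat apply Rabs_plus_le; apply KN;
      rewrite ?Rabs_Ropp; unfold K1; lra|].
    assert (0 <= K1 * Rabs d1) by (apply Rmult_le_pos; auto). unfold N. lra.
  - rewrite Ropp_involutive. apply (Zeros_ext (comb g0 g1 g2 g3 d0 d1)); [lra| |exact Zs].
    intros; ring.
  - rewrite Ropp_involutive in *.
    set (t := K * (K1 * N) * sp (1 / 8) h0) in *.
    assert (G0 := solve_bound C0 g0 t HC0 T1). assert (G1 := solve_bound k g1 t Hk T2).
    assert (G2 := solve_bound C2 g2 t HC2 T4). assert (G3 := solve_bound A g3 t HA T0).
    assert (G4 : Rabs d0 <= r5 * t).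
    { unfold r5. rewrite Rmult_assoc. apply solve_bound; [exact HC0|].
      replace (C0 * d0) with (- c5 + (b0 * g0 + b1 * g1 + b2 * g2 + b3 * g3))
        by (unfold c5; ring).
      eapply Rle_trans.
      - apply Rabs_plus_le; [rewrite Rabs_Ropp; exact T5|].
        repeat apply Rabs_plus_le; apply Rabs_mult_le; eassumption.
      - right. ring. }
    assert (G5 : Rabs d1 <= r3 * t).
    { unfold r3. rewrite Rmult_assoc. apply solve_bound; [exact HA1|].
      replace (A1 * d1) with (- c3 + (a0 * g0 + C1 * g1 + a2 * g2 + a3 * g3 + - A0 * d0))
        by (unfold c3; ring).
      eapply Rle_trans.
      - apply Rabs_plus_le; [rewrite Rabs_Ropp; exact T3|].
        repeat apply Rabs_plus_le; apply Rabs_mult_le; eassumption.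
      - right. rewrite Rabs_Ropp. ring. }
    assert (NN : N <= K2 * t) by (unfold N, K2; lra).
    assert (N <= 0).
    { apply Rnot_lt_le. intros NP.
      replace (K2 * t) with (N * (K2 * (K * K1) * sp (1 / 8) h0)) in NN by (unfold t; ring).
      assert (NL := Rmult_lt_compat_l N _ _ NP S0). lra. }
    repeat split; apply Rabs_eq_0; unfold N in *; lra.
Qed.

(** The [q] are the coefficients of [I_0, ..., I_3] and the [p] those of the integrals of [y^3 dx]
    and [x y^3 dx]; the fractions come from [J4_reduction]. *)
Definition Mform (q0 q1 q2 q3 p0 p1 h : R) : R :=
  q0 * Ix 0 h + q1 * Ix 1 h + q2 * Ix 2 h
  + (q3 + 3 / 34 * p0 + 105 / 1292 * p1) * Ix 3 h
  + (30 / 17 * p0 + 15 / 323 * p1) * (h * Ix 0 h) + 30 / 19 * p1 * (h * Ix 1 h).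

Lemma M1_Mform (a b : nat -> nat -> R) (h : R) : oval_level h ->
  M1 a b h = Mform (b 0%nat 1%nat + a 1%nat 0%nat) (b 1%nat 1%nat + 2 * a 2%nat 0%nat)
    (b 2%nat 1%nat + 3 * a 3%nat 0%nat) (b 3%nat 1%nat + 4 * a 4%nat 0%nat)
    (b 0%nat 3%nat + a 1%nat 2%nat / 3) (b 1%nat 3%nat + 2 / 3 * a 2%nat 2%nat) h.
Proof.
  intros Hh. rewrite M1_formula by exact Hh.
  destruct (J4_reduction h Hh) as [-> ->]. unfold Mform. field.
Qed.

Lemma Mform_chebyshev : exists e, 0 < e <= 1 / 40 /\
  forall q0 q1 q2 q3 p0 p1, Zeros (Mform q0 q1 q2 q3 p0 p1) (- e) 6 ->
    q0 = 0 /\ q1 = 0 /\ q2 = 0 /\ q3 = 0 /\ p0 = 0 /\ p1 = 0.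
Proof.
  destruct comb_chebyshev as [e [He HC]]. exists e. split; [exact He|].
  intros q0 q1 q2 q3 p0 p1 Z.
  (* Coordinates after [I_0], [I_1], [I_2] are written in [Y0], [Y1], [Y2] and [I_3]. The change is
     triangular, so their vanishing gives that of the original parameters. *)
  destruct (HC q0 (q1 + 2 / 5 * q0) (q2 + 3 / 5 * q1 + 21 / 50 * q0)
    (q3 + 3 / 34 * p0 + 105 / 1292 * p1 + 26 / 25 * q2 + 143 / 125 * q1 + 858 / 625 * q0)
    (30 / 17 * p0 + 15 / 323 * p1) (30 / 19 * p1)) as [? [? [? [? [? ?]]]]].
  - apply (Zeros_ext (Mform q0 q1 q2 q3 p0 p1)); [lra| |exact Z].
    intros h _. unfold Mform, comb, Y0, Y1, Y2. field.
  - lra.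
Qed.

Lemma Ix_smooth (n k : nat) : (k <= 3)%nat -> smooth n (Ix k).
Proof.
  intros Hk. destruct (OO_periods n) as [[B0 O0] [[B1 O1] [[B2 O2] [B3 O3]]]].
  destruct k as [|[|[|[|k]]]]; [| | | |lia]; eapply OO_smooth; eassumption.
Qed.

Lemma M1_smooth (a b : nat -> nat -> R) (n : nat) : smooth n (M1 a b).
Proof.
  eapply smooth_ext; [intros h Hh; symmetry; apply M1_Mform, Hh|]. unfold Mform.
  repeat apply smooth_plus; apply smooth_mult; try apply smooth_const;
    try (apply Ix_smooth; lia); (apply smooth_mult; [apply smooth_id|apply Ix_smooth; lia]).
Qed.

(** * Interpolation and the theorem *)

Definition grid (e : R) (n i : nat) : R := - e * (INR (S i) / INR (S n)).

Lemma grid_range (e : R) (n i : nat) : 0 < e -> (i < n)%nat -> - e < grid e n i < 0.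
Proof.
  intros He Hi. unfold grid.
  assert (P : 0 < INR (S n)) by (apply lt_0_INR; lia).
  assert (Q : 0 < INR (S i)) by (apply lt_0_INR; lia).
  assert (L : INR (S i) < INR (S n)) by (apply lt_INR; lia).
  assert (D0 : 0 < INR (S i) / INR (S n)) by (apply Rdiv_lt_0_compat; auto).
  assert (D1 : INR (S i) / INR (S n) < 1).
  { apply (Rmult_lt_reg_r (INR (S n))); auto. unfold Rdiv.
    rewrite Rmult_assoc, Rinv_l by lra. lra. }
  nra.
Qed.

Lemma grid_inj (e : R) (n i j : nat) : 0 < e -> grid e n i = grid e n j -> i = j.
Proof.
  intros He E. unfold grid in E. assert (P : 0 < INR (S n)) by (apply lt_0_INR; lia).
  apply eq_add_S, INR_eq.
  apply (Rmult_eq_reg_l (- e * / INR (S n))).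
  - unfold Rdiv in E. lra.
  - assert (0 < / INR (S n)) by (apply Rinv_0_lt_compat, P). nra.
Qed.

Lemma grid_nodup (e : R) (n k : nat) : 0 < e -> NoDup (map (grid e n) (seq 0 k)).
Proof.
  intros He. apply NoDup_map_NoDup_ForallPairs; [|apply seq_NoDup].
  intros i j _ _ E. apply (grid_inj e n i j He E).
Qed.

Theorem theorem1p3 :
  (exists eps1 : R,
    0 < eps1 <= 1 / 20 /\
    forall eps0 : R, 0 < eps0 < eps1 ->
      (forall a b : nat -> nat -> R,
        ~ M1_vanishes a b -> at_most_zeros_mult (M1 a b) (- eps0) 0 5) /\
      (exists a b : nat -> nat -> R,
        ~ M1_vanishes a b /\ has_simple_zeros (M1 a b) (- eps0) 0 5)) /\
  (forall a b : nat -> nat -> R,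
    M1_vanishes a b <->
      (a 1%nat 2%nat = - 3 * b 0%nat 3%nat /\
       b 1%nat 1%nat = - 2 * a 2%nat 0%nat /\
       a 1%nat 0%nat = - b 0%nat 1%nat /\
       3 * b 1%nat 3%nat = - 2 * a 2%nat 2%nat /\
       b 2%nat 1%nat = - 3 * a 3%nat 0%nat /\
       b 3%nat 1%nat = - 4 * a 4%nat 0%nat)).
Proof.
  destruct Mform_chebyshev as [e [He Cheb]].
  assert (Six : forall a b, Zeros (M1 a b) (- e) 6 ->
    a 1%nat 2%nat = - 3 * b 0%nat 3%nat /\
    b 1%nat 1%nat = - 2 * a 2%nat 0%nat /\
    a 1%nat 0%nat = - b 0%nat 1%nat /\
    3 * b 1%nat 3%nat = - 2 * a 2%nat 2%nat /\
    b 2%nat 1%nat = - 3 * a 3%nat 0%nat /\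
    b 3%nat 1%nat = - 4 * a 4%nat 0%nat).
  { intros a b Z. apply (Zeros_ext _ _ (- e) _ ltac:(lra) (M1_Mform a b)) in Z.
    apply Cheb in Z. lra. }
  assert (Vanish : forall a b : nat -> nat -> R,
    M1_vanishes a b <->
      (a 1%nat 2%nat = - 3 * b 0%nat 3%nat /\
       b 1%nat 1%nat = - 2 * a 2%nat 0%nat /\
       a 1%nat 0%nat = - b 0%nat 1%nat /\
       3 * b 1%nat 3%nat = - 2 * a 2%nat 2%nat /\
       b 2%nat 1%nat = - 3 * a 3%nat 0%nat /\
       b 3%nat 1%nat = - 4 * a 4%nat 0%nat)).
  { intros a b. split.
    - intros V. apply Six.
      (* An identically vanishing [M1] has zeros at six grid points, and six zeros already force the
         linear conditions. *)
      apply (Zeros_of_list (M1 a b) (M1_smooth a b) 6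
        (map (fun i => (grid e 6 i, 1%nat)) (seq 0 6))); [simpl; lia|lra| |].
      + rewrite map_map. apply grid_nodup. lra.
      + intros z m Hin. apply in_map_iff in Hin. destruct Hin as [i [E Hi]].
        apply in_seq in Hi. injection E as <- <-.
        assert (G := grid_range e 6 i ltac:(lra) ltac:(lia)). split; [exact G|].
        intros k Hk. replace k with 0%nat by lia. apply V. lra.
    - intros [E1 [E2 [E3 [E4 [E5 E6]]]]] h Hh. rewrite M1_Mform by exact Hh.
      rewrite E2, E3, E5, E6.
      replace (b 1%nat 3%nat) with (- (2 / 3) * a 2%nat 2%nat) by lra.
      rewrite E1. unfold Mform. field. }
  assert (Most : forall eps0, 0 < eps0 < e -> forall a b,
    ~ M1_vanishes a b -> at_most_zeros_mult (M1 a b) (- eps0) 0 5).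
  { intros eps0 H0 a b NV l ND Hl. apply Nat.nlt_ge. intros Hlt. apply NV, Vanish, Six.
    apply (Zeros_lower _ (- eps0)); [lra|].
    apply (Zeros_fewer _ _ (list_sum (map snd l))); [lia|].
    apply (Zeros_of_list _ (M1_smooth a b) (length l)); auto; lra. }
  split; [|exact Vanish].
  exists e. split; [lra|]. intros eps0 H0. split; [apply Most, H0|].
  set (z := grid eps0 5).
  set (bas := fun j h => match j with
    | 0%nat => Mform 1 0 0 0 0 0 h | 1%nat => Mform 0 1 0 0 0 0 h
    | 2%nat => Mform 0 0 1 0 0 0 h | 3%nat => Mform 0 0 0 1 0 0 h
    | 4%nat => Mform 0 0 0 0 1 0 h | _ => Mform 0 0 0 0 0 1 h end).
  (* Five interpolation conditions on six coefficients leave a nonzero solution. It is realized with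
     [P_1 = 0] by the six coefficients of [Q_1] that enter [Mform]. *)
  destruct (linear_system 5 (fun i j => bas j (z i))) as [x [[j [Hj Xj]] Hx]].
  set (a := fun _ _ : nat => 0).
  set (b := fun i j : nat => match i, j with
    | 0%nat, 1%nat => x 0%nat | 1%nat, 1%nat => x 1%nat | 2%nat, 1%nat => x 2%nat
    | 3%nat, 1%nat => x 3%nat | 0%nat, 3%nat => x 4%nat | 1%nat, 3%nat => x 5%nat
    | _, _ => 0 end).
  exists a, b.
  assert (NV : ~ M1_vanishes a b).
  { intros V. apply Vanish in V. unfold a, b in V. apply Xj.
    destruct j as [|[|[|[|[|[|j]]]]]]; [lra..|lia]. }
  split; [exact NV|].
  assert (Range : forall i, (i < 5)%nat -> - eps0 < z i < 0)
    by (intros; apply grid_range; [lra|lia]).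
  assert (Zero : forall i, (i < 5)%nat -> M1 a b (z i) = 0).
  { intros i Hi. assert (G := Range i Hi). rewrite M1_Mform by (unfold oval_level; lra).
    rewrite <- (Hx i Hi). unfold a, b. simpl. unfold Mform. field. }
  exists (map z (seq 0 5)). split; [apply grid_nodup; lra|]. split; [reflexivity|].
  intros w Hw. apply in_map_iff in Hw. destruct Hw as [i0 [<- Hi0]]. apply in_seq in Hi0.
  split; [apply Range; lia|]. split; [apply Zero; lia|].
  destruct (M1_smooth a b 1) as [f' [D _]].
  assert (G0 := Range i0 ltac:(lia)).
  exists (f' (z i0)). split; [apply D; unfold oval_level; lra|]. intros E.
  (* If the derivative vanished at [z i0], this list would count that zero twice and reach six,
     above the bound just proved. *)
  assert (Bd := Most eps0 H0 a b NV
    (map (fun i => (z i, if Nat.eq_dec i i0 then 2%nat else 1%nat)) (seq 0 5))).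
  assert (Sum : (list_sum (map snd (map (fun i =>
    (z i, if Nat.eq_dec i i0 then 2%nat else 1%nat)) (seq 0 5))) = 6)%nat).
  { destruct i0 as [|[|[|[|[|i0]]]]]; [reflexivity..|lia]. }
  rewrite Sum in Bd. cut (6 <= 5)%nat; [lia|]. apply Bd.
  - rewrite map_map. apply grid_nodup. lra.
  - intros w m Hin. apply in_map_iff in Hin. destruct Hin as [i [Ei Hi]].
    apply in_seq in Hi. injection Ei as <- <-. split; [apply Range; lia|].
    intros k Hk. destruct k as [|k]; [apply Zero; lia|].
    destruct (Nat.eq_dec i i0) as [->|]; [|lia].
    replace k with 0%nat by lia. simpl.
    transitivity (f' (z i0)); [apply is_derive_unique, D; unfold oval_level; lra|exact E].
Qed.
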